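(* Let $(M,g_M)$ and $(N,g_N)$ be compact oriented riemannian 3-manifolds, let a Lie group $G$ with Lie algebra $\mathfrak g$ act isometrically on $N$, and let $\mu:\mathfrak g\to\Omega^1N$ be a moment map, i.e. an equivariant linear map with $d\mu(X)=\iota_{\nu(X)}V_N$ and $\iota_{\nu(X)}\mu(X)=0$ for all $X\in\mathfrak g$, where $V_N$ is the volume form of $g_N$ and $\nu$ generates the action. Let $P\to M$ be a principal $G$-bundle. Let $\alpha,\beta,\gamma\in\mathbb{R}$ and set $$c_1=1,\quad c_2=1+\alpha^2,\quad c_3=\gamma^2,\quad c_4=9+\beta^2,\quad c_5=2\alpha\gamma,\quad c_6=2(3+\alpha\beta).$$ For a section $\phi$ of $P\times_GN$ and a connection $A$ on $P$ let $$E[\phi,A]=\int_M c_1|d^A\phi|^2+c_2|\phi^{*A}\Sigma|^2+c_3|\phi^{*A}\nu|^2+c_4|\phi^{*A}\mu^\sharp|^2+\bigl\langle c_5\phi^{*A}\nu+c_6\phi^{*A}\mu^\sharp,\phi^{*A}\Sigma\bigr\rangle .$$ Then $$E[\phi,A]\ \ge\ 6\,\mathrm{Vol}(N)\,|\deg_G(\phi)|,\qquad \deg_G(\phi)=\frac{1}{\mathrm{Vol}(N)}\int_M\phi^{*A}(V_N+\mu).$$ If the orientation of $M$ is such that $\deg_G(\phi)\geq0$, equality holds if and only if both BPS equations $$\star_M d^A\phi-\phi^{*A}(\Sigma+3\mu^\sharp)=0,\qquad \phi^{*A}(\alpha\Sigma+\beta\mu^\sharp+\gamma\nu)=0$$ 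hold.
   Context: Definitions. $\nu:\mathfrak g\to\Gamma(TN)$ is $\nu(X)(y)=\frac{d}{dt}|_{t=0}\exp(-tX)\cdot y$. Equivariance of $\mu$ means it intertwines the adjoint action on $\mathfrak g$ and the induced action on $\Omega^1N$. $\mu^\sharp:\mathfrak g\to\Gamma(TN)$ is defined by $g_N(\mu^\sharp(X),v)=\mu(X)(v)$. $\Sigma\in\Omega^2(N,TN)$ is defined by $g_N(u,\Sigma(v,w))=V_N(u,v,w)$ for all $u,v,w\in TN$. Choose a basis $I_a$ of $\mathfrak g$, a local trivialisation of $P$ and local coordinates $y^\rho$ on $N$; $\phi$ is then locally a map $M\to N$, $A=A^aI_a$ a $\mathfrak g$-valued 1-form with curvature $F=F^aI_a$, $F=dA+\frac12[A\wedge A]$. Put $d^A\phi=(d\phi^\rho-A^a\,\nu(I_a)^\rho(\phi))\partial_{y^\rho}$, a section of $T^*M\otimes\phi^*TN$. Equivariant pullbacks: $\phi^{*A}\Sigma=\frac12\Sigma^\lambda_{\rho\sigma}(\phi)\,d^A\phi^\rho\wedge d^A\phi^\sigma\otimes\partial_{y^\lambda}$, $\phi^{*A}\nu=F^a\otimes\nu(I_a)(\phi)$, $\phi^{*A}\mu^\sharp=F^a\otimes\mu^\sharp(I_a)(\phi)$ (all sections of $\Lambda^2M\otimes\phi^*TN$), $\phi^{*A}V_N=\frac16(V_N)_{\rho\sigma\lambda}(\phi)\,d^A\phi^\rho\wedge d^A\phi^\sigma\wedge d^A\phi^\lambda$ and $\phi^{*A}\mu=\mu(I_a)_\rho(\phi)\,F^a\wedge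 d^A\phi^\rho$ (3-forms on $M$). For $\phi^*TN$-valued forms, $\langle\sigma,\tau\rangle=g_N(\sigma\wedge\star_M\tau)$ (a 3-form on $M$, combining wedge product with $g_N$) and $|\sigma|^2=\langle\sigma,\sigma\rangle$.
   Formalization: The action of G on N is additionally assumed to preserve the orientation of N (automatic for connected G); otherwise the volume form is not invariant, and the pullbacks of V_N and Σ, the degree and the BPS equations are not well defined. *)

(* Defs.v *)
(* Tangent vectors and tensors are handled through their components in the
   charts of an atlas; tangent vectors are row vectors, and the derivative in the
   direction v of a map between coordinate spaces is the library's 'D_v f x. *)
From HB Require Import structures.
From mathcomp Require Import all_boot all_order all_algebra.
From mathcomp Require Import all_classical all_reals all_analysis.

Set Implicit Arguments.
Unset Strict Implicit.
Unset Printing Implicit Defensive.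

Import Order.TTheory GRing.Theory Num.Theory numFieldNormedType.Exports.
Local Open Scope classical_set_scope.
Local Open Scope ring_scope.

(* Only meant for open U (differentiability at a point of U then involves the
   values of f on a neighbourhood contained in U) and finite-dimensional V. *)
Fixpoint Ck (R : realType) (V W : normedModType R) (k : nat) (U : set V)
    (f : V -> W) : Prop :=
  match k with
  | 0 => forall x, U x -> {for x, continuous f}
  | k'.+1 => (forall x, U x -> differentiable f x) /\
             (forall v, Ck k' U (fun x => 'D_v f x))
  end.

Definition Cinf (R : realType) (V W : normedModType R) (U : set V)
  (f : V -> W) : Prop := forall k, Ck k U f.

(* cmap is only meaningful on cdom, and cinv on the image of cdom. *)
Record chart (R : realType) (n : nat) (T : topologicalType) := Chart {
  cdom : set T;
  cmap :> T -> 'rV[R]_n;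
  cinv : 'rV[R]_n -> T;
  cdom_open : open cdom;
  cimg_open : open (cmap @` cdom);
  cmapK : forall x, cdom x -> cinv (cmap x) = x;
  cmap_cont : forall x, cdom x -> {for x, continuous cmap};
  cinv_cont : forall xi, (cmap @` cdom) xi -> {for xi, continuous cinv} }.

Record manifold (R : realType) (n : nat) := Manifold {
  mspace :> topologicalType;
  mhausdorff : hausdorff_space mspace;
  msecond_countable : @second_countable mspace;
  atlas : set (chart R n mspace);
  atlas_cover : forall x, exists c, atlas c /\ cdom c x;
  atlas_compat : forall c d, atlas c -> atlas d ->
    Cinf (c @` (cdom c `&` cdom d)) (fun xi => d (cinv c xi)) }.

Definition chart_at (R : realType) (n : nat) (M : manifold R n) (x : M)
  : chart R n M := sval (cid (atlas_cover x)).

(* Smoothness of f on an open set U. *)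
Definition smooth_on (R : realType) (m n : nat) (A : manifold R m)
    (B : manifold R n) (U : set A) (f : A -> B) : Prop :=
  (forall x, U x -> {for x, continuous f}) /\
  (forall a b, atlas a -> atlas b ->
    Cinf (a @` (U `&` cdom a `&` f @^-1` cdom b)) (fun xi => b (f (cinv a xi)))).

(* Smoothness of a map defined on the product manifold A x B. *)
Definition smooth2 (R : realType) (m n p : nat) (A : manifold R m)
    (B : manifold R n) (C : manifold R p) (f : A -> B -> C) : Prop :=
  continuous (fun z : A * B => f z.1 z.2) /\
  (forall a b c, atlas a -> atlas b -> atlas c ->
    Cinf [set z : 'rV[R]_m * 'rV[R]_n | exists x y,
            [/\ cdom a x, cdom b y, cdom c (f x y) & z = (a x, b y)]]
         (fun z => c (f (cinv a z.1) (cinv b z.2)))).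

Definition jacobian_mx (R : realType) (m n : nat) (f : 'rV[R]_m -> 'rV[R]_n)
  (xi : 'rV[R]_m) : 'M[R]_(m, n) :=
  \matrix_(i, j) ('D_(delta_mx 0 i) f xi) 0 j.

(* The atlas defines an orientation of M. *)
Definition oriented (R : realType) (n : nat) (M : manifold R n) : Prop :=
  forall (c d : chart R n M) x, atlas c -> atlas d -> cdom c x -> cdom d x ->
    0 < \det (jacobian_mx (fun xi => d (cinv c xi)) (c x)).

Record metric (R : realType) (n : nat) (M : manifold R n) := Metric {
  gmx : chart R n M -> 'rV[R]_n -> 'M[R]_n;
  gmx_smooth : forall c, atlas c -> Cinf (c @` cdom c) (gmx c);
  gmx_sym : forall c x, atlas c -> cdom c x -> (gmx c (c x))^T = gmx c (c x);
  gmx_pos : forall c x (v : 'rV[R]_n), atlas c -> cdom c x -> v != 0 ->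
    0 < (v *m gmx c (c x) *m v^T) 0 0;
  gmx_compat : forall c d x (v w : 'rV[R]_n),
    atlas c -> atlas d -> cdom c x -> cdom d x ->
    v *m gmx c (c x) *m w^T =
    'D_v (fun xi => d (cinv c xi)) (c x) *m gmx d (d x)
      *m ('D_w (fun xi => d (cinv c xi)) (c x))^T }.

(* An R^m-valued 1-form: its value on the tangent vector with components v in
   the chart c is v *m omx c. *)
Record oneform (R : realType) (n : nat) (M : manifold R n) (m : nat) := OneForm {
  omx :> chart R n M -> 'rV[R]_n -> 'M[R]_(n, m);
  omx_smooth : forall c, atlas c -> Cinf (c @` cdom c) (omx c);
  omx_compat : forall c d x (v : 'rV[R]_n),
    atlas c -> atlas d -> cdom c x -> cdom d x ->
    v *m omx c (c x) = 'D_v (fun xi => d (cinv c xi)) (c x) *m omx d (d x) }.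

(* The Lie algebra is the tangent space at the identity, identified with R^n
   by the chart lchart, whose coordinate vectors form the basis I_a.  The
   exponential map is uniquely determined by lexpD, lexp_cont and lexp_deriv:
   t |-> lexp (t X) is the one-parameter subgroup with initial velocity X. *)
Record lieGroup (R : realType) (n : nat) := LieGroup {
  lman :> manifold R n;
  lmul : lman -> lman -> lman;
  lone : lman;
  linv : lman -> lman;
  lmulA : forall x y z, lmul x (lmul y z) = lmul (lmul x y) z;
  lmul1g : forall x, lmul lone x = x;
  lmulg1 : forall x, lmul x lone = x;
  lmulVg : forall x, lmul (linv x) x = lone;
  lmulgV : forall x, lmul x (linv x) = lone;
  lmul_smooth : smooth2 lmul;
  linv_smooth : smooth_on setT linv;
  lchart : chart R n lman;
  lchart_atlas : atlas lchart;
  lchart_one : cdom lchart lone;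
  lexp : 'rV[R]_n -> lman;
  lexpD : forall (s t : R) X,
    lexp ((s + t) *: X) = lmul (lexp (s *: X)) (lexp (t *: X));
  lexp_cont : forall X, continuous (fun t : R => lexp (t *: X));
  lexp_deriv : forall X,
    is_derive (0 : R) (1 : R) (fun t : R => lchart (lexp (t *: X))) X }.

Definition Ad (R : realType) (n : nat) (G : lieGroup R n) (g : G)
    (X : 'rV[R]_n) : 'rV[R]_n :=
  derive1 (fun t : R => lchart G (lmul (lmul g (lexp G (t *: X))) (linv g))) 0.

(* [X, Y] = d/dt Ad (exp (t X)) Y at t = 0 *)
Definition bracket (R : realType) (n : nat) (G : lieGroup R n)
    (X Y : 'rV[R]_n) : 'rV[R]_n :=
  derive1 (fun t : R => Ad (lexp G (t *: X)) Y) 0.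

Record gaction (R : realType) (n d : nat) (G : lieGroup R n)
    (N : manifold R d) := GAction {
  act :> G -> N -> N;
  act1 : forall y, act (lone G) y = y;
  actM : forall g h y, act (lmul g h) y = act g (act h y);
  act_smooth : smooth2 act }.

Definition isometric (R : realType) (n d : nat) (G : lieGroup R n)
    (N : manifold R d) (rho : gaction G N) (gN : metric N) : Prop :=
  forall g y (k l : chart R d N) (v w : 'rV[R]_d),
    atlas k -> atlas l -> cdom k y -> cdom l (rho g y) ->
    let dg (u : 'rV[R]_d) := 'D_u (fun eta => l (rho g (cinv k eta))) (k y) in
    dg v *m gmx gN l (l (rho g y)) *m (dg w)^T = v *m gmx gN k (k y) *m w^T.

(* Together with isometric: V_N is G-invariant, so that the equivariant
   pullbacks of V_N and Sigma are defined globally. *)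
Definition orientation_preserving (R : realType) (n d : nat)
    (G : lieGroup R n) (N : manifold R d) (rho : gaction G N) : Prop :=
  forall g y (k l : chart R d N), atlas k -> atlas l -> cdom k y ->
    cdom l (rho g y) ->
    0 < \det (jacobian_mx (fun eta => l (rho g (cinv k eta))) (k y)).

(* Components in the chart k of nu(X)(y) = d/dt exp(- t X) . y at t = 0. *)
Definition generator (R : realType) (n d : nat) (G : lieGroup R n)
    (N : manifold R d) (rho : gaction G N) (X : 'rV[R]_n) (k : chart R d N)
    (y : N) : 'rV[R]_d :=
  derive1 (fun t : R => k (rho (lexp G (- t *: X)) y)) 0.

Definition tens1 (R : realType) := 'I_3 -> R.
Definition tens2 (R : realType) := 'I_3 -> 'I_3 -> R.
Definition tens3 (R : realType) := 'I_3 -> 'I_3 -> 'I_3 -> R.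

(* The Levi-Civita symbol, by its Vandermonde formula on indices 0, 1, 2. *)
Definition levi_civita (R : realType) : tens3 R := fun i j k =>
  ((i%:R - j%:R) * (j%:R - k%:R) * (k%:R - i%:R)) / 2.

(* Volume form of the metric g, in a positively oriented basis. *)
Definition volume (R : realType) (g : 'M[R]_3) : tens3 R := fun i j k =>
  Num.sqrt (\det g) * levi_civita R i j k.

Definition wedge11 (R : realType) (a b : tens1 R) : tens2 R := fun i j =>
  a i * b j - a j * b i.

Definition wedge12 (R : realType) (a : tens1 R) (b : tens2 R) : tens3 R :=
  fun i j k => a i * b j k + a j * b k i + a k * b i j.

Definition wedge21 (R : realType) (b : tens2 R) (a : tens1 R) : tens3 R :=
  fun i j k => b i j * a k + b j k * a i + b k i * a j.

Definition star1 (R : realType) (g : 'M[R]_3) (a : tens1 R) : tens2 R :=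
  fun j k => \sum_i \sum_l invmx g l i * a i * volume g l j k.

Definition star2 (R : realType) (g : 'M[R]_3) (b : tens2 R) : tens1 R :=
  fun k => 2^-1 * \sum_i \sum_j \sum_l \sum_m
    invmx g l i * invmx g m j * b i j * volume g l m k.

(* <s, t> = h (s /\ star t), for forms with values in a 3-dimensional space
   with inner product h; the first index is the one of the values. *)
Definition pair1 (R : realType) (g h : 'M[R]_3) (s t : 'I_3 -> tens1 R)
  : tens3 R := fun i j k =>
  \sum_l \sum_m h l m * wedge12 (s l) (star1 g (t m)) i j k.

Definition pair2 (R : realType) (g h : 'M[R]_3) (s t : 'I_3 -> tens2 R)
  : tens3 R := fun i j k =>
  \sum_l \sum_m h l m * wedge21 (s l) (star2 g (t m)) i j k.

Record moment_map (R : realType) (n : nat) (G : lieGroup R n)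
    (N : manifold R 3) (rho : gaction G N) (gN : metric N) := MomentMap {
  mu :> 'rV[R]_n -> oneform N 1;
  mu_linear : forall (a : R) X Y k y, atlas k -> cdom k y ->
    mu (a *: X + Y) k (k y) = a *: mu X k (k y) + mu Y k (k y);
  (* mu (Ad_g X) = (g^-1)^* (mu X) *)
  mu_equivariant : forall g X y k l (v : 'rV[R]_3), atlas k -> atlas l -> cdom k y ->
    cdom l (rho g y) ->
    'D_v (fun eta => l (rho g (cinv k eta))) (k y)
      *m mu (Ad g X) l (l (rho g y)) = v *m mu X k (k y);
  (* d (mu X) = iota_{nu X} V_N *)
  mu_d : forall X k y (i j : 'I_3), atlas k -> cdom k y ->
    'D_(delta_mx 0 i) (fun eta => mu X k eta) (k y) j 0
    - 'D_(delta_mx 0 j) (fun eta => mu X k eta) (k y) i 0 =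
    \sum_l (generator rho X k y) 0 l * volume (gmx gN k (k y)) l i j;
  (* iota_{nu X} (mu X) = 0 *)
  mu_iota : forall X k y, atlas k -> cdom k y ->
    generator rho X k y *m mu X k (k y) = 0 }.

(* A local trivialisation (x, g) |-> tsec x . g over tdom; the G-component of
   its inverse is tfib.  The functions are only meaningful over tdom. *)
Record triv (R : realType) (n m p : nat) (G : lieGroup R n)
    (M : manifold R m) (P : manifold R p) (proj : P -> M) (ract : P -> G -> P)
  := Triv {
  tdom : set M;
  tsec : M -> P;
  tfib : P -> G;
  tdom_open : open tdom;
  tsec_smooth : smooth_on tdom tsec;
  tfib_smooth : smooth_on (proj @^-1` tdom) tfib;
  tsecK : forall x, tdom x -> proj (tsec x) = x;
  tfibK : forall q, tdom (proj q) -> ract (tsec (proj q)) (tfib q) = q }.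

Record principal_bundle (R : realType) (n m : nat) (G : lieGroup R n)
    (M : manifold R m) := PrincipalBundle {
  ptotal :> manifold R (m + n)%N;
  proj : ptotal -> M;
  ract : ptotal -> G -> ptotal;
  proj_smooth : smooth_on setT proj;
  ract_smooth : smooth2 ract;
  ract1 : forall q, ract q (lone G) = q;
  ractM : forall q g h, ract q (lmul g h) = ract (ract q g) h;
  proj_ract : forall q g, proj (ract q g) = proj q;
  ract_free : forall q g, ract q g = q -> g = lone G;
  ptriv : forall x, exists t : triv proj ract, tdom t x }.

Definition bundle_triv (R : realType) (n m : nat) (G : lieGroup R n)
  (M : manifold R m) (P : principal_bundle G M) : Type :=
  triv (@proj R n m G M P) (@ract R n m G M P).

Definition triv_at (R : realType) (n m : nat) (G : lieGroup R n)
  (M : manifold R m) (P : principal_bundle G M) (x : M) : bundle_triv P :=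
  sval (cid (ptriv P x)).

Record connection (R : realType) (n m : nat) (G : lieGroup R n)
    (M : manifold R m) (P : principal_bundle G M) := Connection {
  cform :> oneform P n;
  (* R_g^* omega = Ad_{g^-1} omega *)
  cform_equivariant : forall g q (c d : chart R (m + n) P)
      (v : 'rV[R]_(m + n)),
    atlas c -> atlas d -> cdom c q -> cdom d (ract q g) ->
    'D_v (fun xi => d (ract (cinv c xi) g)) (c q) *m cform d (d (ract q g)) =
    Ad (linv g) (v *m cform c (c q));
  (* omega (d/dt q . exp (t X)) = X *)
  cform_vertical : forall X q (c : chart R (m + n) P), atlas c -> cdom c q ->
    derive1 (fun t : R => c (ract q (lexp G (t *: X)))) 0 *m cform c (c q) = X }.

(* The point [q, y] of P x_G N, as the G-orbit { (q g, g^-1 y) | g }. *)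
Definition assoc_class (R : realType) (n m d : nat) (G : lieGroup R n)
    (M : manifold R m) (P : principal_bundle G M) (N : manifold R d)
    (rho : gaction G N) (z : P * N) : set (P * N) :=
  [set w | exists g, w = (ract z.1 g, rho (linv g) z.2)].

(* A smooth section of P x_G N; over tdom t it has the form x |-> [tsec t x, f x]
   with f the local expression of the section in the trivialisation t. *)
Record assoc_section (R : realType) (n m d : nat) (G : lieGroup R n)
    (M : manifold R m) (P : principal_bundle G M) (N : manifold R d)
    (rho : gaction G N) := AssocSection {
  asec : M -> set (P * N);
  asecP : forall x, exists z, proj z.1 = x /\ asec x = assoc_class rho z;
  asec_smooth : forall (t : bundle_triv P) (f : M -> N),
    (forall x, tdom t x -> asec x (tsec t x, f x)) -> smooth_on (tdom t) f }.

(* If phi x = [q, y] then phi x = [tsec t x, tfib t q . y]. *)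
Definition local_map (R : realType) (n m d : nat) (G : lieGroup R n)
    (M : manifold R m) (P : principal_bundle G M) (N : manifold R d)
    (rho : gaction G N) (phi : assoc_section P rho) (t : bundle_triv P) (x : M)
  : N :=
  let z := sval (cid (asecP phi x)) in rho (tfib t z.1) z.2.

(* The component A_i of the gauge potential A = s^* omega, s = tsec t. *)
Definition local_potential (R : realType) (n m : nat) (G : lieGroup R n)
    (M : manifold R m) (P : principal_bundle G M) (A : connection P)
    (t : bundle_triv P) (c : chart R m M) (i : 'I_m) (xi : 'rV[R]_m)
  : 'rV[R]_n :=
  let q := tsec t (cinv c xi) in
  let k := chart_at q in
  'D_(delta_mx 0 i) (fun zeta => k (tsec t (cinv c zeta))) xi *m A k (k q).

(* F_ij = d_i A_j - d_j A_i + [A_i, A_j], as ([A /\ A] / 2)(v, w) = [A v, A w]. *)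
Definition local_curvature (R : realType) (n m : nat) (G : lieGroup R n)
    (M : manifold R m) (P : principal_bundle G M) (A : connection P)
    (t : bundle_triv P) (c : chart R m M) (i j : 'I_m) (xi : 'rV[R]_m)
  : 'rV[R]_n :=
  'D_(delta_mx 0 i) (local_potential A t c j) xi
  - 'D_(delta_mx 0 j) (local_potential A t c i) xi
  + bracket G (local_potential A t c i xi) (local_potential A t c j xi).

(* Components at a point of M of all the fields occurring in the energy. *)
Record local_fields (R : realType) (n : nat) := LocalFields {
  fg : 'M[R]_3;                   (* g_M *)
  fh : 'M[R]_3;                   (* g_N at phi *)
  fdphi : 'I_3 -> tens1 R;        (* (d^A phi^rho)_i *)
  fF : 'I_n -> tens2 R;           (* F^a_ij *)
  fnu : 'I_n -> 'I_3 -> R;        (* nu(I_a)^rho at phi *)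
  fmu : 'I_n -> 'I_3 -> R }.      (* mu(I_a)_rho at phi *)

Definition fields_at (R : realType) (n : nat) (G : lieGroup R n)
    (M N : manifold R 3) (gM : metric M) (gN : metric N) (rho : gaction G N)
    (mu : moment_map rho gN) (P : principal_bundle G M)
    (phi : assoc_section P rho) (A : connection P) (c : chart R 3 M)
    (t : bundle_triv P) (k : chart R 3 N) (xi : 'rV[R]_3) : local_fields R n :=
  let y := local_map phi t (cinv c xi) in
  let nu_ (a : 'I_n) := generator rho (delta_mx 0 a) k y in
  {| fg := gmx gM c xi;
     fh := gmx gN k (k y);
     fdphi := fun r i =>
       ('D_(delta_mx 0 i) (fun zeta => k (local_map phi t (cinv c zeta))) xi) 0 r
       - \sum_a (local_potential A t c i xi) 0 a * (nu_ a) 0 r;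
     fF := fun a i j => (local_curvature A t c i j xi) 0 a;
     fnu := fun a r => (nu_ a) 0 r;
     fmu := fun a r => mu (delta_mx 0 a) k (k y) r 0 |}.

(* Sigma^l_rs, solution of g_N (u, Sigma (v, w)) = V_N (u, v, w). *)
Definition Sigma (R : realType) (h : 'M[R]_3) : tens3 R := fun l r s =>
  \sum_m invmx h l m * volume h m r s.

Definition pb_Sigma (R : realType) (n : nat) (f : local_fields R n)
  : 'I_3 -> tens2 R := fun l i j =>
  2^-1 * \sum_r \sum_s
    Sigma (fh f) l r s * wedge11 (fdphi f r) (fdphi f s) i j.

Definition pb_nu (R : realType) (n : nat) (f : local_fields R n)
  : 'I_3 -> tens2 R := fun l i j => \sum_a fF f a i j * fnu f a l.

(* mu^sharp (I_a)^l = g_N^lm mu (I_a)_m *)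
Definition pb_mu_sharp (R : realType) (n : nat) (f : local_fields R n)
  : 'I_3 -> tens2 R := fun l i j =>
  \sum_a fF f a i j * \sum_m invmx (fh f) l m * fmu f a m.

Definition pb_volume (R : realType) (n : nat) (f : local_fields R n)
  : tens3 R := fun i j k =>
  6^-1 * \sum_r \sum_s \sum_l volume (fh f) r s l *
    wedge21 (wedge11 (fdphi f r) (fdphi f s)) (fdphi f l) i j k.

Definition pb_mu (R : realType) (n : nat) (f : local_fields R n)
  : tens3 R := fun i j k =>
  \sum_a \sum_r fmu f a r * wedge21 (fF f a) (fdphi f r) i j k.

Definition energy_integrand (R : realType) (n : nat)
    (c1 c2 c3 c4 c5 c6 : R) (f : local_fields R n) : tens3 R := fun i j k =>
  let g := fg f in let h := fh f in
  c1 * pair1 g h (fdphi f) (fdphi f) i j k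
  + c2 * pair2 g h (pb_Sigma f) (pb_Sigma f) i j k
  + c3 * pair2 g h (pb_nu f) (pb_nu f) i j k
  + c4 * pair2 g h (pb_mu_sharp f) (pb_mu_sharp f) i j k
  + pair2 g h (fun l i' j' => c5 * pb_nu f l i' j' + c6 * pb_mu_sharp f l i' j')
      (pb_Sigma f) i j k.

Definition degree_integrand (R : realType) (n : nat) (f : local_fields R n)
  : tens3 R := fun i j k => pb_volume f i j k + pb_mu f i j k.

(* Components of a 3-form in each chart. *)
Definition threeform (R : realType) (M : manifold R 3) : Type :=
  chart R 3 M -> 'rV[R]_3 -> tens3 R.

Record partition_of_unity (R : realType) (n : nat) (M : manifold R n) :=
  PartitionOfUnity {
  pu_size : nat;
  pu_chart : 'I_pu_size -> chart R n M;
  pu_fun : 'I_pu_size -> M -> R;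
  pu_atlas : forall i, atlas (pu_chart i);
  pu_cont : forall i, continuous (pu_fun i);
  pu_ge0 : forall i x, 0 <= pu_fun i x;
  pu_supp : forall i,
    closure [set x | pu_fun i x != 0] `<=` cdom (pu_chart i);
  pu_sum : forall x, \sum_i pu_fun i x = 1 }.

Definition row3 (R : realType) (z : R * R * R) : 'rV[R]_3 :=
  \row_(i < 3) nth 0 [:: z.1.1; z.1.2; z.2] i.

Definition lebesgue3 (R : realType) :=
  ((@lebesgue_measure R \x @lebesgue_measure R) \x @lebesgue_measure R)%E.

(* Integral over M, oriented by its atlas, of w = w_012 dx^0 /\ dx^1 /\ dx^2,
   computed with a partition of unity subordinate to the atlas. *)
Definition int_form (R : realType) (M : manifold R 3)
    (p : partition_of_unity M) (w : threeform M) : R :=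
  \sum_(i < pu_size p)
    let c := pu_chart i in
    Rintegral (@lebesgue3 R) (@row3 R @^-1` (c @` cdom c))
      (fun z => pu_fun i (cinv c (row3 z))
                * w c (row3 z) (inord 0) (inord 1) (inord 2)).

Definition Vol (R : realType) (N : manifold R 3) (gN : metric N)
  (p : partition_of_unity N) : R :=
  int_form p (fun k eta => volume (gmx gN k eta)).

(* The fields in the chart c, with some trivialisation of P near x and some
   chart of N near the value of phi at x. *)
Definition fields_in_chart (R : realType) (n : nat) (G : lieGroup R n)
    (M N : manifold R 3) (gM : metric M) (gN : metric N) (rho : gaction G N)
    (mu : moment_map rho gN) (P : principal_bundle G M)
    (phi : assoc_section P rho) (A : connection P) (c : chart R 3 M)
    (xi : 'rV[R]_3) : local_fields R n :=
  let t := triv_at P (cinv c xi) in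
  fields_at gM mu phi A c t (chart_at (local_map phi t (cinv c xi))) xi.

Definition energy (R : realType) (n : nat) (G : lieGroup R n)
    (M N : manifold R 3) (gM : metric M) (gN : metric N) (rho : gaction G N)
    (mu : moment_map rho gN) (P : principal_bundle G M)
    (pM : partition_of_unity M) (c1 c2 c3 c4 c5 c6 : R)
    (phi : assoc_section P rho) (A : connection P) : R :=
  int_form pM (fun c xi =>
    energy_integrand c1 c2 c3 c4 c5 c6 (fields_in_chart gM mu phi A c xi)).

Definition degree (R : realType) (n : nat) (G : lieGroup R n)
    (M N : manifold R 3) (gM : metric M) (gN : metric N) (rho : gaction G N)
    (mu : moment_map rho gN) (P : principal_bundle G M)
    (pM : partition_of_unity M) (pN : partition_of_unity N)
    (phi : assoc_section P rho) (A : connection P) : R :=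
  (Vol gN pN)^-1 *
  int_form pM (fun c xi => degree_integrand (fields_in_chart gM mu phi A c xi)).

(* star_M d^A phi - phi^{*A} (Sigma + 3 mu^sharp) *)
Definition bps1 (R : realType) (n : nat) (f : local_fields R n)
  : 'I_3 -> tens2 R := fun l i j =>
  star1 (fg f) (fdphi f l) i j - (pb_Sigma f l i j + 3 * pb_mu_sharp f l i j).

(* phi^{*A} (alpha Sigma + beta mu^sharp + gamma nu) *)
Definition bps2 (R : realType) (n : nat) (alpha beta gamma : R)
    (f : local_fields R n) : 'I_3 -> tens2 R := fun l i j =>
  alpha * pb_Sigma f l i j + beta * pb_mu_sharp f l i j + gamma * pb_nu f l i j.

(* An equation between sections of Lambda^2 M (x) phi^*TN holds on M: it holds
   in all charts and all local trivialisations. *)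
Definition vanishes (R : realType) (n : nat) (G : lieGroup R n)
    (M N : manifold R 3) (gM : metric M) (gN : metric N) (rho : gaction G N)
    (mu : moment_map rho gN) (P : principal_bundle G M)
    (phi : assoc_section P rho) (A : connection P)
    (s : local_fields R n -> 'I_3 -> tens2 R) : Prop :=
  forall (x : M) (c : chart R 3 M) (t : bundle_triv P) (k : chart R 3 N),
    atlas c -> cdom c x -> tdom t x -> atlas k -> cdom k (local_map phi t x) ->
    forall l i j, s (fields_at gM mu phi A c t k (c x)) l i j = 0.

(* Main.v *)
(** At each point the energy density is a sum of squares plus a multiple of the
    degree density: with b1, b2 the left-hand sides of the BPS equations,
      e = |b1|^2 + |b2|^2 + 6 phi^*A (V_N + mu).
    The product <phi^*A nu, phi^*A mu#>, which occurs in |b2|^2 but not in e, is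
    zero: polarising iota_nu(X) mu(X) = 0 makes <nu(X), mu#(Y)> antisymmetric in X
    and Y, while <F^a, F^b> is symmetric. Replacing b1 by
    star d^A phi + phi^*A (Sigma + 3 mu#) changes the sign of the last term, so
    integrating yields the bound for either sign of the degree.

    In the case of equality |b1|^2 + |b2|^2 is a nonnegative continuous density of
    vanishing integral, hence zero. That it is a density, and that the BPS
    equations do not depend on the charts and trivialisations, requires the
    curvature to be tensorial. The local curvature is the pullback of
    Omega = dA + [A, A]/2 on P, which is horizontal: differentiating the
    equivariance of A along the fibres gives dA(X, v) = - [X, A(v)]. *)
Require Import Defs.
From HB Require Import structures.
From mathcomp Require Import all_boot all_order all_algebra.
From mathcomp Require Import all_classical all_reals all_analysis.
From mathcomp Require Import ring lra measurable_realfun.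
Set Implicit Arguments.
Unset Strict Implicit.
Unset Printing Implicit Defensive.
Import Order.TTheory GRing.Theory Num.Theory numFieldNormedType.Exports.
Local Open Scope classical_set_scope.
Local Open Scope ring_scope.

Local Notation i0 := (inord 0 : 'I_3).
Local Notation i1 := (inord 1 : 'I_3).
Local Notation i2 := (inord 2 : 'I_3).

(** In dimension three a vector-valued 2-form is a 3x3 matrix ([hat]). In this form star d^A phi and
    the pullbacks of Sigma, nu and mu# lie in one space with one inner product [Q], so the identity
    for the energy density is an expansion by bilinearity. Its only inputs besides <nu, mu#> = 0 are
    <star d^A phi, phi^*A Sigma> = 3 phi^*A V_N and <star d^A phi, phi^*A mu#> = phi^*A mu. The
    obstacle is that [fields_in_chart] chooses a trivialisation of P and a chart of N separately at
    every point, and [local_potential] a chart of P, so that even inside one chart of M no integrand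
    is visibly continuous. The transformation law of the fields therefore serves twice: it replaces
    these choices by fixed ones near a point, which gives continuity, and it carries the vanishing
    of b1 and b2 from one chart to all. The integrals enter only through linearity and positivity
    for a fixed partition of unity. *)

Lemma ord3P (P : 'I_3 -> Prop) : P i0 -> P i1 -> P i2 -> forall i, P i.
Proof.
move=> p0 p1 p2 [[|[|[|//]]] lti].
- by rewrite (_ : Ordinal _ = i0)//; apply/val_inj; rewrite /= inordK.
- by rewrite (_ : Ordinal _ = i1)//; apply/val_inj; rewrite /= inordK.
- by rewrite (_ : Ordinal _ = i2)//; apply/val_inj; rewrite /= inordK.
Qed.

Lemma sum3 (V : nmodType) (F : 'I_3 -> V) : \sum_i F i = F i0 + F i1 + F i2.
Proof.
rewrite !big_ord_recl big_ord0 addr0 addrA.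
by congr (F _ + F _ + F _); apply/val_inj; rewrite /= ?inordK.
Qed.

(** * Three-dimensional linear algebra *)

Section Algebra.
Variable R : realType.
Implicit Types (A g h P : 'M[R]_3) (u v : 'rV[R]_3).

Lemma inord3 : ((i0 == i1) = false) * ((i0 == i2) = false) * ((i1 == i0) = false)
 * ((i1 == i2) = false) * ((i2 == i0) = false) * ((i2 == i1) = false).
Proof. by do !split; apply/negbTE/eqP => /(congr1 val); rewrite /= !inordK. Qed.

Lemma det2 (B : 'M[R]_2) : \det B = B 0 0 * B 1 1 - B 0 1 * B 1 0.
Proof.
rewrite (expand_det_row _ 0) !big_ord_recl big_ord0 /cofactor !det_mx11 !mxE addr0.
rewrite /= expr0 expr1 mul1r mulN1r mulrN.
by congr (B _ _ * B _ _ - B _ _ * B _ _); apply/val_inj.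
Qed.

Lemma det3 A : \det A =
  A i0 i0 * (A i1 i1 * A i2 i2 - A i1 i2 * A i2 i1)
  - A i0 i1 * (A i1 i0 * A i2 i2 - A i1 i2 * A i2 i0)
  + A i0 i2 * (A i1 i0 * A i2 i1 - A i1 i1 * A i2 i0).
Proof.
rewrite (expand_det_row _ i0) sum3 /cofactor !det2 !mxE.
have l00 : lift i0 (0 : 'I_2) = i1 by apply/val_inj; rewrite /= /bump !inordK.
have l01 : lift i0 (1 : 'I_2) = i2 by apply/val_inj; rewrite /= /bump !inordK.
have l10 : lift i1 (0 : 'I_2) = i0 by apply/val_inj; rewrite /= /bump !inordK.
have l11 : lift i1 (1 : 'I_2) = i2 by apply/val_inj; rewrite /= /bump !inordK.
have l20 : lift i2 (0 : 'I_2) = i0 by apply/val_inj; rewrite /= /bump !inordK.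
have l21 : lift i2 (1 : 'I_2) = i1 by apply/val_inj; rewrite /= /bump !inordK.
rewrite ?l00 ?l01 ?l10 ?l11 ?l20 ?l21 !inordK//=.
rewrite /=; ring.
Qed.

Lemma lc_val : forall i j k,  @levi_civita R i j k =
  if [&& i == i0, j == i1 & k == i2] then 1 else
  if [&& i == i1, j == i2 & k == i0] then 1 else
  if [&& i == i2, j == i0 & k == i1] then 1 else
  if [&& i == i0, j == i2 & k == i1] then -1 else
  if [&& i == i2, j == i1 & k == i0] then -1 else
  if [&& i == i1, j == i0 & k == i2] then -1 else 0.
Proof.
apply: ord3P; apply: ord3P; apply: ord3P; rewrite /levi_civita !inord3 !eqxx /= !inordK//; by field.
Qed.

(** With cyclic indices (k, k+1, k+2) is always an even permutation, so the cofactors and the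
    components of 2-forms carry no signs. *)
Definition succ3 (i : 'I_3) : 'I_3 := inord (i.+1 %% 3).

Lemma succ3E : (succ3 i0 = i1) * (succ3 i1 = i2) * (succ3 i2 = i0).
Proof. by do !split; rewrite /succ3 inordK. Qed.

(** Column k holds the coefficients of dx^(k+1) /\ dx^(k+2), indices modulo 3; the row is the index
    of the values. For antisymmetric s these are all independent components, see [hat_eq0]. *)
Definition hat (s : 'I_3 -> tens2 R) : 'M[R]_3 :=
  \matrix_(l, k) s l (succ3 k) (succ3 (succ3 k)).

Definition cof3 A : 'M[R]_3 := \matrix_(i, j)
  (A (succ3 i) (succ3 j) * A (succ3 (succ3 i)) (succ3 (succ3 j))
   - A (succ3 i) (succ3 (succ3 j)) * A (succ3 (succ3 i)) (succ3 j)).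

Lemma mx3P A (B : 'M[R]_3) : (forall i j, A i j = B i j) -> A = B.
Proof. by move=> AB; apply/matrixP. Qed.

Lemma mul_cof3_tr A : cof3 A *m A^T = (\det A)%:M.
Proof.
apply: mx3P; apply: ord3P; apply: ord3P;
  rewrite !mxE sum3 !mxE !succ3E ?inord3 ?eqxx det3 /=; ring.
Qed.

(** Functoriality of the second exterior power. It is a polynomial identity, which matters because
    the matrix of d^A phi may be singular. *)
Lemma cof3M A (B : 'M[R]_3) : cof3 (A *m B) = cof3 A *m cof3 B.
Proof.
apply: mx3P; apply: ord3P; apply: ord3P;
  rewrite !mxE !sum3 !mxE !succ3E /=; ring.
Qed.

Lemma cof3_tr A : cof3 A^T = (cof3 A)^T.
Proof. apply: mx3P => i j; rewrite !mxE; ring. Qed.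

Lemma cof3_unit A : A \in unitmx -> cof3 A = \det A *: (invmx A)^T.
Proof.
move=> uA; have uAT : A^T \in unitmx by rewrite unitmx_tr.
by rewrite -[LHS](mulmxK uAT) mul_cof3_tr mul_scalar_mx trmx_inv.
Qed.

Definition antisym2 (b : tens2 R) := forall i j, b i j = - b j i.

Lemma antisym2_diag b i : antisym2 b -> b i i = 0.
Proof. by move=> /(_ i i) ?; lra. Qed.

Lemma star1_anti g (a : tens1 R) : antisym2 (star1 g a).
Proof.
apply: ord3P; apply: ord3P; rewrite /star1 !sum3 /volume !lc_val !inord3 !eqxx /=; ring.
Qed.

Lemma hat_star1 g (s : 'I_3 -> tens1 R) : g^T = g ->
  hat (fun l => star1 g (s l)) =
  Num.sqrt (\det g) *: ((\matrix_(l, i) s l i) *m invmx g).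
Proof.
move=> gT.
have PT i j : invmx g i j = invmx g j i by rewrite -[in LHS]gT -trmx_inv mxE.
apply: mx3P => l; apply: ord3P; rewrite !mxE !sum3 !mxE /star1 /volume !sum3;
  rewrite !lc_val !succ3E !inord3 !eqxx /= (PT i1 i0) (PT i2 i0) (PT i2 i1); ring.
Qed.

(** Raising both indices of an antisymmetric tensor with g^-1 produces the 2x2 minors of g^-1. *)
Lemma star2E g (b : tens2 R) k : antisym2 b ->
  star2 g b k = Num.sqrt (\det g) *
    \sum_m cof3 (invmx g) k m * b (succ3 m) (succ3 (succ3 m)).
Proof.
move=> ab; move: k; apply: ord3P;
  rewrite /star2 /volume !sum3 !lc_val !mxE !succ3E !inord3 !eqxx /=;
  rewrite (ab i1 i0) (ab i0 i2) (ab i2 i1); set P := invmx g; by field.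
Qed.

(** The coefficient of the 3-form <s, t> for 2-forms with matrices S and T: under [hat] the metric
    on 2-forms is g / det g, and the volume form contributes the factor sqrt (det g). *)
Definition Q g h (S T : 'M[R]_3) := (Num.sqrt (\det g))^-1 * \tr (h *m S *m g *m T^T).

End Algebra.

Section Pointwise.
Variable R : realType.
Implicit Types (g h P : 'M[R]_3) (u v : 'rV[R]_3).

Definition posdef n (g : 'M[R]_n) := forall v : 'rV_n, v != 0 -> 0 < (v *m g *m v^T) 0 0.

Lemma hatD (s t : 'I_3 -> tens2 R) (a b : R) :
  hat (fun l i j => a * s l i j + b * t l i j) = a *: hat s + b *: hat t.
Proof. by apply/matrixP => i j; rewrite !mxE. Qed.

Lemma Q_sym g h (S T : 'M[R]_3) : g^T = g -> h^T = h -> Q g h S T = Q g h T S.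
Proof.
move=> gT hT; rewrite /Q -[in LHS]mxtrace_tr !trmx_mul trmxK gT hT.
by rewrite [in LHS]mulmxA [in LHS]mulmxA mxtrace_mulC !mulmxA.
Qed.

Lemma QDl g h (S S' T : 'M[R]_3) : Q g h (S + S') T = Q g h S T + Q g h S' T.
Proof. by rewrite /Q mulmxDr !mulmxDl mxtraceD mulrDr. Qed.

Lemma QZl g h a (S T : 'M[R]_3) : Q g h (a *: S) T = a * Q g h S T.
Proof. by rewrite /Q -scalemxAr -!scalemxAl mxtraceZ mulrCA. Qed.

Lemma QDr g h (S T T' : 'M[R]_3) : Q g h S (T + T') = Q g h S T + Q g h S T'.
Proof. by rewrite /Q linearD mulmxDr mxtraceD mulrDr. Qed.

Lemma QZr g h a (S T : 'M[R]_3) : Q g h S (a *: T) = a * Q g h S T.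
Proof. by rewrite /Q linearZ -scalemxAr mxtraceZ mulrCA. Qed.

Lemma tr3 (A B C : 'M[R]_3) : \tr (A *m B *m C^T) =
  \sum_l \sum_m A l m * \sum_k B m k * C l k.
Proof.
apply: eq_bigr => l _; rewrite !mxE.
under eq_bigr do rewrite !mxE mulr_suml.
rewrite exchange_big; apply: eq_bigr => m _; rewrite mulr_sumr.
by apply: eq_bigr => k _; rewrite mulrA.
Qed.

(** The Hodge star is an isometry from 1-forms to 2-forms, so |d^A phi|^2 becomes a value of the
    same form [Q] as the other terms of the energy. *)
Lemma pair1E g h (s t : 'I_3 -> tens1 R) : g^T = g -> 0 < \det g ->
  pair1 g h s t i0 i1 i2 =
  Q g h (hat (fun l => star1 g (t l))) (hat (fun l => star1 g (s l))).
Proof.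
move=> gT g0.
have ug : g \in unitmx by rewrite unitmxE unitfE gt_eqF.
have r0 : Num.sqrt (\det g) != 0 by rewrite gt_eqF// sqrtr_gt0.
have -> : pair1 g h s t i0 i1 i2 =
  \tr (h *m hat (fun l => star1 g (t l)) *m (\matrix_(l, i) s l i)^T).
  rewrite tr3; apply: eq_bigr => l _; apply: eq_bigr => m _; congr (_ * _).
  by rewrite /wedge12 sum3 !mxE !succ3E; ring.
rewrite /Q [in RHS](hat_star1 s gT) linearZ /= -!scalemxAr mxtraceZ mulrA mulVf// mul1r.
by rewrite trmx_mul trmx_inv gT mulmxA (mulmxK ug).
Qed.

Lemma star2_unitE g (b : tens2 R) k : g^T = g -> 0 < \det g -> antisym2 b ->
  star2 g b k = (Num.sqrt (\det g))^-1 *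
    \sum_m g k m * b (succ3 m) (succ3 (succ3 m)).
Proof.
move=> gT g0 ab.
have ug : g \in unitmx by rewrite unitmxE unitfE gt_eqF.
have r0 : Num.sqrt (\det g) != 0 by rewrite gt_eqF// sqrtr_gt0.
rewrite star2E// cof3_unit ?unitmx_inv// invmxK det_inv gT.
under eq_bigr do rewrite mxE -mulrA.
rewrite -mulr_sumr mulrA; congr (_ * _).
by rewrite -{2}(sqr_sqrtr (ltW g0)) expr2 invfM mulrA divff// mul1r.
Qed.

Lemma pair2E g h (s t : 'I_3 -> tens2 R) : g^T = g -> 0 < \det g ->
  (forall l, antisym2 (t l)) ->
  pair2 g h s t i0 i1 i2 = Q g h (hat t) (hat s).
Proof.
move=> gT g0 at_.
rewrite /Q -(mulmxA h) tr3 mulr_sumr; apply: eq_bigr => l _.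
rewrite mulr_sumr; apply: eq_bigr => m _; rewrite mulrCA; congr (_ * _).
rewrite /wedge21 !star2_unitE// !sum3 !mxE !sum3 !mxE !succ3E.
rewrite -[in X in _ = _ * X]gT !mxE; ring.
Qed.

End Pointwise.

(** * Completing the squares *)

Section Fields.
Variables (R : realType) (n : nat).
Implicit Types f : local_fields R n.

Definition Umx f : 'M[R]_3 := \matrix_(l, i) fdphi f l i.
Definition Fmx f : 'M[R]_(n, 3) := \matrix_(a, k) fF f a (succ3 k) (succ3 (succ3 k)).
Definition numx f : 'M[R]_(n, 3) := \matrix_(a, r) fnu f a r.
Definition mumx f : 'M[R]_(n, 3) := \matrix_(a, r) fmu f a r.

(** The products d^A phi^r /\ d^A phi^s have the 2x2 minors of the matrix of d^A phi as components;
    the inverse metric raises the index of V_N that becomes the value of Sigma. *)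
Lemma hat_pb_Sigma f : hat (pb_Sigma f) =
  Num.sqrt (\det (fh f)) *: (invmx (fh f) *m cof3 (Umx f)).
Proof.
apply: mx3P => l; apply: ord3P;
rewrite !mxE /pb_Sigma /Sigma /volume /wedge11 !sum3 !lc_val !mxE !succ3E !inord3 !eqxx /=;
set P := invmx _; by field.
Qed.

Lemma hat_pb_nu f : hat (pb_nu f) = (numx f)^T *m Fmx f.
Proof.
apply/matrixP => l k; rewrite !mxE; apply: eq_bigr => a _.
by rewrite !mxE mulrC.
Qed.

Lemma hat_pb_mu_sharp f : hat (pb_mu_sharp f) = invmx (fh f) *m (mumx f)^T *m Fmx f.
Proof.
apply/matrixP => l k; rewrite !mxE; apply: eq_bigr => a _.
rewrite !mxE mulrC; congr (_ * _); apply: eq_bigr => m _; by rewrite !mxE.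
Qed.

Lemma pb_Sigma_anti f l : antisym2 (pb_Sigma f l).
Proof.
move=> i j; rewrite /pb_Sigma -mulrN; congr (_ * _).
rewrite -sumrN; apply: eq_bigr => r _; rewrite -sumrN; apply: eq_bigr => s _.
rewrite /wedge11; ring.
Qed.

Lemma pb_nu_anti f l : (forall a, antisym2 (fF f a)) -> antisym2 (pb_nu f l).
Proof.
move=> aF i j; rewrite /pb_nu -sumrN; apply: eq_bigr => r _.
by rewrite aF mulNr.
Qed.

Lemma pb_mu_sharp_anti f l : (forall a, antisym2 (fF f a)) -> antisym2 (pb_mu_sharp f l).
Proof.
move=> aF i j; rewrite /pb_nu -sumrN; apply: eq_bigr => r _.
by rewrite aF mulNr.
Qed.

Lemma pb_volumeE f : pb_volume f i0 i1 i2 = Num.sqrt (\det (fh f)) * \det (Umx f).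
Proof.
rewrite (det3 (Umx f)) !mxE /pb_volume /volume /wedge21 /wedge11 !sum3 !lc_val !inord3 !eqxx /=.
by field.
Qed.

Lemma pb_muE f : pb_mu f i0 i1 i2 = \tr (mumx f *m Umx f *m (Fmx f)^T).
Proof.
apply: eq_bigr => a _; rewrite !mxE.
under [RHS]eq_bigr do rewrite !mxE mulr_suml.
rewrite [RHS]exchange_big; apply: eq_bigr => r _.
rewrite /wedge21 sum3 !mxE !succ3E; ring.
Qed.

End Fields.

(** * Positive definite matrices *)

Section Cholesky.
Variable R : realType.

(** Induction on the size: the Schur complement [d'] of the upper left entry [a] is again symmetric
    and positive definite. *)
Lemma cholesky n (g : 'M[R]_n) : g^T = g -> posdef g ->
  exists2 L : 'M[R]_n, L \in unitmx & g = L *m L^T.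
Proof.
elim: n g => [|n IHn] g gT gp.
  exists 1%:M; first by rewrite unitmx1.
  by apply/matrixP => -[].
move: g gT gp; rewrite -[n.+1]/(1 + n)%N => g gT gp.
set a := ulsubmx g 0 0; set b := ursubmx g; set d := drsubmx g.
have gE : g = block_mx a%:M b b^T d.
  rewrite -[LHS]submxK -/b -/d; congr block_mx.
    exact: mx11_scalar.
  by rewrite -[in LHS]gT /b trmx_ursub.
have dT : d^T = d by rewrite /d trmx_drsub gT.
have a0 : 0 < a.
  have e0 : row_mx (1%:M : 'M[R]_1) (0 : 'rV[R]_n) != 0.
    apply/eqP => /(congr1 lsubmx); rewrite row_mxKl linear0 => /matrixP/(_ 0 0).
    by rewrite !mxE => /eqP; rewrite oner_eq0.
  have := gp _ e0; rewrite gE mul_row_block !mul0mx !addr0 !mul1mx tr_row_mx.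
  by rewrite mul_row_col trmx1 mulmx1 trmx0 mulmx0 addr0 mxE.
have an0 : a != 0 by rewrite gt_eqF.
pose d' := d - a^-1 *: (b^T *m b).
have d'T : d'^T = d' by rewrite /d' linearB linearZ /= trmx_mul trmxK dT.
have d'p : posdef d'.
  move=> v v0.
  (* The first entry is chosen so that the terms with [b] cancel: the quadratic form of [g] at this
     vector is that of [d'] at [v]. *)
  have e0 : row_mx (- a^-1 *: (v *m b^T)) v != 0.
    apply: contra v0 => /eqP/(congr1 rsubmx); rewrite row_mxKr => ->.
    by rewrite linear0.
  have := gp _ e0; rewrite gE mul_row_block tr_row_mx mul_row_col mul_mx_scalar.
  rewrite scalerA mulrN divff// scaleN1r addNr mul0mx add0r.
  by rewrite /d' mulmxBr -scalemxAr -scalemxAl scaleNr mulmxA addrC.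
have [L uL LE] := IHn _ d'T d'p.
have s0 : Num.sqrt a != 0 by rewrite gt_eqF// sqrtr_gt0.
exists (block_mx (Num.sqrt a)%:M 0 ((Num.sqrt a)^-1 *: b^T) L).
  rewrite unitmxE det_lblock det_scalar expr1 unitfE mulf_neq0//.
  by rewrite -unitfE -unitmxE.
rewrite tr_block_mx mulmx_block !trmx0 !mul0mx !mulmx0 !addr0.
rewrite tr_scalar_mx -scalar_mxM -expr2 sqr_sqrtr ?ltW// linearZ /= trmxK.
rewrite mul_scalar_mx scalerA divff// scale1r mul_mx_scalar scalerA divff// scale1r.
rewrite -LE -scalemxAl -scalemxAr scalerA -invfM -expr2 sqr_sqrtr ?ltW//.
by rewrite /d' addrC subrK.
Qed.

Lemma posdef_det n (g : 'M[R]_n) : g^T = g -> posdef g -> 0 < \det g.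
Proof.
move=> gT gp; have [L uL ->] := cholesky gT gp.
by rewrite det_mulmx det_tr -expr2 exprn_even_gt0// -unitfE -unitmxE uL.
Qed.

(** With g = L L^T and h = H H^T the trace is the sum of the squares of the entries of H^T S L, and
    L and H are invertible. *)
Lemma Q_gt0 g h (S : 'M[R]_3) : g^T = g -> h^T = h -> posdef g -> posdef h ->
  S != 0 -> 0 < Q g h S S.
Proof.
move=> gT hT gp hp S0.
rewrite /Q mulr_gt0// ?invr_gt0 ?sqrtr_gt0 ?posdef_det//.
have [L uL ->] := cholesky gT gp.
have [H uH ->] := cholesky hT hp.
rewrite -!mulmxA mxtrace_mulC !mulmxA.
set T := H^T *m S *m L.
have -> : \tr (H^T *m S *m L *m L^T *m S^T *m H) = \tr (T *m T^T).
  by rewrite /T !trmx_mul trmxK !mulmxA.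
have T0 : T != 0.
  apply: contra S0 => /eqP T0.
  have -> : S = invmx H^T *m T *m invmx L.
    by rewrite /T !mulmxA mulVmx ?unitmx_tr// mul1mx mulmxK.
  by rewrite T0 mulmx0 mul0mx.
clearbody T.
have trE : \tr (T *m T^T) = \sum_i \sum_j T i j ^+ 2.
  by apply: eq_bigr => i _; rewrite mxE; apply: eq_bigr => j _; rewrite mxE expr2.
have ge0 i : 0 <= \sum_j T i j ^+ 2 by apply: sumr_ge0 => j _; exact: sqr_ge0.
rewrite trE lt0r sumr_ge0// andbT; apply: contra T0 => /eqP s0.
apply/eqP/matrixP => i j; rewrite mxE; apply/eqP; rewrite -sqrf_eq0.
have := psumr_eq0P (fun i _ => ge0 i) s0.
by move=> /(_ i isT) /(psumr_eq0P (fun j _ => sqr_ge0 (T i j))) /(_ j isT) ->.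
Qed.

Lemma Q_ge0 g h (S : 'M[R]_3) : g^T = g -> h^T = h -> posdef g -> posdef h ->
  0 <= Q g h S S.
Proof.
move=> gT hT gp hp; have [->|S0] := eqVneq S 0; last exact/ltW/Q_gt0.
by rewrite /Q mulmx0 !mul0mx mxtrace0 mulr0.
Qed.

End Cholesky.

Lemma invmxM (R : comUnitRingType) n (A B : 'M[R]_n) :
  A \in unitmx -> B \in unitmx -> invmx (A *m B) = invmx B *m invmx A.
Proof.
move=> uA uB; have uAB : A *m B \in unitmx by rewrite unitmx_mul uA.
by rewrite -[RHS](mulmxK uAB) !mulmxA (mulmxKV uA) mulVmx// mul1mx.
Qed.

Section Energy.
Variables (R : realType) (n : nat).
Implicit Types f : local_fields R n.

(** What the pointwise algebra requires of the fields. [adm_munu] says that mu(I_a)(nu(I_b)) is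
    antisymmetric in a and b. *)
Record admissible f : Prop := Admissible {
  adm_gT : (fg f)^T = fg f;
  adm_hT : (fh f)^T = fh f;
  adm_gp : posdef (fg f);
  adm_hp : posdef (fh f);
  adm_F : forall a, antisym2 (fF f a);
  adm_munu : (mumx f *m (numx f)^T)^T = - (mumx f *m (numx f)^T) }.

(** The matrix of star d^A phi, according to [hat_star1]. *)
Definition starU f : 'M[R]_3 := Num.sqrt (\det (fg f)) *: (Umx f *m invmx (fg f)).

Lemma energyE c1 c2 c3 c4 c5 c6 f : admissible f ->
  energy_integrand c1 c2 c3 c4 c5 c6 f i0 i1 i2 =
  let q := Q (fg f) (fh f) in let S := hat (pb_Sigma f) in
  let N := hat (pb_nu f) in let M := hat (pb_mu_sharp f) in
  c1 * q (starU f) (starU f) + c2 * q S S + c3 * q N N + c4 * q M M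
  + q S (c5 *: N + c6 *: M).
Proof.
move=> [gT hT gp hp aF _]; have g0 := posdef_det gT gp.
rewrite /energy_integrand pair1E// !pair2E//;
  try by move=> ?; (exact: pb_Sigma_anti || exact: pb_nu_anti || exact: pb_mu_sharp_anti).
by rewrite hatD hat_star1.
Qed.

(** For the matrix U of d^A phi, cof(U) U^T is det U times the identity, with trace 3 det U: the
    pairing with Sigma counts phi^*A V_N three times, the one with mu# counts phi^*A mu once. This
    ratio is the origin of the coefficient 3 in the first BPS equation. *)
Lemma degreeE f : admissible f ->
  degree_integrand f i0 i1 i2 =
  3^-1 * Q (fg f) (fh f) (starU f) (hat (pb_Sigma f))
  + Q (fg f) (fh f) (starU f) (hat (pb_mu_sharp f)).
Proof.
move=> [gT hT gp hp aF _]; have g0 := posdef_det gT gp.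
have h0 := posdef_det hT hp.
have ug : fg f \in unitmx by rewrite unitmxE unitfE gt_eqF.
have uh : fh f \in unitmx by rewrite unitmxE unitfE gt_eqF.
have r0 : Num.sqrt (\det (fg f)) != 0 by rewrite gt_eqF// sqrtr_gt0.
have QU T : Q (fg f) (fh f) (starU f) T = \tr (fh f *m Umx f *m T^T).
  rewrite /Q /starU -scalemxAr -!scalemxAl mxtraceZ mulrA mulVf// mul1r.
  by rewrite mulmxA (mulmxKV ug).
rewrite /degree_integrand pb_volumeE pb_muE !QU hat_pb_Sigma hat_pb_mu_sharp.
congr (_ + _).
  rewrite linearZ /= trmx_mul trmx_inv hT -scalemxAr mxtraceZ.
  rewrite mulmxA mxtrace_mulC !mulmxA mulVmx// mul1mx.
  rewrite -mxtrace_tr trmx_mul trmxK mul_cof3_tr mxtrace_scalar; by field.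
rewrite !trmx_mul trmxK trmx_inv hT !mulmxA [in RHS]mxtrace_mulC !mulmxA mulVmx// mul1mx.
by rewrite [RHS]mxtrace_mulC !mulmxA.
Qed.

Lemma Q_nu_mu_sharp f : admissible f ->
  Q (fg f) (fh f) (hat (pb_nu f)) (hat (pb_mu_sharp f)) = 0.
Proof.
move=> [gT hT gp hp aF munu].
have uh : fh f \in unitmx by rewrite unitmxE unitfE gt_eqF// posdef_det.
rewrite /Q hat_pb_nu hat_pb_mu_sharp; apply/eqP; rewrite mulf_eq0; apply/orP; right.
rewrite !trmx_mul trmxK trmx_inv hT !mulmxA mxtrace_mulC !mulmxA mulVmx// mul1mx.
set N := numx f in munu *; set M := mumx f in munu *; set F := Fmx f.
rewrite mxtrace_mulC !mulmxA.
have : \tr (M *m N^T *m (F *m fg f *m F^T)) = - \tr (M *m N^T *m (F *m fg f *m F^T)).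
  rewrite -[LHS]mxtrace_tr trmx_mul munu !trmx_mul trmxK gT mulmxN linearN /=.
  by rewrite mxtrace_mulC !mulmxA.
by rewrite !mulmxA => /eqP; rewrite -addr_eq0 -mulr2n mulrn_eq0.
Qed.

Lemma hat_bps1 f : (fg f)^T = fg f -> hat (bps1 f) =
  starU f - (hat (pb_Sigma f) + 3 *: hat (pb_mu_sharp f)).
Proof. by move=> gT; rewrite /starU -hat_star1//; apply/matrixP => i j; rewrite !mxE. Qed.

Lemma hat_bps2 alpha beta gamma f : hat (bps2 alpha beta gamma f) =
  alpha *: hat (pb_Sigma f) + beta *: hat (pb_mu_sharp f) + gamma *: hat (pb_nu f).
Proof. by apply/matrixP => i j; rewrite !mxE. Qed.

Lemma bps1_anti f l : (forall a, antisym2 (fF f a)) -> antisym2 (bps1 f l).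
Proof.
move=> aF i j; rewrite /bps1 star1_anti pb_Sigma_anti (pb_mu_sharp_anti _ aF); ring.
Qed.

Lemma bps2_anti alpha beta gamma f l : (forall a, antisym2 (fF f a)) ->
  antisym2 (bps2 alpha beta gamma f l).
Proof.
move=> aF i j; rewrite /bps2 pb_nu_anti// pb_Sigma_anti (pb_mu_sharp_anti _ aF); ring.
Qed.

Lemma hat_eq0 (s : 'I_3 -> tens2 R) : (forall l, antisym2 (s l)) ->
  hat s = 0 <-> forall l i j, s l i j = 0.
Proof.
move=> as_; split=> [h0 l|s0]; last by apply/matrixP => i j; rewrite !mxE s0.
have h k : s l (succ3 k) (succ3 (succ3 k)) = 0.
  by have /matrixP/(_ l k) := h0; rewrite !mxE.
have := h i0; have := h i1; have := h i2; rewrite !succ3E => h01 h20 h12.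
apply: ord3P; apply: ord3P; rewrite ?(antisym2_diag _ (as_ l))// ?h01 ?h20 ?h12//.
- by rewrite as_ h20 oppr0.
- by rewrite as_ h01 oppr0.
- by rewrite as_ h12 oppr0.
Qed.

(** The cross terms of |b1|^2 that contain star d^A phi are - 2 <star d^A phi, Sigma> - 6 <star d^A
    phi, mu#>, which is - 6 times the degree density by [degreeE]. Its cross term 6 <Sigma, mu#> is
    the constant part of c6, its 9 |mu#|^2 that of c4; all terms with alpha, beta and gamma come
    from |b2|^2. *)
Lemma energy_bps alpha beta gamma f : admissible f ->
  energy_integrand 1 (1 + alpha ^+ 2) (gamma ^+ 2) (9 + beta ^+ 2)
    (2 * alpha * gamma) (2 * (3 + alpha * beta)) f i0 i1 i2 =
  Q (fg f) (fh f) (hat (bps1 f)) (hat (bps1 f))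
  + Q (fg f) (fh f) (hat (bps2 alpha beta gamma f)) (hat (bps2 alpha beta gamma f))
  + 6 * degree_integrand f i0 i1 i2.
Proof.
move=> af; rewrite energyE// degreeE// hat_bps1 ?adm_gT// hat_bps2 /=.
have NM := Q_nu_mu_sharp af.
have qs := Q_sym _ _ (adm_gT af) (adm_hT af).
move: NM; move: (starU f) (hat (pb_Sigma f)) (hat (pb_nu f)) (hat (pb_mu_sharp f)).
move=> u S N M NM; rewrite -scaleN1r !(QDl, QDr, QZl, QZr).
rewrite (qs S u) (qs M u) (qs M N) NM (qs M S) (qs N S).
by field.
Qed.

(* The identity behind the bound for negative degree: reversing the sign of
   star d^A phi amounts to reversing the orientation of M. *)
Lemma energy_anti_bps alpha beta gamma f : admissible f ->
  let T := starU f + hat (pb_Sigma f) + 3 *: hat (pb_mu_sharp f) in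
  energy_integrand 1 (1 + alpha ^+ 2) (gamma ^+ 2) (9 + beta ^+ 2)
    (2 * alpha * gamma) (2 * (3 + alpha * beta)) f i0 i1 i2 =
  Q (fg f) (fh f) T T
  + Q (fg f) (fh f) (hat (bps2 alpha beta gamma f)) (hat (bps2 alpha beta gamma f))
  - 6 * degree_integrand f i0 i1 i2.
Proof.
move=> af; rewrite energyE// degreeE// hat_bps2 /=.
have NM := Q_nu_mu_sharp af.
have qs := Q_sym _ _ (adm_gT af) (adm_hT af).
move: NM; move: (starU f) (hat (pb_Sigma f)) (hat (pb_nu f)) (hat (pb_mu_sharp f)).
move=> u S N M NM; rewrite !(QDl, QDr, QZl, QZr).
rewrite (qs S u) (qs M u) (qs M N) NM (qs M S) (qs N S).
by field.
Qed.

(* f' arises from f by a change of coordinates with jacobian K on M and J on N,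
   and a gauge transformation acting on the Lie algebra through B; the jacobians
   act on row vectors. *)
Record related (K J : 'M[R]_3) (B : 'M[R]_n) f f' : Prop := Related {
  rel_K : 0 < \det K;
  rel_J : 0 < \det J;
  rel_g : fg f' = K *m fg f *m K^T;
  rel_h : fh f = J *m fh f' *m J^T;
  rel_U : Umx f' = J^T *m Umx f *m K^T;
  rel_F : forall a i j, fF f' a i j =
     \sum_b B b a * \sum_i' \sum_j' K i i' * K j j' * fF f b i' j';
  rel_nu : B *m numx f' = numx f *m J;
  rel_mu : B *m mumx f' *m J^T = mumx f }.

Section Related.
Variables (K J : 'M[R]_3) (B : 'M[R]_n) (f f' : local_fields R n).
Hypotheses (af : admissible f) (af' : admissible f') (ff' : related K J B f f').

Let uK : K \in unitmx. Proof. by rewrite unitmxE unitfE gt_eqF// (rel_K ff'). Qed.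
Let uJ : J \in unitmx. Proof. by rewrite unitmxE unitfE gt_eqF// (rel_J ff'). Qed.
Let uh : fh f \in unitmx.
Proof. by rewrite unitmxE unitfE gt_eqF// posdef_det ?(adm_hT af)//; exact: adm_hp. Qed.
Let uh' : fh f' \in unitmx.
Proof. by rewrite unitmxE unitfE gt_eqF// posdef_det ?(adm_hT af')//; exact: adm_hp. Qed.
Let ug : fg f \in unitmx.
Proof. by rewrite unitmxE unitfE gt_eqF// posdef_det ?(adm_gT af)//; exact: adm_gp. Qed.

(** Antisymmetry of F reduces the sum over i' and j' to the 2x2 minors of K. *)
Lemma related_Fmx : Fmx f' = \det K *: (B^T *m Fmx f *m invmx K).
Proof.
have -> : \det K *: (B^T *m Fmx f *m invmx K) = B^T *m (Fmx f *m (cof3 K)^T).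
  by rewrite cof3_unit// linearZ /= trmxK -!scalemxAr mulmxA.
apply/matrixP => a k; rewrite !mxE (rel_F ff'); apply: eq_bigr => b _.
rewrite !mxE; congr (_ * _); move: (adm_F af b) => aF.
rewrite !sum3 !mxE !(antisym2_diag _ aF) !succ3E.
rewrite (aF i1 i0) (aF i0 i2) (aF i2 i1); ring.
Qed.

Lemma related_invh : invmx (fh f') = J^T *m invmx (fh f) *m J.
Proof.
have uJT : J^T \in unitmx by rewrite unitmx_tr.
have uJh : J *m fh f' \in unitmx by rewrite unitmx_mul uJ.
rewrite (rel_h ff') !invmxM// -trmx_inv !mulmxA -trmx_mul mulVmx//.
by rewrite trmx1 mul1mx (mulmxKV uJ).
Qed.

Lemma related_sqrt_g : Num.sqrt (\det (fg f')) = \det K * Num.sqrt (\det (fg f)).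
Proof.
rewrite (rel_g ff') !det_mulmx det_tr mulrAC mulrC -expr2 mulrC sqrtrM ?sqr_ge0//.
by rewrite sqrtr_sqr ger0_norm// ltW// (rel_K ff').
Qed.

Lemma related_sqrt_h : Num.sqrt (\det (fh f)) = \det J * Num.sqrt (\det (fh f')).
Proof.
rewrite (rel_h ff') !det_mulmx det_tr mulrAC mulrC -expr2 mulrC sqrtrM ?sqr_ge0//.
by rewrite sqrtr_sqr ger0_norm// ltW// (rel_J ff').
Qed.

(** The TN-valued 2-forms all obey one law, S |-> det K J^T S K^-1: J^T transforms the values, and
    det K K^-1, the transposed cofactor matrix of K, acts on the form index. By linearity the BPS
    expressions inherit it. *)
Lemma related_starU : starU f' = \det K *: (J^T *m starU f *m invmx K).
Proof.
have uKT : K^T \in unitmx by rewrite unitmx_tr.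
have uKg : K *m fg f \in unitmx by rewrite unitmx_mul uK.
rewrite /starU related_sqrt_g -scalerA; congr (_ *: _).
rewrite -scalemxAr -scalemxAl; congr (_ *: _).
rewrite (rel_U ff') (rel_g ff') !invmxM// !mulmxA; congr (_ *m _).
by rewrite (mulmxK uKT).
Qed.

(** The cofactor matrix of J brings in a factor det J, which turns the volume density of [fh f']
    into that of [fh f]. Here the sign of det J matters, since square roots of determinants see only
    its absolute value. *)
Lemma related_Sigma :
  hat (pb_Sigma f') = \det K *: (J^T *m hat (pb_Sigma f) *m invmx K).
Proof.
have uJT : J^T \in unitmx by rewrite unitmx_tr.
rewrite !hat_pb_Sigma related_sqrt_h related_invh (rel_U ff') !cof3M.
rewrite !cof3_tr (cof3_unit uJ) (cof3_unit uK) !linearZ /= !trmxK.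
do 6?rewrite -?scalemxAl -?scalemxAr; rewrite !scalerA; congr (_ *: _); first by ring.
by rewrite !mulmxA (mulmxK uJ).
Qed.

Lemma related_nu :
  hat (pb_nu f') = \det K *: (J^T *m hat (pb_nu f) *m invmx K).
Proof.
rewrite !hat_pb_nu related_Fmx -scalemxAr !mulmxA.
by rewrite -trmx_mul (rel_nu ff') trmx_mul.
Qed.

Lemma related_mu_sharp :
  hat (pb_mu_sharp f') = \det K *: (J^T *m hat (pb_mu_sharp f) *m invmx K).
Proof.
have uJT : J^T \in unitmx by rewrite unitmx_tr.
rewrite !hat_pb_mu_sharp related_Fmx -scalemxAr !mulmxA -(rel_mu ff').
rewrite related_invh; congr (_ *: (_ *m _ *m _)).
by rewrite !trmx_mul trmxK !mulmxA.
Qed.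

Lemma related_bps1 :
  hat (bps1 f') = \det K *: (J^T *m hat (bps1 f) *m invmx K).
Proof.
rewrite !hat_bps1 ?(adm_gT af)// ?(adm_gT af')//.
rewrite related_starU related_Sigma related_mu_sharp.
rewrite mulmxBr mulmxDr mulmxBl mulmxDl scalerBr scalerDr.
by rewrite -!scalemxAr -!scalemxAl !scalerA [3 * _]mulrC.
Qed.

Lemma related_bps2 alpha beta gamma :
  hat (bps2 alpha beta gamma f') =
  \det K *: (J^T *m hat (bps2 alpha beta gamma f) *m invmx K).
Proof.
rewrite !hat_bps2 related_nu related_Sigma related_mu_sharp.
by rewrite !mulmxDr !mulmxDl !scalerDr -!scalemxAr -!scalemxAl !scalerA
  ![_ * \det K]mulrC.
Qed.

(** The two arguments contribute det K twice and sqrt (det g) removes it once; the remaining factor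
    is that of the coefficient of a 3-form. *)
Lemma related_Q (S T : 'M[R]_3) :
  Q (fg f') (fh f') (\det K *: (J^T *m S *m invmx K))
    (\det K *: (J^T *m T *m invmx K)) = \det K * Q (fg f) (fh f) S T.
Proof.
have K0 := rel_K ff'.
have uKT : K^T \in unitmx by rewrite unitmx_tr.
have r0 : Num.sqrt (\det (fg f)) != 0.
  by rewrite gt_eqF// sqrtr_gt0 posdef_det ?(adm_gT af)//; exact: adm_gp.
rewrite QZl QZr /Q related_sqrt_g (rel_g ff').
have -> : \tr (fh f' *m (J^T *m S *m invmx K) *m (K *m fg f *m K^T) *m
    (J^T *m T *m invmx K)^T) = \tr (fh f *m S *m fg f *m T^T).
  rewrite (rel_h ff') !trmx_mul trmxK !mulmxA (mulmxKV uK) trmx_inv (mulmxK uKT).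
  by rewrite [LHS]mxtrace_mulC !mulmxA.
by field; rewrite r0 gt_eqF.
Qed.

Lemma related_energy c1 c2 c3 c4 c5 c6 :
  energy_integrand c1 c2 c3 c4 c5 c6 f' i0 i1 i2 =
  \det K * energy_integrand c1 c2 c3 c4 c5 c6 f i0 i1 i2.
Proof.
rewrite !energyE// related_starU related_Sigma related_nu related_mu_sharp /=.
by rewrite !QDr ![Q _ _ _ (_ *: (hat _))]QZr ![Q _ _ _ (c5 *: _)]QZr
  ![Q _ _ _ (c6 *: _)]QZr !related_Q; ring.
Qed.

Lemma related_degree :
  degree_integrand f' i0 i1 i2 = \det K * degree_integrand f i0 i1 i2.
Proof.
rewrite !degreeE// related_starU related_Sigma related_mu_sharp !related_Q; ring.
Qed.

End Related.

End Energy.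

(** * Derivatives *)

Section Calculus.
Variable R : realType.
Implicit Types V W : normedModType R.

Lemma Cinf_diff V W (U : set V) (f : V -> W) x : Cinf U f -> U x -> differentiable f x.
Proof. by move=> /(_ 1%N) [+ _]; exact. Qed.

Lemma Cinf_cont V W (U : set V) (f : V -> W) x : Cinf U f -> U x -> {for x, continuous f}.
Proof. by move=> /(_ 0%N); exact. Qed.

Lemma Cinf_D V W (U : set V) (f : V -> W) v : Cinf U f -> Cinf U (fun x => 'D_v f x).
Proof. by move=> fU k; have [_] := fU k.+1; exact. Qed.

(** A directional derivative only sees the values along one line, so f and g may live on different
    spaces. *)
Lemma eq_derive V V' W (f : V -> W) (g : V' -> W) a b v w :
  (forall h : R, f (h *: v + a) = g (h *: w + b)) -> 'D_v f a = 'D_w g b.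
Proof.
move=> fg; have fgab : f a = g b by have := fg 0; rewrite !scale0r !add0r.
rewrite /derive; set F := (X in X @ _); set G := (X in _ = lim (X @ _)).
by suff -> : F = G by []; apply/funext => h; rewrite /F /G /= fg fgab.
Qed.

Lemma derive_pairl V V' W (f : V * V' -> W) p u v :
  'D_(v, 0) f (p, u) = 'D_v (fun q => f (q, u)) p.
Proof.
apply: eq_derive => h; congr f.
by congr pair; rewrite /= scaler0 add0r.
Qed.

Lemma derive_pairr V V' W (f : V * V' -> W) p u v :
  'D_(0, v) f (p, u) = 'D_v (fun q => f (p, q)) u.
Proof.
apply: eq_derive => h; congr f.
by congr pair; rewrite /= scaler0 add0r.
Qed.

Lemma Cinf_pairl V V' W (U : set (V * V')) (f : V * V' -> W) u :
  Cinf U f -> Cinf [set p | U (p, u)] (fun p => f (p, u)).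
Proof.
move=> fU k; elim: k f fU => [|k IHk] f fU /=.
  move=> x Ux; apply: (continuous_comp (g := f) (f := fun p => (p, u))).
    by apply: cvg_pair => //; exact: cvg_cst.
  exact: Cinf_cont fU Ux.
split=> [x Ux|v].
  apply: (differentiable_comp (g := f) (f := fun p => (p, u))).
    by apply: differentiable_pair => //; exact: differentiable_cst.
  exact: Cinf_diff fU Ux.
have -> : (fun p => 'D_v (fun q => f (q, u)) p) = (fun p => 'D_(v, 0) f (p, u)).
  by apply/funext => p; rewrite derive_pairl.
exact: (IHk (fun y => 'D_(v, 0) f y)) (Cinf_D _ fU).
Qed.

Lemma differentiable_mxP V m n (A : V -> 'M[R]_(m, n)) x :
  differentiable A x <-> forall i j, differentiable (fun y => A y i j) x.
Proof.
split=> [dA i j|dA].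
  exact: differentiable_comp dA (differentiable_coord _ _ _).
have -> : A = \sum_i \sum_j (fun y => A y i j *: delta_mx i j).
  apply/funext => y; rewrite fct_sumE [LHS]matrix_sum_delta.
  by apply: eq_bigr => i _; rewrite fct_sumE.
apply: differentiable_sum => i; apply: differentiable_sum => j.
exact: differentiableZl.
Qed.

Lemma differentiable_mulmx V m n p (A : V -> 'M[R]_(m, n)) (B : V -> 'M[R]_(n, p)) x :
  differentiable A x -> differentiable B x -> differentiable (fun y => A y *m B y) x.
Proof.
move=> /differentiable_mxP dA /differentiable_mxP dB; apply/differentiable_mxP => i j.
have -> : (fun y => (A y *m B y) i j) = \sum_k ((fun y => A y i k) * (fun y => B y k j)).
  by apply/funext => y; rewrite fct_sumE mxE.
by apply: differentiable_sum => k; exact: differentiableM.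
Qed.

Lemma derive_mulmx V m n p (A : V -> 'M[R]_(m, n)) (B : V -> 'M[R]_(n, p)) x v :
  differentiable A x -> differentiable B x ->
  'D_v (fun y => A y *m B y) x = 'D_v A x *m B x + A x *m 'D_v B x.
Proof.
move=> dA dB.
rewrite !derive_mx; try exact: diff_derivable; try exact/diff_derivable/differentiable_mulmx.
move/differentiable_mxP in dA; move/differentiable_mxP in dB.
apply/matrixP => i j; rewrite !mxE.
have -> : (fun y => (A y *m B y) i j) = \sum_k ((fun y => A y i k) * (fun y => B y k j)).
  by apply/funext => y; rewrite fct_sumE mxE.
rewrite derive_sum; last by move=> k; exact/derivableM/diff_derivable/dB/diff_derivable.
rewrite -big_split; apply: eq_bigr => k _ /=.
rewrite deriveM; [|exact: diff_derivable..].
by rewrite !mxE addrC [B x k j *: _]mulrC.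
Qed.

Lemma is_derive_line V W (f : V -> W) y u (s : R) :
  differentiable f (y + s *: u) ->
  is_derive s 1 (fun t : R => f (y + t *: u)) ('D_u f (y + s *: u)).
Proof.
move=> fd.
have E : (fun h : R => h^-1 *: (((fun t : R => f (y + t *: u)) \o shift s) (h *: 1) - f (y + s *: u)))
  = (fun h => h^-1 *: ((f \o shift (y + s *: u)) (h *: u) - f (y + s *: u))).
  apply/funext => h /=; congr (_ *: (f _ - _)).
  by rewrite [h%:A]mulr1 scalerDl addrCA.
have [] := derivableP (@diff_derivable _ _ _ f _ u fd) => d1 d2.
by split; rewrite /derivable /derive E.
Qed.

Lemma MVT_line V (f : V -> R) y u (t : R) : 0 < t ->
  (forall s, 0 <= s <= t -> differentiable f (y + s *: u)) ->
  exists2 s, 0 < s < t & f (y + t *: u) - f y = t * 'D_u f (y + s *: u).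
Proof.
move=> t0 fd.
have [||] := @MVT R (fun s => f (y + s *: u)) (fun s => 'D_u f (y + s *: u)) 0 t t0.
- move=> s; rewrite in_itv /= => /andP[s0 st]; apply: is_derive_line.
  by apply: fd; rewrite !ltW.
- apply: derivable_within_continuous => s; rewrite in_itv /= => st.
  by have [] := is_derive_line (fd s st).
- move=> s; rewrite in_itv /= => st; rewrite scale0r addr0 subr0 => ->.
  by exists s => //; rewrite mulrC.
Qed.

(** Mean value theorem twice: along v for y |-> f (y + t w) - f y, then along w for the derivative
    of f along v. The second difference is symmetric in v and w, which is what [derive_sym]
    exploits. *)
Let second_difference V (f : V -> R) x v w (e : R) : 0 < e ->
  (forall y, ball x e y -> differentiable f y) ->
  (forall y, ball x e y -> differentiable (fun y => 'D_v f y) y) ->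
  forall t, 0 < t -> t * (`|v| + `|w|) < e ->
  exists2 p, `|p - x| <= t * (`|v| + `|w|) &
    f (x + t *: v + t *: w) - f (x + t *: v) - f (x + t *: w) + f x =
    t * (t * 'D_w (fun y => 'D_v f y) p).
Proof.
move=> e0 fd fdv t t0 te.
have inb a b : 0 <= a <= t -> 0 <= b <= t ->
    `|x + a *: v + b *: w - x| <= t * (`|v| + `|w|).
  move=> /andP[a0 at_] /andP[b0 bt].
  rewrite addrC !addrA addNr add0r (le_trans (ler_normD _ _))// !normrZ !ger0_norm// mulrDr.
  by rewrite lerD// ler_wpM2r.
have inB a b : 0 <= a <= t -> 0 <= b <= t -> ball x e (x + a *: v + b *: w).
  move=> ha hb; rewrite -ball_normE /= distrC; exact: le_lt_trans (inb _ _ ha hb) te.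
have t1 : 0 <= t <= t by rewrite lexx ltW.
have t00 : (0 : R) <= 0 <= t by rewrite lexx ltW.
pose g y := f (y + t *: w) - f y.
have dg s : 0 <= s <= t -> differentiable g (x + s *: v).
  move=> hs; apply: differentiableB.
    apply: (differentiable_comp (f := fun y => y + t *: w)); last exact/fd/inB.
    by apply: differentiableD => //; exact: differentiable_cst.
  by have := inB _ _ hs t00; rewrite scale0r addr0; exact: fd.
have [s /andP[s0 st] gs] := MVT_line t0 dg.
have hs : 0 <= s <= t by rewrite !ltW.
have Dg : 'D_v g (x + s *: v) = 'D_v f (x + s *: v + t *: w) - 'D_v f (x + s *: v).
  have d1 : differentiable f (x + s *: v).
    by have := inB _ _ hs t00; rewrite scale0r addr0; exact: fd.
  rewrite /g deriveB; [|apply: diff_derivable..] => //; last first.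
    apply: (differentiable_comp (f := fun y => y + t *: w)); last exact/fd/inB.
    by apply: differentiableD => //; exact: differentiable_cst.
  by congr (_ - _); apply: eq_derive => h; rewrite !addrA.
have [r /andP[r0 rt] hr] : exists2 r, 0 < r < t &
    'D_v f (x + s *: v + t *: w) - 'D_v f (x + s *: v) =
    t * 'D_w (fun y => 'D_v f y) (x + s *: v + r *: w).
  apply: (MVT_line (f := fun y => 'D_v f y)) => // r hr; exact/fdv/inB.
exists (x + s *: v + r *: w); first by apply: inb => //; rewrite !ltW.
by rewrite -hr -Dg -gs /g opprB addrA addrAC.
Qed.

(** One and the same second difference equals t^2 times either mixed derivative, each at some point
    near x. If the two differed at x, continuity would keep them apart at such points for small
    t. *)
Lemma derive_sym V (f : V -> R) (U : set V) x v w : open U -> U x -> Ck 2 U f ->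
  'D_v (fun y => 'D_w f y) x = 'D_w (fun y => 'D_v f y) x.
Proof.
move=> oU Ux /= [fd fD].
have [e e0 eU] : exists2 e : R, 0 < e & ball x e `<=` U.
  by apply/nbhs_ballP; exact: open_nbhs_nbhs.
have cvw : {for x, continuous (fun y => 'D_v (fun y => 'D_w f y) y)} by exact: ((fD w).2 v x Ux).
have cwv : {for x, continuous (fun y => 'D_w (fun y => 'D_v f y) y)} by exact: ((fD v).2 w x Ux).
apply/eqP/negP => /negP ne.
set a := 'D_v _ x in ne cvw *; set b := 'D_w _ x in ne cwv *.
have d0 : 0 < `|a - b| / 2 by rewrite divr_gt0// normr_gt0 subr_eq0.
have [e1 /= e10 h1] : exists2 e1 : R, 0 < e1 & forall y, ball x e1 y ->
    `|a - 'D_v (fun y => 'D_w f y) y| < `|a - b| / 2.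
  by apply/nbhs_ballP; move/cvgrPdist_lt: cvw => /(_ _ d0).
have [e2 /= e20 h2] : exists2 e2 : R, 0 < e2 & forall y, ball x e2 y ->
    `|b - 'D_w (fun y => 'D_v f y) y| < `|a - b| / 2.
  by apply/nbhs_ballP; move/cvgrPdist_lt: cwv => /(_ _ d0).
pose m := Num.min e (Num.min e1 e2).
have m0 : 0 < m by rewrite !lt_min e0 e10.
(* The summand 1 keeps [K] positive when v = w = 0 and makes t (|v| + |w|) strictly smaller than
   [m]. *)
pose K := `|v| + `|w| + 1.
have K0 : 0 < K by rewrite ltr_wpDl// addr_ge0.
pose t := m / K.
have t0 : 0 < t by rewrite divr_gt0.
have tm : t * (`|v| + `|w|) < m.
  by rewrite /t -mulrA gtr_pMr// mulrC ltr_pdivrMr// mul1r /K ltrDl.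
have [mE [m1 m2]] : m <= e /\ m <= e1 /\ m <= e2 by rewrite /m !ge_min !lexx !orbT.
have [p pb pE] := second_difference e0 (fun y Hy => fd y (eU y Hy))
  (fun y Hy => (fD v).1 y (eU y Hy)) t0 (lt_le_trans tm mE).
have tm' : t * (`|w| + `|v|) < m by rewrite addrC.
have [q qb qE] := second_difference e0 (fun y Hy => fd y (eU y Hy))
  (fun y Hy => (fD w).1 y (eU y Hy)) t0 (lt_le_trans tm' mE).
have pq : 'D_w (fun y => 'D_v f y) p = 'D_v (fun y => 'D_w f y) q.
  apply: (mulfI (lt0r_neq0 t0)); apply: (mulfI (lt0r_neq0 t0)).
  apply: (etrans (esym pE)); apply: (etrans _ qE).
  by rewrite (addrAC x); congr (_ + _); exact: addrAC.
have qa := h1 q; have pbb := h2 p.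
have {}qa : `|a - 'D_v (fun y => 'D_w f y) q| < `|a - b| / 2.
  by apply: qa; rewrite -ball_normE /= distrC (le_lt_trans qb)// (lt_le_trans tm').
have {}pbb : `|b - 'D_w (fun y => 'D_v f y) p| < `|a - b| / 2.
  by apply: pbb; rewrite -ball_normE /= distrC (le_lt_trans pb)// (lt_le_trans tm).
have := ltrD qa pbb; rewrite -splitr pq [X in _ + X < _]distrC => /(le_lt_trans (ler_normD _ _)).
by rewrite addrA subrK ltxx.
Qed.

Lemma near_eq_differentiable V W (f g : V -> W) x :
  (\forall y \near x, f y = g y) -> differentiable f x -> differentiable g x.
Proof.
move=> fg df; have fgx : f x = g x by exact: (nbhs_singleton fg).
have E : g \o shift x = cst (g x) + 'd f x +o_ (0 : V) id.
  apply/eqaddoP => e e0; have /eqaddoP /(_ _ e0) := diff_locally df.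
  have : \forall y \near 0, f (y + x) = g (y + x).
    by move: fg; rewrite (near_shift 0 x); apply: filterS => y; rewrite /= subr0.
  apply: filterS2 => y fgy; rewrite !fctE /= -fgx -fgy; exact.
apply/diff_locallyP; rewrite (diff_unique (diff_continuous df) E).
split => //; exact: diff_continuous.
Qed.

Lemma eq_Ck V W (f g : V -> W) (U : set V) k : open U ->
  (forall y, U y -> f y = g y) -> Ck k U f -> Ck k U g.
Proof.
move=> oU; have nU x : U x -> \forall y \near x, U y by move=> Ux; exact: open_nbhs_nbhs.
elim: k f g => [|k IHk] f g fg /=.
  move=> fU x Ux; have fgx : \forall y \near x, f y = g y.
    by near=> y; apply: fg; near: y; exact: nU.
  rewrite /prop_for /continuous_at -(fg _ Ux).
  by apply: cvg_trans (fU x Ux); exact: near_eq_cvg.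
move=> [fd fD]; split=> [x Ux|v].
  have h : \forall y \near x, f y = g y by near=> y; apply: fg; near: y; exact: nU.
  exact: near_eq_differentiable h (fd x Ux).
apply: IHk (fD v) => y Uy; apply: near_eq_derive.
by near=> z; apply: fg; near: z; exact: nU.
Unshelve. all: by end_near. Qed.

Lemma derive_coord V m n (f : V -> 'M[R]_(m, n)) x v i j :
  differentiable f x -> 'D_v (fun y => f y i j) x = 'D_v f x i j.
Proof. by move=> df; rewrite derive_mx ?mxE//; exact: diff_derivable. Qed.

Lemma Ck_coord V m n (f : V -> 'M[R]_(m, n)) (U : set V) k i j :
  open U -> Ck k U f -> Ck k U (fun y => f y i j).
Proof.
move=> oU; elim: k f => [|k IHk] f /=.
  move=> fU x Ux; apply: (continuous_comp (g := fun A : 'M[R]_(m, n) => A i j)).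
    exact: fU.
  exact: coord_continuous.
move=> [fd fD]; split=> [x Ux|v].
  by have /differentiable_mxP := fd x Ux; exact.
apply: eq_Ck (IHk _ (fD v)) => // y Uy.
by rewrite derive_coord//; exact: fd.
Qed.

Lemma derive_sym_mx V m n (f : V -> 'M[R]_(m, n)) (U : set V) x v w :
  open U -> U x -> Ck 2 U f ->
  'D_v (fun y => 'D_w f y) x = 'D_w (fun y => 'D_v f y) x.
Proof.
move=> oU Ux fU; have [fd fD] := fU; apply/matrixP => i j.
have D u u' : 'D_u (fun y => 'D_u' f y) x i j = 'D_u (fun y => 'D_u' (fun z => f z i j) y) x.
  have d : differentiable (fun y => 'D_u' f y) x by exact: ((fD u').1 x Ux).
  rewrite -(derive_coord u i j d); apply: near_eq_derive.
  have : \forall y \near x, U y by exact: open_nbhs_nbhs.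
  by apply: filterS => y Uy; rewrite derive_coord//; exact: fd.
refine (etrans (D v w) _).
refine (etrans _ (esym (D w v))).
exact: (@derive_sym V (fun z => f z i j) U x v w oU Ux (Ck_coord i j oU fU)).
Qed.

(** The exterior derivative of the 1-form with coefficients [om], on u and v extended as constant
    vector fields, whose Lie bracket vanishes. *)
Definition dform p q (om : 'rV[R]_p -> 'M[R]_(p, q)) x (u v : 'rV[R]_p) : 'rV[R]_q :=
  v *m 'D_u om x - u *m 'D_v om x.

(** Pullback commutes with d: in the product rule the second derivatives of psi appear once with
    each sign and cancel by symmetry. *)
Lemma dform_pullback V p q (psi : V -> 'rV[R]_p) (om : 'rV[R]_p -> 'M[R]_(p, q))
    (U : set V) x v w :
  open U -> U x -> Ck 2 U psi -> differentiable om (psi x) ->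
  'D_v (fun y => 'D_w psi y *m om (psi y)) x - 'D_w (fun y => 'D_v psi y *m om (psi y)) x
  = dform om (psi x) ('D_v psi x) ('D_w psi x).
Proof.
move=> oU Ux pU dom; have [pd pD] := pU.
have dp := pd x Ux.
have dc : differentiable (fun y => om (psi y)) x by exact: differentiable_comp.
have D u : 'D_u (fun y => om (psi y)) x = 'D_('D_u psi x) om (psi x).
  by rewrite !deriveE// (diff_comp dp dom).
rewrite !derive_mulmx//; [|exact: (pD _).1..].
rewrite !D (derive_sym_mx v w oU Ux pU) /dform opprD addrACA subrr add0r.
by [].
Qed.

(* The values are passed as equations, since rewriting inside iterated
   derivatives is expensive. *)
Lemma dform_pullback_eq V p q (psi : V -> 'rV[R]_p) (om : 'rV[R]_p -> 'M[R]_(p, q))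
    (U : set V) x v w a b y v' w' :
  open U -> U x -> Ck 2 U psi -> psi x = y -> differentiable om y ->
  'D_v psi x = v' -> 'D_w psi x = w' ->
  'D_v (fun z => 'D_w psi z *m om (psi z)) x = a ->
  'D_w (fun z => 'D_v psi z *m om (psi z)) x = b ->
  dform om y v' w' = a - b.
Proof. by move=> oU Ux pU <- dom <- <- <- <-; rewrite -(dform_pullback v w oU Ux pU dom). Qed.

End Calculus.

Lemma pair_cont (S T U : topologicalType) (f : S -> T) (g : S -> U) x :
  {for x, continuous f} -> {for x, continuous g} ->
  {for x, continuous (fun v => (f v, g v))}.
Proof. by move=> fc gc; exact: cvg_pair. Qed.

(** * Maps between manifolds and their differentials *)

Section Manifolds.
Variable R : realType.
Implicit Types V : normedModType R.

Lemma near_open (S T : topologicalType) (f : S -> T) (U : set T) x :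
  {for x, continuous f} -> open U -> U (f x) -> \forall y \near x, U (f y).
Proof. by move=> fx oU Ufx; apply: fx; exact: open_nbhs_nbhs. Qed.

Lemma chartK n (T : topologicalType) (c : chart R n T) xi :
  (c @` cdom c) xi -> cdom c (cinv c xi) /\ c (cinv c xi) = xi.
Proof. by move=> [x xc <-]; rewrite cmapK. Qed.

Lemma near_cdom n (T : topologicalType) (c : chart R n T) x : cdom c x ->
  \forall y \near x, cdom c y.
Proof. by move=> cx; apply: open_nbhs_nbhs; split => //; exact: cdom_open. Qed.

Lemma near_cimg n (T : topologicalType) (c : chart R n T) x : cdom c x ->
  \forall y \near c x, (c @` cdom c) y.
Proof. by move=> cx; apply: open_nbhs_nbhs; split; [exact: cimg_open|exists x]. Qed.

Lemma cinv_cont_at n (T : topologicalType) (c : chart R n T) x : cdom c x ->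
  {for c x, continuous (cinv c)}.
Proof. by move=> cx; apply: cinv_cont; exists x. Qed.

Lemma open_chart_image n (T : topologicalType) (c : chart R n T) (U : set T) :
  open U -> open (c @` (U `&` cdom c)).
Proof.
move=> oU; rewrite openE => _ [x [Ux cx] <-].
have h1 := near_cimg cx.
have h2 : \forall y \near c x, U (cinv c y).
  by apply: near_open (cinv_cont_at cx) oU _; rewrite cmapK.
rewrite /interior; apply: filterS2 h1 h2 => y ycd Uy.
have [yd yE] := chartK ycd.
by exists (cinv c y).
Qed.

(** Curves, chart inverses and local sections in coordinates all have a normed space as source, so
    the chain rule takes such a map as its inner factor and a map of manifolds ([mdiffm]) as its
    outer one. Both notions concern a single point. *)
Definition mdiff V n (A : manifold R n) (f : V -> A) (x : V) :=
  {for x, continuous f} /\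
  forall a, atlas a -> cdom a (f x) -> differentiable (fun y => a (f y)) x.

Definition mdiffm m n (A : manifold R m) (B : manifold R n) (F : A -> B) y :=
  {for y, continuous F} /\ forall a b, atlas a -> atlas b -> cdom a y -> cdom b (F y) ->
    differentiable (fun xi => b (F (cinv a xi))) (a y).

Definition Dm m n (A : manifold R m) (B : manifold R n) (F : A -> B)
    (a : chart R m A) (b : chart R n B) (y : A) (v : 'rV[R]_m) : 'rV[R]_n :=
  'D_v (fun xi => b (F (cinv a xi))) (a y).

Lemma mdiffm_comp V m n (A : manifold R m) (B : manifold R n) (F : A -> B) (f : V -> A) x :
  mdiff f x -> mdiffm F (f x) -> mdiff (fun y => F (f y)) x.
Proof.
move=> [fc fd] [Fc Fd]; split; first exact: (continuous_comp fc Fc).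
move=> b ab bF; have [a [aa af]] := atlas_cover (f x).
have h : \forall y \near x, b (F (cinv a (a (f y)))) = b (F (f y)).
  have := near_open fc (@cdom_open _ _ _ a) af.
  by apply: filterS => y ya; rewrite cmapK.
apply: near_eq_differentiable h _.
exact: differentiable_comp (fd _ aa af) (Fd _ _ aa ab af bF).
Qed.

Lemma Dm_comp V m n (A : manifold R m) (B : manifold R n) (F : A -> B) (f : V -> A)
    (a : chart R m A) (b : chart R n B) x v :
  mdiff f x -> mdiffm F (f x) -> atlas a -> cdom a (f x) -> atlas b -> cdom b (F (f x)) ->
  'D_v (fun y => b (F (f y))) x = Dm F a b (f x) ('D_v (fun y => a (f y)) x).
Proof.
move=> [fc fd] [Fc Fd] aa af ab bF.
have h : \forall y \near x, b (F (f y)) = b (F (cinv a (a (f y)))).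
  have := near_open fc (@cdom_open _ _ _ a) af.
  by apply: filterS => y ya; rewrite cmapK.
rewrite (near_eq_derive _ h) /Dm.
have df := fd _ aa af; have dF := Fd _ _ aa ab af bF.
have dc := differentiable_comp df dF.
rewrite (deriveE _ dc) (deriveE _ df) (deriveE _ dF).
by rewrite (diff_comp df dF).
Qed.

Lemma mdiff_cst V m (A : manifold R m) (y : A) (x : V) : mdiff (fun=> y) x.
Proof. by split; [exact: cst_continuous|move=> a aa ay; exact: differentiable_cst]. Qed.

Lemma mdiff_cinv m (A : manifold R m) (a : chart R m A) y : atlas a -> cdom a y ->
  mdiff (cinv a) (a y).
Proof.
move=> aa ay; split; first exact: cinv_cont_at.
move=> b ab; rewrite cmapK// => bby.
by apply: Cinf_diff (atlas_compat aa ab) _; exists y.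
Qed.

Lemma mdiffmP m n (A : manifold R m) (B : manifold R n) (F : A -> B) a y :
  atlas a -> cdom a y -> mdiff (fun xi => F (cinv a xi)) (a y) -> mdiffm F y.
Proof.
move=> aa ay [Fc Fd].
have h : \forall z \near y, F (cinv a (a z)) = F z.
  by have := near_cdom ay; apply: filterS => z za; rewrite cmapK.
have FcE : {for y, continuous F}.
  rewrite /prop_for /continuous_at -{2}(cmapK ay).
  have : {for y, continuous (fun z => F (cinv a (a z)))}.
    exact: (continuous_comp (cmap_cont ay) Fc).
  by apply: cvg_trans; apply: near_eq_cvg; apply: filterS h => z ->.
split=> // a' b aa' ab a'y bF.
have cv := mdiff_cinv aa' a'y.
have [cc cd] := cv.
have h' : \forall z \near a' y, b (F (cinv a (a (cinv a' z)))) = b (F (cinv a' z)).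
  have : \forall z \near a' y, cdom a (cinv a' z).
    by apply: near_open cc (@cdom_open _ _ _ a) _; rewrite cmapK.
  by apply: filterS => z za; rewrite [cinv a (a _)]cmapK.
apply: near_eq_differentiable h' _.
apply: (differentiable_comp (f := fun z => a (cinv a' z)) (g := fun z => b (F (cinv a z)))).
  by apply: cd => //; rewrite cmapK.
by rewrite [cinv a' _]cmapK//; apply: Fd => //; rewrite cmapK.
Qed.

Lemma mdiffm_id m (A : manifold R m) (y : A) : mdiffm id y.
Proof.
have [a [aa ay]] := atlas_cover y.
exact: mdiffmP aa ay (mdiff_cinv aa ay).
Qed.

Lemma mdiff_chart V n (A : manifold R n) (f : V -> A) x a :
  {for x, continuous f} -> atlas a -> cdom a (f x) ->
  differentiable (fun y => a (f y)) x -> mdiff f x.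
Proof.
move=> fc aa af fd; split=> // b ab bf.
have h : \forall y \near x, b (cinv a (a (f y))) = b (f y).
  have := near_open fc (@cdom_open _ _ _ a) af.
  by apply: filterS => y ya; rewrite cmapK.
apply: near_eq_differentiable h _.
apply: (differentiable_comp (f := fun y => a (f y)) (g := fun z => b (cinv a z)) fd).
by have [_] := mdiff_cinv aa af; apply=> //; rewrite cmapK.
Qed.

Lemma smooth_on_mdiffm m n (A : manifold R m) (B : manifold R n) (F : A -> B) U y :
  open U -> smooth_on U F -> U y -> mdiffm F y.
Proof.
move=> oU [Fc Fs] Uy; split; first exact: Fc.
move=> a b aa ab ay bF; apply: Cinf_diff (Fs _ _ aa ab) _.
by exists y.
Qed.

Lemma Dm_linear m n (A : manifold R m) (B : manifold R n) (F : A -> B) a b y k u v :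
  mdiffm F y -> atlas a -> atlas b -> cdom a y -> cdom b (F y) ->
  Dm F a b y (k *: u + v) = k *: Dm F a b y u + Dm F a b y v.
Proof.
by move=> [_ Fd] aa ab ay bF; rewrite /Dm !(deriveE _ (Fd _ _ aa ab ay bF)) linearP.
Qed.

Lemma DmN m n (A : manifold R m) (B : manifold R n) (F : A -> B) a b y v :
  mdiffm F y -> atlas a -> atlas b -> cdom a y -> cdom b (F y) ->
  Dm F a b y (- v) = - Dm F a b y v.
Proof.
by move=> [_ Fd] aa ab ay bF; rewrite /Dm !(deriveE _ (Fd _ _ aa ab ay bF)) linearN.
Qed.

Lemma Dm_id m (A : manifold R m) (a : chart R m A) y v : cdom a y -> Dm id a a y v = v.
Proof.
move=> ay; rewrite /Dm.
have h : \forall z \near a y, a (cinv a z) = z.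
  by have := near_cimg ay; apply: filterS => z /chartK[].
by rewrite (near_eq_derive _ h) derive_id.
Qed.

Section TwoVariables.
Variables (m n p : nat) (A : manifold R m) (B : manifold R n) (C : manifold R p).
Variables (F : A -> B -> C).
Hypothesis F_smooth : smooth2 F.

Lemma smooth2_rep_diff a b c x y :
  atlas a -> atlas b -> atlas c -> cdom a x -> cdom b y -> cdom c (F x y) ->
  differentiable (fun z : 'rV[R]_m * 'rV[R]_n => c (F (cinv a z.1) (cinv b z.2))) (a x, b y).
Proof.
move=> aa ab ac ax by_ cF; have [_ Fs] := F_smooth.
by apply: Cinf_diff (Fs _ _ _ aa ab ac) _; exists x, y.
Qed.

Lemma smooth2_cont V (f : V -> A) (g : V -> B) x :
  {for x, continuous f} -> {for x, continuous g} ->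
  {for x, continuous (fun v => F (f v) (g v))}.
Proof.
move=> fc gc; have [Fc _] := F_smooth.
apply: (continuous_comp (f := fun v => (f v, g v)) (g := fun z => F z.1 z.2)); last exact: Fc.
exact: cvg_pair.
Qed.

Lemma smooth2_near V (f : V -> A) (g : V -> B) (a : chart R m A) (b : chart R n B)
    (c : chart R p C) x :
  {for x, continuous f} -> {for x, continuous g} -> cdom a (f x) -> cdom b (g x) ->
  \forall v \near x, c (F (cinv a (a (f v))) (cinv b (b (g v)))) = c (F (f v) (g v)).
Proof.
move=> fc gc af bg.
have h1 := near_open fc (@cdom_open _ _ _ a) af.
have h2 := near_open gc (@cdom_open _ _ _ b) bg.
by apply: filterS2 h1 h2 => v va vb; rewrite !cmapK.
Qed.

Lemma mdiff2 V (f : V -> A) (g : V -> B) x : mdiff f x -> mdiff g x ->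
  mdiff (fun v => F (f v) (g v)) x.
Proof.
move=> [fc fd] [gc gd]; split; first exact: smooth2_cont.
move=> c ac cF.
have [a [aa af]] := atlas_cover (f x); have [b [ab bg]] := atlas_cover (g x).
apply: near_eq_differentiable (smooth2_near c fc gc af bg) _.
apply: (differentiable_comp (f := fun v => (a (f v), b (g v)))
  (g := fun z => c (F (cinv a z.1) (cinv b z.2)))).
  by apply: differentiable_pair; [exact: fd|exact: gd].
exact: smooth2_rep_diff.
Qed.

Lemma mdiffm2l y x : mdiffm (F ^~ y) x.
Proof.
have [a [aa ax]] := atlas_cover x.
apply: (mdiffmP aa ax); apply: (mdiff2 (f := cinv a) (g := fun=> y)).
  exact: mdiff_cinv.
exact: mdiff_cst.
Qed.

Lemma mdiffm2r x y : mdiffm (F x) y.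
Proof.
have [b [ab by_]] := atlas_cover y.
apply: (mdiffmP ab by_); apply: (mdiff2 (f := fun=> x) (g := cinv b)).
  exact: mdiff_cst.
exact: mdiff_cinv.
Qed.

(** The differential of a map of two variables is the sum of the partial ones, as (u, w) = (u, 0) +
    (0, w). It is applied to group actions in which the point and the group element move
    together. *)
Lemma Dm2 V (f : V -> A) (g : V -> B) a b c x v : mdiff f x -> mdiff g x ->
  atlas a -> atlas b -> atlas c -> cdom a (f x) -> cdom b (g x) -> cdom c (F (f x) (g x)) ->
  'D_v (fun w => c (F (f w) (g w))) x =
  Dm (F ^~ (g x)) a c (f x) ('D_v (fun w => a (f w)) x) +
  Dm (F (f x)) b c (g x) ('D_v (fun w => b (g w)) x).
Proof.
move=> [fc fd] [gc gd] aa ab ac af bg cF.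
have h : \forall w \near x, c (F (f w) (g w)) = c (F (cinv a (a (f w))) (cinv b (b (g w)))).
  by apply: filterS (smooth2_near c fc gc af bg) => w ->.
rewrite (near_eq_derive _ h).
pose Phi (z : 'rV[R]_m * 'rV[R]_n) := c (F (cinv a z.1) (cinv b z.2)).
have dP : differentiable Phi (a (f x), b (g x)) by exact: smooth2_rep_diff.
have df := fd _ aa af; have dg := gd _ ab bg.
have dp := differentiable_pair df dg.
transitivity ('D_('D_v (fun w => a (f w)) x, 'D_v (fun w => b (g w)) x) Phi (a (f x), b (g x))).
  rewrite (deriveE _ (differentiable_comp dp dP)) (deriveE _ df) (deriveE _ dg) (deriveE _ dP).
  by rewrite (diff_comp dp dP) /= (diff_pair df dg).
set u := 'D_v _ x; set w := 'D_v _ x.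
have -> : (u, w) = (u, 0) + (0, w) by rewrite -[RHS]/(u + 0, 0 + w) addr0 add0r.
rewrite (deriveE _ dP) linearD /= -!(deriveE _ dP) derive_pairl derive_pairr.
by rewrite /Phi /= /Dm !cmapK.
Qed.

End TwoVariables.

End Manifolds.

(** * Group actions, connections and curvature *)

Section LieGroups.
Variables (R : realType) (n : nat) (G : lieGroup R n).
Implicit Types (g h : G) (X Y : 'rV[R]_n) (V : normedModType R).
Local Notation l := (lchart G).
Local Notation e := (lone G).

Lemma lmul_eq1 g h : lmul g h = e -> h = linv g.
Proof. by move=> gh; rewrite -[h]lmul1g -(lmulVg g) -lmulA gh lmulg1. Qed.

Lemma linvK g : linv (linv g) = g.
Proof. by rewrite -(lmul_eq1 (lmulVg g)). Qed.

Lemma linvM g h : linv (lmul g h) = lmul (linv h) (linv g).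
Proof.
symmetry; apply: lmul_eq1.
by rewrite -lmulA [lmul h _]lmulA lmulgV lmul1g lmulgV.
Qed.

Lemma linv1 : linv e = e.
Proof. by rewrite -(lmul_eq1 (lmul1g e)). Qed.

Lemma lexp0 X : lexp G (0 *: X) = e.
Proof.
have := @lexpD _ _ G 0 0 X; rewrite addr0; set g := lexp G _ => gg.
by rewrite -(lmulVg g) {3}gg lmulA lmulVg lmul1g.
Qed.

Lemma mdiff_lexp X : mdiff (fun t : R => lexp G (t *: X)) 0.
Proof.
apply: (mdiff_chart (a := l)); rewrite ?lexp0.
- exact: lexp_cont.
- exact: lchart_atlas.
- exact: lchart_one.
- by have [d _] := @lexp_deriv _ _ G X; exact/derivable1_diffP.
Qed.

Lemma derive_lexp X : 'D_1 (fun t : R => l (lexp G (t *: X))) 0 = X.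
Proof. by have [_] := @lexp_deriv _ _ G X. Qed.

Lemma lexpN X t : linv (lexp G (t *: X)) = lexp G (t *: - X).
Proof.
symmetry; apply: lmul_eq1; rewrite scalerN -scaleNr -lexpD subrr.
exact: lexp0.
Qed.

(** A one-parameter subgroup enters a derivative only through its initial velocity. Derivatives
    along exponentials thus become differentials at the identity, which are linear in X. *)
Lemma derive_Dm_lexp m (B : manifold R m) (F : G -> B) (b : chart R m B) X :
  mdiffm F e -> atlas b -> cdom b (F e) ->
  'D_1 (fun t : R => b (F (lexp G (t *: X)))) 0 = Dm F l b e X.
Proof.
move=> dF ab bF.
have h := lexp0 X.
rewrite (Dm_comp (a := l) (f := fun t : R => lexp G (t *: X))) ?h//.
- by rewrite derive_lexp.
- exact: mdiff_lexp.
- exact: lchart_atlas.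
- exact: lchart_one.
Qed.

Lemma mdiffm_linv g : mdiffm (@linv _ _ G) g.
Proof. by apply: (smooth_on_mdiffm openT (@linv_smooth _ _ G)). Qed.

Lemma Dm_linv X : Dm (@linv _ _ G) l l e X = - X.
Proof.
have la := @lchart_atlas _ _ G; have le := @lchart_one _ _ G.
rewrite -derive_Dm_lexp//; [|exact: mdiffm_linv|by rewrite linv1].
have -> : (fun t : R => l (linv (lexp G (t *: X)))) = fun t => l (lexp G (t *: - X)).
  by apply/funext => t; rewrite lexpN.
exact: derive_lexp.
Qed.

Definition conj g h := lmul (lmul g h) (linv g).

Lemma conj_lone g : conj g e = e.
Proof. by rewrite /conj lmulg1 lmulgV. Qed.

Lemma mdiffm_conj g h : mdiffm (conj g) h.
Proof.
have la := @atlas_cover _ _ G h; case: la => a [aa ah].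
apply: (mdiffmP aa ah).
apply: (mdiff2 (@lmul_smooth _ _ G) (f := fun xi => lmul g (cinv a xi)) (g := fun=> linv g)).
  apply: (mdiff2 (@lmul_smooth _ _ G) (f := fun=> g) (g := cinv a)); first exact: mdiff_cst.
  exact: mdiff_cinv.
exact: mdiff_cst.
Qed.

Lemma AdE g X : Ad g X = Dm (conj g) l l e X.
Proof.
rewrite /Ad derive1E -derive_Dm_lexp//; first exact: mdiffm_conj.
- exact: lchart_atlas.
- rewrite conj_lone; exact: lchart_one.
Qed.

Lemma Ad_linear g k X Y : Ad g (k *: X + Y) = k *: Ad g X + Ad g Y.
Proof.
rewrite !AdE Dm_linear ?conj_lone//; first exact: mdiffm_conj.
- exact: lchart_atlas.
- exact: lchart_atlas.
- exact: lchart_one.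
- exact: lchart_one.
Qed.

Lemma AdM g h X : Ad (lmul g h) X = Ad g (Ad h X).
Proof.
have la := @lchart_atlas _ _ G; have le := @lchart_one _ _ G.
have e1 := conj_lone.
rewrite !AdE /Dm.
have -> : (fun xi => l (conj (lmul g h) (cinv l xi))) =
          (fun xi => l (conj g (conj h (cinv l xi)))).
  by apply/funext => xi; rewrite /conj linvM !lmulA.
rewrite (Dm_comp (F := conj g) (a := l) (f := fun xi => conj h (cinv l xi))) ?cmapK ?e1//.
  apply: mdiffm_comp; first exact: mdiff_cinv.
  exact: mdiffm_conj.
exact: mdiffm_conj.
Qed.

Lemma Ad1 X : Ad e X = X.
Proof.
rewrite AdE; have -> : conj e = id.
  by apply/funext => x; rewrite /conj linv1 lmul1g lmulg1.
apply: Dm_id; exact: lchart_one.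
Qed.

(* H is only evaluated on group elements close to the identity. *)
Lemma derive_at_one V m (H : G -> 'rV[R]_m) (f : V -> G) x v :
  f x = e -> mdiff f x -> differentiable (fun xi => H (cinv l xi)) (l e) ->
  'D_v (fun y => H (f y)) x =
  'D_('D_v (fun y => l (f y)) x) (fun xi => H (cinv l xi)) (l e).
Proof.
move=> fx [fc fd] dH.
have la := @lchart_atlas _ _ G; have le := @lchart_one _ _ G.
have h : \forall y \near x, H (f y) = H (cinv l (l (f y))).
  have lf : cdom l (f x) by rewrite fx.
  have := near_open fc (@cdom_open _ _ _ l) lf.
  by apply: filterS => y ya; rewrite cmapK.
rewrite (near_eq_derive _ h).
have df : differentiable (fun y => l (f y)) x by apply: fd => //; rewrite fx.
have dH' : differentiable (fun xi => H (cinv l xi)) (l (f x)) by rewrite fx.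
have dc := differentiable_comp df dH'.
by rewrite (deriveE _ dc) (deriveE _ df) (deriveE _ dH) (diff_comp df dH') /= fx.
Qed.

End LieGroups.

Section Generator.
Variables (R : realType) (n d : nat) (G : lieGroup R n) (N : manifold R d).
Variable rho : gaction G N.
Local Notation l := (lchart G).
Local Notation e := (lone G).

Lemma generatorE X k y : atlas k -> cdom k y ->
  generator rho X k y = - Dm (rho ^~ y) l k e X.
Proof.
move=> ak ky.
have dr : mdiffm (rho ^~ y) e by exact: (mdiffm2l (@act_smooth _ _ _ _ _ rho)).
have la := @lchart_atlas _ _ G; have le := @lchart_one _ _ G.
rewrite -DmN ?act1// -derive_Dm_lexp ?act1// /generator derive1E.
have -> : (fun t : R => k (rho (lexp G (- t *: X)) y)) =
          (fun t : R => k (rho (lexp G (t *: - X)) y)).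
  by apply/funext => t; rewrite scalerN scaleNr.
by [].
Qed.

Lemma generator_linear k X Y c y : atlas k -> cdom k y ->
  generator rho (c *: X + Y) k y = c *: generator rho X k y + generator rho Y k y.
Proof.
move=> ak ky; rewrite !generatorE//.
have la := @lchart_atlas _ _ G; have le := @lchart_one _ _ G.
rewrite Dm_linear ?act1//; last exact: (mdiffm2l (@act_smooth _ _ _ _ _ rho)).
by rewrite opprD scalerN.
Qed.

(** The identity (g h g^-1) (g y) = g (h y), differentiated in h at the identity. *)
Lemma generator_Ad g X k k' y : atlas k -> atlas k' -> cdom k y -> cdom k' (rho g y) ->
  generator rho (Ad g X) k' (rho g y) = Dm (rho g) k k' y (generator rho X k y).
Proof.
move=> ak ak' ky ky'; rewrite !generatorE//.
have la := @lchart_atlas _ _ G; have le := @lchart_one _ _ G.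
have dy : mdiffm (rho ^~ y) e by exact: (mdiffm2l (@act_smooth _ _ _ _ _ rho)).
have dgy : mdiffm (rho ^~ (rho g y)) e by exact: (mdiffm2l (@act_smooth _ _ _ _ _ rho)).
have dg : mdiffm (rho g) y by exact: (mdiffm2r (@act_smooth _ _ _ _ _ rho)).
rewrite DmN ?act1//; congr (- _); rewrite AdE.
have E : (fun xi => k' (rho (conj g (cinv l xi)) (rho g y))) =
         (fun xi => k' (rho g (rho (cinv l xi) y))).
  by apply/funext => xi; rewrite /conj -!actM -!lmulA lmulVg lmulg1.
transitivity ('D_X (fun xi => k' (rho (conj g (cinv l xi)) (rho g y))) (l e)).
  rewrite (Dm_comp (F := rho ^~ (rho g y)) (a := l) (f := fun xi => conj g (cinv l xi)))
    ?cmapK ?conj_lone ?act1//.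
  apply: mdiffm_comp; first exact: mdiff_cinv.
  exact: mdiffm_conj.
rewrite E (Dm_comp (F := rho g) (a := k) (f := fun xi => rho (cinv l xi) y))
  ?cmapK ?act1//.
apply: (mdiffm_comp (F := rho ^~ y)); first exact: mdiff_cinv.
by rewrite cmapK.
Qed.

End Generator.

Section SmoothDomain.
Variables (R : realType) (m n p : nat).
Variables (A : manifold R m) (B : manifold R n) (C : manifold R p).

Definition rep_dom (F : A -> B -> C) (a : chart R m A) (b : chart R n B) (c : chart R p C) :=
  [set z : 'rV[R]_m * 'rV[R]_n | exists x y,
            [/\ cdom a x, cdom b y, cdom c (F x y) & z = (a x, b y)]].

(** The symmetry of second derivatives and all arguments on neighbourhoods require the domain in
    [smooth2] to be open. *)
Lemma rep_dom_open (F : A -> B -> C) a b c : smooth2 F -> open (rep_dom F a b c).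
Proof.
move=> Fs; rewrite openE => _ [x [y [ax by_ cF ->]]].
have h1 : \forall z \near (a x, b y), (a @` cdom a) z.1.
  by apply: (near_open (f := fst)) (@cimg_open _ _ _ a) _; [exact: cvg_fst|exists x].
have h2 : \forall z \near (a x, b y), (b @` cdom b) z.2.
  by apply: (near_open (f := snd)) (@cimg_open _ _ _ b) _; [exact: cvg_snd|exists y].
have h3 : \forall z \near (a x, b y), cdom c (F (cinv a z.1) (cinv b z.2)).
  apply: (near_open (f := fun z => F (cinv a z.1) (cinv b z.2))) (@cdom_open _ _ _ c) _.
    apply: (smooth2_cont Fs (f := fun z => cinv a z.1) (g := fun z => cinv b z.2)).
      by apply: continuous_comp; [exact: cvg_fst|exact: cinv_cont_at].
    by apply: continuous_comp; [exact: cvg_snd|exact: cinv_cont_at].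
  by rewrite /= !cmapK.
apply: filterS3 h1 h2 h3 => -[u v] /= /chartK[ua uE] /chartK[vb vE] cF'.
by exists (cinv a u), (cinv b v); rewrite uE vE.
Qed.

End SmoothDomain.

Section Connections.
Local Opaque derive.
Variables (R : realType) (n m : nat) (G : lieGroup R n) (M : manifold R m).
Variables (P : principal_bundle G M) (A : connection P).
Implicit Types (X Y : 'rV[R]_n) (u v w : 'rV[R]_(m + n)) (c d : chart R (m + n) P) (q : P).
Local Notation l := (lchart G).
Local Notation e := (lone G).
Local Notation ra := (@ract _ _ _ _ _ P).

Let la : atlas l := @lchart_atlas _ _ G.
Let le : cdom l e := @lchart_one _ _ G.
Let raS : smooth2 ra := @ract_smooth _ _ _ _ _ P.

Definition fund c q X := Dm (ra q) l c e X.

Lemma cform_fund c q X : atlas c -> cdom c q -> fund c q X *m A c (c q) = X.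
Proof.
move=> ac cq; refine (etrans _ (cform_vertical A X ac cq)).
apply: (congr1 (fun w => w *m A c (c q))).
rewrite derive1E; symmetry; apply: derive_Dm_lexp => //; last by rewrite ract1.
exact: (mdiffm2r raS).
Qed.

Lemma cform_Dm g q c d v : atlas c -> atlas d -> cdom c q -> cdom d (ra q g) ->
  Dm (ra ^~ g) c d q v *m A d (d (ra q g)) = Ad (linv g) (v *m A c (c q)).
Proof. exact: cform_equivariant. Qed.

(** The right action in coordinates, with the group element read in the chart at the identity.
    Differentiating in the first variable expresses the equivariance of A, in the second the
    fundamental vectors. *)
Let Phi c (z : 'rV[R]_(m + n) * 'rV[R]_n) := c (ra (cinv c z.1) (cinv l z.2)).

Let PhiS c : atlas c -> Cinf (rep_dom ra c l c) (Phi c).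
Proof. by move=> ac; have [_] := raS; apply. Qed.

Let dom0 c q : cdom c q -> rep_dom ra c l c (c q, l e).
Proof. by move=> cq; exists q, e; rewrite ract1. Qed.

Let Phi0 c q : cdom c q -> Phi c (c q, l e) = c q.
Proof. by move=> cq; rewrite /Phi /= !cmapK// ract1. Qed.

Let Ainv_rep c q v xi : atlas c -> cdom c q -> rep_dom ra c l c (c q, xi) ->
  'D_(v, 0) (Phi c) (c q, xi) *m A c (Phi c (c q, xi)) =
  Ad (linv (cinv l xi)) (v *m A c (c q)).
Proof.
move=> ac cq [x [y [cx ly cxy [cqE ->]]]].
have xq : x = q by rewrite -(cmapK cx) -cqE cmapK.
rewrite xq in cxy.
rewrite derive_pairl [cinv l _]cmapK// -(cform_Dm _ ac ac cq cxy).
by rewrite /Phi /Dm /= !cmapK.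
Qed.

Let Ainv_near c q v : atlas c -> cdom c q ->
  \forall xi \near l e, 'D_(v, 0) (Phi c) (c q, xi) *m A c (Phi c (c q, xi)) =
  Ad (linv (cinv l xi)) (v *m A c (c q)).
Proof.
move=> ac cq.
have : \forall xi \near l e, rep_dom ra c l c (c q, xi).
  have cp : {for l e, continuous (fun xi : 'rV[R]_n => (c q, xi))}.
    by apply: differentiable_continuous; apply: differentiable_pair => //;
      exact: differentiable_cst.
  have h := near_open cp (rep_dom_open raS) (dom0 cq).
  exact: h.
by apply: filterS => xi; exact: Ainv_rep.
Qed.

Let alpha_diff c q v : atlas c -> cdom c q ->
  differentiable (fun z => 'D_(v, 0) (Phi c) z *m A c (Phi c z)) (c q, l e).
Proof.
move=> ac cq; apply: differentiable_mulmx.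
  by apply: Cinf_diff (dom0 cq); apply: Cinf_D; exact: PhiS.
apply: differentiable_comp; first exact: Cinf_diff (PhiS ac) (dom0 cq).
rewrite Phi0//; apply: Cinf_diff (omx_smooth A ac) _.
by exists q.
Qed.

Let pair_diff (p : 'rV[R]_(m + n)) (x : 'rV[R]_n) : differentiable (fun xi : 'rV[R]_n => (p, xi)) x.
Proof. by apply: differentiable_pair => //; exact: differentiable_cst. Qed.

(* Equivariance of the connection form expresses Ad (g^-1) through smooth maps,
   so the existence of a connection yields the smoothness of Ad at the identity. *)
Lemma Ad_linv_diff q Y : differentiable (fun xi => Ad (linv (cinv l xi)) Y) (l e).
Proof.
have [c [ac cq]] := atlas_cover q.
have h := Ainv_near (fund c q Y) ac cq.
rewrite cform_fund// in h.
apply: near_eq_differentiable h _.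
apply: (differentiable_comp (f := fun xi => (c q, xi))
  (g := fun z => 'D_(fund c q Y, 0) (Phi c) z *m A c (Phi c z))).
  exact: pair_diff.
exact: alpha_diff.
Qed.

Lemma Ad_diff q Y : differentiable (fun xi => Ad (cinv l xi) Y) (l e).
Proof.
have lnv := mdiffm_linv e.
have lnvc : mdiff (fun xi => linv (cinv l xi)) (l e).
  by apply: mdiffm_comp; [exact: mdiff_cinv|rewrite cmapK].
have h : \forall xi \near l e,
    Ad (linv (cinv l (l (linv (cinv l xi))))) Y = Ad (cinv l xi) Y.
  have := near_open lnvc.1 (@cdom_open _ _ _ l).
  rewrite cmapK// linv1 => /(_ le).
  by apply: filterS => xi lxi; rewrite [cinv l (l _)]cmapK// linvK.
apply: near_eq_differentiable h _.
apply: (differentiable_comp (f := fun xi => l (linv (cinv l xi)))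
  (g := fun xi => Ad (linv (cinv l xi)) Y)).
  by apply: lnvc.2 => //; rewrite cmapK// linv1.
by rewrite cmapK// linv1; exact: Ad_linv_diff q Y.
Qed.

(** The point q supplies the differentiability of [Ad], which is extracted from the connection near
    q; this is why the facts on the bracket carry a point of P. *)
Lemma bracketE q X Y : bracket G X Y = 'D_X (fun xi => Ad (cinv l xi) Y) (l e).
Proof.
rewrite /bracket derive1E.
rewrite (derive_at_one (H := fun g => Ad g Y) (f := fun t : R => lexp G (t *: X))).
- by rewrite derive_lexp.
- exact: lexp0.
- exact: mdiff_lexp.
- exact: Ad_diff q Y.
Qed.

Lemma derive_Ad_linv q X Y :
  'D_X (fun xi => Ad (linv (cinv l xi)) Y) (l e) = - bracket G X Y.
Proof.
have lnvc : mdiff (fun xi => linv (cinv l xi)) (l e).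
  by apply: mdiffm_comp; [exact: mdiff_cinv|rewrite cmapK//; exact: mdiffm_linv].
rewrite (derive_at_one (H := fun g => Ad g Y) (f := fun xi => linv (cinv l xi))).
- rewrite -/(Dm _ _ _ _ _) Dm_linv (bracketE q).
  have dA := Ad_diff q Y.
  by rewrite !(deriveE _ dA) linearN.
- by rewrite cmapK// linv1.
- exact: lnvc.
- exact: Ad_diff q Y.
Qed.

Lemma bracket_linearl q k X X' Y :
  bracket G (k *: X + X') Y = k *: bracket G X Y + bracket G X' Y.
Proof.
rewrite !(bracketE q); have dA := Ad_diff q Y.
by rewrite !(deriveE _ dA) linearP.
Qed.

(* Half of the horizontality of the curvature: the derivative of the
   equivariance equation along X, with the vertical values of the form constant. *)
Lemma dform_fund c q X v : atlas c -> cdom c q ->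
  dform (A c) (c q) (fund c q X) v = - bracket G X (v *m A c (c q)).
Proof.
move=> ac cq; have q0 := dom0 cq.
have dA : differentiable (A c) (c q).
  by apply: Cinf_diff (omx_smooth A ac) _; exists q.
have e1 : 'D_(0, X) (Phi c) (c q, l e) = fund c q X.
  by rewrite derive_pairr /fund /Dm /Phi /= cmapK.
have e2 : 'D_(v, 0) (Phi c) (c q, l e) = v.
  rewrite derive_pairl -[RHS](Dm_id v cq).
  apply: eq_derive => h; rewrite /Phi /= cmapK// ract1.
  by [].
have e3 : 'D_(0, X) (fun z => 'D_(v, 0) (Phi c) z *m A c (Phi c z)) (c q, l e) =
    - bracket G X (v *m A c (c q)).
  rewrite derive_pairr -(derive_Ad_linv q).
  exact: near_eq_derive (Ainv_near v ac cq).
have e4 : 'D_(v, 0) (fun z => 'D_(0, X) (Phi c) z *m A c (Phi c z)) (c q, l e) = 0.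
  rewrite derive_pairl -(derive_cst X (c q) v); apply: near_eq_derive.
  near=> y; have /chartK[yc yE] : (c @` cdom c) y by near: y; exact: near_cimg.
  have p0 : Phi c (y, l e) = c (cinv c y) by rewrite -{1}yE Phi0.
  have p1 : 'D_(0, X) (Phi c) (y, l e) = fund c (cinv c y) X by rewrite derive_pairr.
  rewrite p1 p0; exact: cform_fund.
rewrite -[RHS]subr0.
exact: (dform_pullback_eq (rep_dom_open raS) q0 (PhiS ac 2%N) (Phi0 cq) dA e1 e2 e3 e4).
Unshelve. all: by end_near. Qed.

(** By [dform_fund], dA takes the value - [X, Y] on the fundamental vectors of X and Y; antisymmetry
    of the 2-form dA passes to the bracket. *)
Lemma bracket_antisym q X Y : bracket G X Y = - bracket G Y X.
Proof.
have [c [ac cq]] := atlas_cover q.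
have hX := dform_fund X (fund c q Y) ac cq.
have hY := dform_fund Y (fund c q X) ac cq.
rewrite (cform_fund Y ac cq) in hX; rewrite (cform_fund X ac cq) in hY.
by rewrite -hY -[LHS]opprK -hX /dform opprB.
Qed.

Lemma bracket_linearr q k X X' Y :
  bracket G Y (k *: X + X') = k *: bracket G Y X + bracket G Y X'.
Proof.
by rewrite !(bracket_antisym q Y) (bracket_linearl q) opprD scalerN.
Qed.

(** Multiplication by a constant matrix commutes with differentiation. *)
Lemma Ad_mx (g : G) : exists L : 'M[R]_n, forall Z, Ad g Z = Z *m L.
Proof.
pose f : {linear 'rV[R]_n -> 'rV[R]_n} :=
  HB.pack (Ad g) (GRing.isLinear.Build _ _ _ _ (Ad g) (Ad_linear g)).
by exists (lin1_mx f) => Z; rewrite mul_rV_lin1.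
Qed.

(** Differentiate Ad_g Ad_h Y = Ad_(g h g^-1) Ad_g Y in h at the identity, in the direction X. *)
Lemma Ad_bracket q (g : G) X Y : Ad g (bracket G X Y) = bracket G (Ad g X) (Ad g Y).
Proof.
have dY := Ad_diff q Y.
have dgY := Ad_diff q (Ad g Y).
have [L LE] := Ad_mx g.
rewrite (bracketE q) (bracketE q (Ad g X)) LE.
have E : (fun xi => Ad (cinv l xi) Y *m L) = (fun xi => Ad (conj g (cinv l xi)) (Ad g Y)).
  apply/funext => xi; have cg : lmul (conj g (cinv l xi)) g = lmul g (cinv l xi).
    by rewrite /conj -lmulA lmulVg lmulg1.
  by rewrite -LE -(AdM g) -(AdM (conj g _)) cg.
have mc : mdiff (fun xi => conj g (cinv l xi)) (l e).
  apply: mdiffm_comp; [exact: mdiff_cinv|exact: mdiffm_conj].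
have ge : conj g (cinv l (l e)) = e by rewrite cmapK// conj_lone.
have h1 := derive_mulmx X dY (differentiable_cst L (l e)).
have h2 := derive_at_one (H := fun h => Ad h (Ad g Y)) X ge mc dgY.
rewrite derive_cst mulmx0 addr0 in h1.
refine (etrans (esym h1) _); rewrite E.
refine (etrans h2 _).
exact: (congr1 (fun W => 'D_W (fun xi => Ad (cinv l xi) (Ad g Y)) (l e)) (esym (AdE g X))).
Qed.

Definition Omega c q u v :=
  dform (A c) (c q) u v + bracket G (u *m A c (c q)) (v *m A c (c q)).

End Connections.

Section Curvature.
Variables (R : realType) (n m : nat) (G : lieGroup R n) (M : manifold R m).
Variables (P : principal_bundle G M) (A : connection P).
Implicit Types (X Y : 'rV[R]_n) (u v w : 'rV[R]_(m + n)) (c d : chart R (m + n) P) (q : P).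
Local Notation l := (lchart G).
Local Notation e := (lone G).
Local Notation ra := (@ract _ _ _ _ _ P).
Local Opaque derive.

Let raS : smooth2 ra := @ract_smooth _ _ _ _ _ P.

Lemma dform_anti p r (om : 'rV[R]_p -> 'M[R]_(p, r)) x a b : dform om x a b = - dform om x b a.
Proof. by rewrite /dform opprB. Qed.

Lemma dform_linearl p r (om : 'rV[R]_p -> 'M[R]_(p, r)) x k a b a' : differentiable om x ->
  dform om x (k *: a + a') b = k *: dform om x a b + dform om x a' b.
Proof.
move=> dom; rewrite /dform !(deriveE _ dom) linearP /= mulmxDr mulmxDl.
by rewrite opprD addrACA -scalemxAl -scalemxAr -scalerBr.
Qed.

Lemma cform_diff c q : atlas c -> cdom c q -> differentiable (A c) (c q).
Proof. by move=> ac cq; apply: Cinf_diff (omx_smooth A ac) _; exists q. Qed.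

Lemma Omega_anti c q u v : Omega A c q u v = - Omega A c q v u.
Proof.
rewrite /Omega opprD -dform_anti; congr (_ + _); exact: (bracket_antisym A q).
Qed.

Lemma Omega_linearl c q k u u' v : atlas c -> cdom c q ->
  Omega A c q (k *: u + u') v = k *: Omega A c q u v + Omega A c q u' v.
Proof.
move=> ac cq; rewrite /Omega dform_linearl; last exact: cform_diff.
have := bracket_linearl A q k (u *m A c (c q)) (u' *m A c (c q)) (v *m A c (c q)).
rewrite scalemxAl -mulmxDl => ->; rewrite addrACA.
by congr (_ + _); exact/esym/scalerDr.
Qed.

Lemma Omega_linearr c q k u v v' : atlas c -> cdom c q ->
  Omega A c q u (k *: v + v') = k *: Omega A c q u v + Omega A c q u v'.
Proof.
move=> ac cq.
refine (etrans (Omega_anti c q u _) (etrans (congr1 -%R (Omega_linearl k v v' u ac cq)) _)).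
refine (etrans (opprD _ _) (congr2 +%R _ (esym (Omega_anti c q u v')))).
exact: (etrans (esym (scalerN _ _)) (congr1 ( *:%R k) (esym (Omega_anti c q u v)))).
Qed.

Let OmegaDl c q u u' v : atlas c -> cdom c q ->
  Omega A c q (u + u') v = Omega A c q u v + Omega A c q u' v.
Proof.
by move=> ac cq; have := Omega_linearl 1 u u' v ac cq; rewrite !scale1r.
Qed.

Lemma Omega_fund c q X v : atlas c -> cdom c q -> Omega A c q (fund c q X) v = 0.
Proof.
move=> ac cq; rewrite /Omega (dform_fund A X v ac cq) (cform_fund A X ac cq).
exact: addNr.
Qed.

Lemma Omega_horizontal c q X Y u v : atlas c -> cdom c q ->
  Omega A c q (u + fund c q X) (v + fund c q Y) = Omega A c q u v.
Proof.
move=> ac cq; rewrite OmegaDl// (Omega_fund X _ ac cq) addr0.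
by rewrite Omega_anti OmegaDl// (Omega_fund Y _ ac cq) addr0 -Omega_anti.
Qed.

(** Right translation by g pulls A back to the constant matrix of Ad (g^-1) applied to A. The
    exterior derivative commutes with the pullback and with that matrix, and Ad preserves the
    bracket. *)
Lemma Omega_equivariant g c d q u v : atlas c -> atlas d -> cdom c q -> cdom d (ra q g) ->
  Omega A d (ra q g) (Dm (ra ^~ g) c d q u) (Dm (ra ^~ g) c d q v) =
  Ad (linv g) (Omega A c q u v).
Proof.
move=> ac ad cq dq.
have [b [ab bg]] := atlas_cover g.
have [L LE] := Ad_mx (linv g).
pose psi xi := d (ra (cinv c xi) g).
pose U : set 'rV[R]_(m + n) := [set p | rep_dom ra c b d (p, b g)].
have oU : open U.
  apply: (@open_comp _ _ (fun p : 'rV[R]_(m + n) => (p, b g)) (rep_dom ra c b d));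
    last exact: (rep_dom_open raS).
  move=> p _; apply: differentiable_continuous; apply: differentiable_pair => //.
have Uq : U (c q) by exists q, g.
have psiU : Cinf U psi.
  have -> : psi = (fun p => d (ra (cinv c p) (cinv b (b g)))) by rewrite cmapK.
  apply: (Cinf_pairl (f := fun z => d (ra (cinv c z.1) (cinv b z.2))) (b g)).
  by have [_] := raS; apply.
have psiq : psi (c q) = d (ra q g) by rewrite /psi cmapK.
have D a a' : 'D_a (fun z => 'D_a' psi z *m A d (psi z)) (c q) = a' *m 'D_a (A c) (c q) *m L.
  have dA := cform_diff ac cq.
  have h : \forall z \near c q, 'D_a' psi z *m A d (psi z) = a' *m A c z *m L.
    near=> z.
    have [x [y [cx by_ dxy [zE gE]]]] : U z by near: z; exact: open_nbhs_nbhs.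
    have yg : y = g by rewrite -(cmapK by_) -gE cmapK.
    rewrite yg in dxy.
    have xz : cinv c z = x by rewrite zE cmapK.
    by rewrite -LE zE /psi -(cform_Dm A a' ac ad cx dxy) cmapK.
  refine (etrans (near_eq_derive _ h) _).
  have d1 : differentiable (fun z => a' *m A c z) (c q).
    by apply: differentiable_mulmx => //; exact: differentiable_cst.
  have h1 := derive_mulmx a (differentiable_cst a' (c q)) dA.
  have h2 := derive_mulmx a d1 (differentiable_cst L (c q)).
  rewrite derive_cst mulmx0 addr0 in h2.
  rewrite derive_cst mul0mx add0r in h1.
  refine (etrans h2 _).
  exact: (congr1 (fun W => W *m L) h1).
have h := dform_pullback_eq oU Uq (psiU 2%N) psiq (cform_diff ad dq) (erefl ('D_u psi (c q)))
  (erefl ('D_v psi (c q))) (D u v) (D v u).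
rewrite /Omega !(cform_Dm A _ ac ad cq dq) -(Ad_bracket A q).
have LD Z Z' : Ad (linv g) (Z + Z') = Ad (linv g) Z + Ad (linv g) Z'.
  by rewrite !LE mulmxDl.
rewrite LD; congr (_ + _).
by refine (etrans h _); rewrite LE /dform mulmxBl.
Unshelve. all: by end_near. Qed.

Definition pot (V : normedModType R) (s : V -> P) d (v : V) (xi : V) : 'rV[R]_n :=
  'D_v (fun z => d (s z)) xi *m A d (d (s xi)).

Lemma pot_curvature (V : normedModType R) (s : V -> P) d (U : set V) xi (v w : V) :
  atlas d -> open U -> U xi -> Ck 2 U (fun z => d (s z)) -> cdom d (s xi) ->
  'D_v (pot s d w) xi - 'D_w (pot s d v) xi + bracket G (pot s d v xi) (pot s d w xi) =
  Omega A d (s xi) ('D_v (fun z => d (s z)) xi) ('D_w (fun z => d (s z)) xi).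
Proof.
move=> ad oU Ux sU ds; rewrite /Omega; congr (_ + _).
exact: (dform_pullback v w oU Ux sU (cform_diff ad ds)).
Qed.

(** The gauge potential is defined with a chart of P that varies from point to point; this
    independence permits a fixed chart before the potential is differentiated. *)
Lemma pot_chart (V : normedModType R) (s : V -> P) c d xi (v : V) : mdiff s xi ->
  atlas c -> atlas d -> cdom c (s xi) -> cdom d (s xi) -> pot s c v xi = pot s d v xi.
Proof.
move=> ms ac ad cs ds; rewrite /pot (omx_compat A _ ac ad cs ds).
apply: (congr1 (fun w => w *m A d (d (s xi)))).
exact/esym/(Dm_comp v ms (mdiffm_id (s xi)) ac cs ad ds).
Qed.

End Curvature.

Section SmoothMaps.
Variables (R : realType) (m n : nat) (A : manifold R m) (B : manifold R n).

Lemma smooth_dom_open (U : set A) (f : A -> B) (a : chart R m A) (b : chart R n B) :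
  open U -> smooth_on U f -> open (a @` (U `&` cdom a `&` f @^-1` cdom b)).
Proof.
move=> oU [fc _].
have -> : U `&` cdom a `&` f @^-1` cdom b = (U `&` f @^-1` cdom b) `&` cdom a.
  by rewrite setIAC.
apply: open_chart_image; rewrite openE => x [Ux fx].
have h1 : \forall y \near x, U y by exact: open_nbhs_nbhs.
have h2 := near_open (fc x Ux) (@cdom_open _ _ _ b) fx.
by apply: filterS2 h1 h2 => y Uy fy.
Qed.

Lemma mdiff_rep (U : set A) (f : A -> B) (a : chart R m A) xi :
  open U -> smooth_on U f -> atlas a -> (a @` cdom a) xi -> U (cinv a xi) ->
  mdiff (fun z => f (cinv a z)) xi.
Proof.
move=> oU sf aa /chartK[ax <-] Ux; rewrite cmapK// in Ux.
apply: (mdiffm_comp (F := f)); first exact: mdiff_cinv.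
by rewrite cmapK//; exact: smooth_on_mdiffm oU sf Ux.
Qed.

End SmoothMaps.

Section GaugePotential.
Variables (R : realType) (n m : nat) (G : lieGroup R n) (M : manifold R m).
Variables (P : principal_bundle G M) (A : connection P).
Variables (t : bundle_triv P) (c : chart R m M).
Hypothesis ac : atlas c.
Local Opaque derive.
Implicit Types (d : chart R (m + n) P).

Let sg xi := tsec t (cinv c xi).

Lemma tsec_mdiff xi : (c @` cdom c) xi -> tdom t (cinv c xi) -> mdiff sg xi.
Proof. by move=> cx tx; apply: mdiff_rep (tdom_open t) (tsec_smooth t) ac cx tx. Qed.

Lemma local_potentialE d i xi : atlas d -> (c @` cdom c) xi -> tdom t (cinv c xi) ->
  cdom d (tsec t (cinv c xi)) ->
  local_potential A t c i xi = pot A sg d (delta_mx 0 i) xi.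
Proof.
move=> ad cx tx dx; rewrite -[LHS]/(pot A sg (chart_at (sg xi)) (delta_mx 0 i) xi).
have [ak kx] : atlas (chart_at (sg xi)) /\ cdom (chart_at (sg xi)) (sg xi).
  exact: svalP (cid (atlas_cover (sg xi))).
exact: pot_chart (tsec_mdiff cx tx) ak ad kx dx.
Qed.

Definition pot_dom d := c @` (tdom t `&` cdom c `&` tsec t @^-1` cdom d).

Lemma pot_dom_open d : open (pot_dom d).
Proof. exact: smooth_dom_open (tdom_open t) (tsec_smooth t). Qed.

Lemma pot_domP d xi : pot_dom d xi ->
  [/\ (c @` cdom c) xi, tdom t (cinv c xi) & cdom d (tsec t (cinv c xi))].
Proof. by move=> [x [[tx cx] dx] <-]; rewrite !cmapK//; split=> //; exists x. Qed.

Lemma pot_dom_in d x : tdom t x -> cdom c x -> cdom d (tsec t x) -> pot_dom d (c x).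
Proof. by move=> tx cx dx; exists x. Qed.

Lemma sg_smooth d : atlas d -> Cinf (pot_dom d) (fun xi => d (sg xi)).
Proof. by move=> ad; have [_] := tsec_smooth t; apply. Qed.

Lemma local_curvatureE d i j xi : atlas d -> pot_dom d xi ->
  local_curvature A t c i j xi =
  Omega A d (sg xi) ('D_(delta_mx 0 i) (fun z => d (sg z)) xi)
    ('D_(delta_mx 0 j) (fun z => d (sg z)) xi).
Proof.
move=> ad dx; have [cx tx dsx] := pot_domP dx.
rewrite -(pot_curvature A _ _ ad (@pot_dom_open d) dx (sg_smooth ad 2%N) dsx).
have E k : \forall z \near xi, local_potential A t c k z = pot A sg d (delta_mx 0 k) z.
  have : \forall z \near xi, pot_dom d z.
    by apply: open_nbhs_nbhs; split => //; exact: pot_dom_open.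
  by apply: filterS => z /pot_domP[]; exact: local_potentialE.
rewrite /local_curvature !(local_potentialE _ ad cx tx dsx).
exact: (congr2 (fun a b => a - b + _) (near_eq_derive _ (E j)) (near_eq_derive _ (E i))).
Qed.

End GaugePotential.

(** * Gauge transformations *)

Section LocalMaps.
Variables (R : realType) (n m p : nat) (G : lieGroup R n) (M : manifold R m).
Variables (P : principal_bundle G M) (N : manifold R p) (rho : gaction G N).
Variable phi : assoc_section P rho.
Local Notation ra := (@ract _ _ _ _ _ P).
Local Notation pj := (@Defs.proj _ _ _ _ _ P).
Local Notation l := (lchart G).
Local Notation e := (lone G).
Local Opaque derive.

Let raS : smooth2 ra := @ract_smooth _ _ _ _ _ P.
Let rhoS : smooth2 rho := @act_smooth _ _ _ _ _ rho.
Let la : atlas l := @lchart_atlas _ _ G.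
Let le : cdom l e := @lchart_one _ _ G.

Lemma asec_local (t : bundle_triv P) x : tdom t x -> asec phi x (tsec t x, local_map phi t x).
Proof.
move=> tx; rewrite /local_map; case: (cid _) => z /= [pz ->].
exists (linv (tfib t z.1)); rewrite linvK; congr pair.
have tpz : tdom t (pj z.1) by rewrite pz.
by rewrite -{1}(tfibK tpz) -ractM lmulgV ract1 pz.
Qed.

Lemma local_map_smooth (t : bundle_triv P) : smooth_on (tdom t) (local_map phi t).
Proof. by apply: (asec_smooth (a := phi)) => x; exact: asec_local. Qed.

Definition transition (t t' : bundle_triv P) (x : M) : G := tfib t (tsec t' x).

Lemma tsec_change (t t' : bundle_triv P) x : tdom t x -> tdom t' x ->
  tsec t' x = ra (tsec t x) (transition t t' x).
Proof.
move=> tx t'x; have px := tsecK t'x.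
have tpx : tdom t (pj (tsec t' x)) by rewrite px.
by have := tfibK tpx; rewrite px.
Qed.

(** Both local values are representatives in the same G-orbit. Since G acts freely on P, the element
    relating them is determined by the two sections, hence is the transition function. *)
Lemma local_map_change (t t' : bundle_triv P) x : tdom t x -> tdom t' x ->
  local_map phi t' x = rho (linv (transition t t' x)) (local_map phi t x).
Proof.
move=> tx t'x.
have := asec_local tx; have := asec_local t'x.
have [z [pz ->]] := asecP phi x.
move=> [g2 [s2 f2]] [g1 [s1 f1]].
have gE : lmul (linv g1) g2 = transition t t' x.
  have h : ra z.1 (lmul g2 (linv (lmul g1 (transition t t' x)))) = z.1.
    by rewrite ractM -s2 (tsec_change tx t'x) s1 -!ractM lmulA lmulgV ract1.
  have /lmul_eq1/(congr1 (@linv _ _ G)) := ract_free h.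
  by rewrite !linvK => <-; rewrite lmulA lmulVg lmul1g.
by rewrite -gE linvM linvK actM f1 -(actM rho g1) lmulgV act1 f2.
Qed.

Lemma transition_mdiffm (t t' : bundle_triv P) x : tdom t x -> tdom t' x ->
  mdiffm (transition t t') x.
Proof.
move=> tx t'x.
have [c [ac cx]] := atlas_cover x.
apply: (mdiffmP ac cx).
apply: (mdiffm_comp (F := tfib t) (f := fun xi => tsec t' (cinv c xi))).
  by apply: tsec_mdiff; rewrite ?cmapK//; exists x.
rewrite cmapK//.
apply: (smooth_on_mdiffm _ (tfib_smooth t)); last by rewrite /= tsecK.
apply: open_comp; last exact: tdom_open.
move=> q _; have [pc _] := @proj_smooth _ _ _ _ _ P; exact: pc.
Qed.

Section Change.
Variables (t t' : bundle_triv P) (c c' : chart R m M) (x : M).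
Variables (d d' : chart R (m + n) P) (k k' : chart R p N).
Hypotheses (tx : tdom t x) (t'x : tdom t' x).
Hypotheses (ac : atlas c) (ac' : atlas c') (cx : cdom c x) (c'x : cdom c' x).
Let q := tsec t x.
Let q' := tsec t' x.
Let y := local_map phi t x.
Let y' := local_map phi t' x.
Let g0 := transition t t' x.
Hypotheses (ad : atlas d) (ad' : atlas d') (dq : cdom d q) (d'q' : cdom d' q').
Hypotheses (ak : atlas k) (ak' : atlas k') (ky : cdom k y) (k'y' : cdom k' y').
Variable A : connection P.

Lemma Dm_chart q1 (B : manifold R q1) (F : M -> B) (b : chart R q1 B) v :
  mdiffm F x -> atlas b -> cdom b (F x) ->
  Dm F c' b x v = Dm F c b x (Dm id c' c x v).
Proof.
move=> dF ab bF; have cc := mdiff_cinv ac' c'x.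
have cE := cmapK c'x.
have h := @Dm_comp _ _ _ _ _ _ F (cinv c') c b (c' x) v cc.
rewrite cE in h; exact: h.
Qed.

(** The inverse transition function, normalised to be the identity at x. Its differential there lies
    in the Lie algebra and is the only inhomogeneous term in the transformation laws below. *)
Let hh z := lmul (linv (transition t t' z)) g0.

Let hhx : hh x = e. Proof. exact: lmulVg. Qed.

Let hh_mdiff : mdiffm hh x.
Proof.
apply: (mdiffmP ac cx); apply: (mdiff2 (@lmul_smooth _ _ G)
  (f := fun xi => linv (transition t t' (cinv c xi))) (g := fun=> g0)); last exact: mdiff_cst.
apply: (mdiffm_comp (F := @linv _ _ G)); last exact: mdiffm_linv.
apply: (mdiffm_comp (F := transition t t')); first exact: mdiff_cinv.
by rewrite cmapK//; exact: transition_mdiffm.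
Qed.

Let near_tt : \forall xi \near c' x, tdom t (cinv c' xi) /\ tdom t' (cinv c' xi).
Proof.
have cc := cinv_cont_at c'x.
have h1 := near_open cc (tdom_open t); have h2 := near_open cc (tdom_open t').
rewrite cmapK// in h1 h2.
by apply: filterS2 (h1 tx) (h2 t'x) => xi.
Qed.

Let tsec_mdiffm (t0 : bundle_triv P) : tdom t0 x -> mdiffm (tsec t0) x.
Proof. exact: smooth_on_mdiffm (tdom_open t0) (tsec_smooth t0). Qed.

Let local_mdiffm (t0 : bundle_triv P) : tdom t0 x -> mdiffm (local_map phi t0) x.
Proof. exact: smooth_on_mdiffm (tdom_open t0) (local_map_smooth t0). Qed.

Definition gauge_derivative v := Dm hh c' l x v.

Let q'E : q' = ra q g0. Proof. exact: tsec_change. Qed.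
Let y'E : y' = rho (linv g0) y. Proof. exact: local_map_change. Qed.

(** Differentiate tsec t' = (tsec t . g0) . hh^-1 with g0 fixed: the first factor gives the
    push-forward by g0, the second a vertical vector. *)
Lemma Dm_tsec_change v : Dm (tsec t') c' d' x v =
  Dm (ra ^~ g0) d d' q (Dm (tsec t) c d x (Dm id c' c x v))
  + fund d' q' (- gauge_derivative v).
Proof.
have cc := mdiff_cinv ac' c'x; have cE := cmapK c'x.
have h : \forall xi \near c' x, d' (tsec t' (cinv c' xi)) =
    d' (ra (ra (tsec t (cinv c' xi)) g0) (linv (hh (cinv c' xi)))).
  apply: filterS near_tt => xi [ti t'i].
  by rewrite (tsec_change ti t'i) /hh linvM linvK -ractM lmulA lmulgV lmul1g.
have E1 : Dm (tsec t') c' d' x v = 'D_v (fun xi =>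
    d' (ra (ra (tsec t (cinv c' xi)) g0) (linv (hh (cinv c' xi))))) (c' x).
  exact: near_eq_derive.
have ms : mdiff (fun xi => tsec t (cinv c' xi)) (c' x).
  by apply: (mdiffm_comp (F := tsec t) cc); rewrite cE; exact: tsec_mdiffm.
have mh : mdiff (fun xi => hh (cinv c' xi)) (c' x).
  by apply: (mdiffm_comp (F := hh) cc); rewrite cE; exact: hh_mdiff.
have mi : mdiff (fun xi => linv (hh (cinv c' xi))) (c' x).
  by apply: (mdiffm_comp (F := @linv _ _ G) mh); exact: mdiffm_linv.
have mr : mdiff (fun xi => ra (tsec t (cinv c' xi)) g0) (c' x).
  by apply: (mdiffm_comp (F := ra ^~ g0) ms); exact: (mdiffm2l raS).
have E2 := @Dm2 _ _ _ _ _ _ _ _ raS _ _ _ d' l d' (c' x) v mr mi ad' la ad'.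
rewrite cE hhx linv1 ract1 -/q -q'E in E2.
have {}E2 := E2 d'q' le d'q'.
have E3 w : Dm (ra ^~ e) d' d' q' w = w.
  have -> : ra ^~ e = id by apply/funext => z; exact: ract1.
  exact: Dm_id.
have E4 := @Dm_comp _ _ _ _ _ _ (ra ^~ g0) _ d d' (c' x) v ms.
rewrite cE -/q -q'E in E4.
have {}E4 := E4 (mdiffm2l raS _ _) ad dq ad' d'q'.
have E5 := @Dm_comp _ _ _ _ _ _ (@linv _ _ G) _ l l (c' x) v mh.
rewrite cE hhx linv1 in E5.
have {}E5 := E5 (mdiffm_linv _) la le la le.
have E6 := Dm_chart v (tsec_mdiffm tx) ad dq.
refine (etrans E1 (etrans E2 (congr2 +%R (etrans (E3 _) (etrans E4 _)) (congr1 _ (etrans E5 _))))).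
  exact: (congr1 _ E6).
exact: Dm_linv.
Qed.

(** Differentiate local_map t' = hh . (g0^-1 . local_map t). The sign of the last term is the one in
    exp (- t X) in the definition of nu. *)
Lemma Dm_local_change v : Dm (local_map phi t') c' k' x v =
  Dm (rho (linv g0)) k k' y (Dm (local_map phi t) c k x (Dm id c' c x v))
  - generator rho (gauge_derivative v) k' y'.
Proof.
have cc := mdiff_cinv ac' c'x; have cE := cmapK c'x.
have h : \forall xi \near c' x, k' (local_map phi t' (cinv c' xi)) =
    k' (rho (hh (cinv c' xi)) (rho (linv g0) (local_map phi t (cinv c' xi)))).
  apply: filterS near_tt => xi [ti t'i].
  by rewrite (local_map_change ti t'i) -actM /hh -lmulA lmulgV lmulg1.
have E1 : Dm (local_map phi t') c' k' x v = 'D_v (fun xi =>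
    k' (rho (hh (cinv c' xi)) (rho (linv g0) (local_map phi t (cinv c' xi))))) (c' x).
  exact: near_eq_derive.
have ms : mdiff (fun xi => local_map phi t (cinv c' xi)) (c' x).
  by apply: (mdiffm_comp (F := local_map phi t) cc); rewrite cE; exact: local_mdiffm.
have mh : mdiff (fun xi => hh (cinv c' xi)) (c' x).
  by apply: (mdiffm_comp (F := hh) cc); rewrite cE; exact: hh_mdiff.
have mr : mdiff (fun xi => rho (linv g0) (local_map phi t (cinv c' xi))) (c' x).
  by apply: (mdiffm_comp (F := rho (linv g0)) ms); exact: (mdiffm2r rhoS).
have E2 := @Dm2 _ _ _ _ _ _ _ _ rhoS _ _ _ l k' k' (c' x) v mh mr la ak' ak'.
rewrite cE hhx act1 -/y -y'E in E2.
have {}E2 := E2 le k'y' k'y'.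
have E3 w : Dm (rho e) k' k' y' w = w.
  have -> : (rho e : N -> N) = id by apply/funext => z; exact: act1.
  exact: Dm_id.
have E4 := @Dm_comp _ _ _ _ _ _ (rho (linv g0)) _ k k' (c' x) v ms.
rewrite cE -/y -y'E in E4.
have {}E4 := E4 (mdiffm2r rhoS _ _) ak ky ak' k'y'.
have E6 := Dm_chart v (local_mdiffm tx) ak ky.
rewrite generatorE// opprK addrC.
refine (etrans E1 (etrans E2 (congr2 +%R _ (etrans (E3 _) (etrans E4 _))))).
  by [].
exact: (congr1 _ E6).
Qed.

End Change.

End LocalMaps.

Lemma mx_bilin_eq (R : comNzRingType) n (g h : 'M[R]_n) :
  (forall v w : 'rV_n, v *m g *m w^T = v *m h *m w^T) -> g = h.
Proof.
move=> gh; apply/matrixP => i j.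
have E (a : 'M[R]_n) : a i j = ((delta_mx 0 i : 'rV_n) *m a *m (delta_mx 0 j : 'rV_n)^T) 0 0.
  by rewrite -rowE trmx_delta -colE !mxE.
by rewrite (E g) (E h) gh.
Qed.

Section LinearSums.
Variables (R : realType) (n p : nat).

Lemma linear_sum_delta (f : 'rV[R]_n -> 'rV[R]_p) v :
  (forall k u w, f (k *: u + w) = k *: f u + f w) ->
  f v = \sum_i v 0 i *: f (delta_mx 0 i).
Proof.
move=> fl.
pose F : {linear 'rV[R]_n -> 'rV[R]_p} := HB.pack f (GRing.isLinear.Build _ _ _ _ f fl).
rewrite -[f]/(F : _ -> _) {1}(row_sum_delta v) linear_sum.
by apply: eq_bigr => i _; rewrite linearZ.
Qed.

Lemma linear_mxE (f : 'rV[R]_n -> 'rV[R]_p) v :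
  (forall k u w, f (k *: u + w) = k *: f u + f w) ->
  f v = v *m \matrix_(i, j) f (delta_mx 0 i) 0 j.
Proof.
move=> fl; rewrite (linear_sum_delta v fl); apply/rowP => j.
by rewrite summxE mxE; apply: eq_bigr => i _; rewrite !mxE.
Qed.

End LinearSums.

(** * Independence of charts and trivialisations *)

Section FieldsAt.
Variables (R : realType) (n : nat).
Variables (M N : manifold R 3) (gM : metric M) (gN : metric N).
Variables (G : lieGroup R n) (rho : gaction G N).
Variables (mu : moment_map rho gN) (P : principal_bundle G M).
Variables (phi : assoc_section P rho) (A : connection P).
Local Opaque derive.
Local Notation E i := (delta_mx 0 i).

Lemma Dm_jacobian m p (X : manifold R m) (Y : manifold R p) (F : X -> Y) a b y v :
  mdiffm F y -> atlas a -> atlas b -> cdom a y -> cdom b (F y) ->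
  Dm F a b y v = v *m jacobian_mx (fun xi => b (F (cinv a xi))) (a y).
Proof.
move=> dF aa ab ay bF.
exact: (@linear_mxE _ _ _ (Dm F a b y) v (fun k u w => Dm_linear k u w dF aa ab ay bF)).
Qed.

Section Point.
Variables (c : chart R 3 M) (t : bundle_triv P) (k : chart R 3 N) (d : chart R (3 + n) P).
Variable x : M.
Let q := tsec t x.
Let y := local_map phi t x.
Hypotheses (ac : atlas c) (cx : cdom c x) (tx : tdom t x) (ak : atlas k) (ky : cdom k y).
Hypotheses (ad : atlas d) (dq : cdom d q).
Let f := fields_at gM mu phi A c t k (c x).

(** [potv] and [covd] evaluate the gauge potential and d^A phi on arbitrary tangent vectors, since a
    change of chart does not preserve the coordinate vectors. *)
Definition potv v := Dm (tsec t) c d x v *m A d (d q).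

Definition covd v := Dm (local_map phi t) c k x v - generator rho (potv v) k y.

Lemma potE i : local_potential A t c i (c x) = potv (E i).
Proof.
by rewrite (local_potentialE A ac (d := d)) ?cmapK// /pot cmapK.
Qed.

Lemma curvE i j : local_curvature A t c i j (c x) =
  Omega A d q (Dm (tsec t) c d x (E i)) (Dm (tsec t) c d x (E j)).
Proof.
refine (etrans (local_curvatureE A ac i j ad (pot_dom_in tx cx dq)) _).
exact: (congr1 (fun z => Omega A d (tsec t z) (Dm (tsec t) c d x (E i))
  (Dm (tsec t) c d x (E j))) (cmapK cx)).
Qed.

Lemma generator_sum X : generator rho X k y = \sum_a X 0 a *: generator rho (E a) k y.
Proof.
exact: (linear_sum_delta (f := fun X => generator rho X k y) X
  (fun c0 u w => generator_linear rho u w c0 ak ky)).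
Qed.

Let ts_mdiffm : mdiffm (tsec t) x.
Proof. exact: smooth_on_mdiffm (tdom_open t) (tsec_smooth t) tx. Qed.

Let lm_mdiffm : mdiffm (local_map phi t) x.
Proof. exact: smooth_on_mdiffm (tdom_open t) (local_map_smooth phi t) tx. Qed.

Lemma Dtsec_linear a u w : Dm (tsec t) c d x (a *: u + w) =
  a *: Dm (tsec t) c d x u + Dm (tsec t) c d x w.
Proof. exact: Dm_linear. Qed.

Lemma potv_linear a u w : potv (a *: u + w) = a *: potv u + potv w.
Proof. by rewrite /potv Dtsec_linear mulmxDl scalemxAl. Qed.

Lemma covd_linear a u w : covd (a *: u + w) = a *: covd u + covd w.
Proof.
rewrite /covd potv_linear (generator_linear rho _ _ a ak ky) (Dm_linear a u w lm_mdiffm)//.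
rewrite opprD scalerBr; exact: addrACA.
Qed.

Lemma fdphiE r i : fdphi f r i = covd (E i) 0 r.
Proof.
rewrite /f /fields_at /= cmapK// -/y (potE i) /covd mxE [in RHS]mxE; congr (_ + - _).
by rewrite (generator_sum (potv _)) summxE; apply: eq_bigr => a _; rewrite !mxE.
Qed.

Lemma covd_mx v : covd v = v *m (Umx f)^T.
Proof.
rewrite (linear_mxE v covd_linear); congr (_ *m _).
by apply/matrixP => i r; rewrite mxE [RHS]mxE [RHS]mxE fdphiE.
Qed.

Lemma fFE a i j : fF f a i j =
  Omega A d q (Dm (tsec t) c d x (E i)) (Dm (tsec t) c d x (E j)) 0 a.
Proof. exact: (congr1 (fun w : 'rV_n => w 0 a) (curvE i j)). Qed.

Lemma fields_admissible : admissible f.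
Proof.
have yE : local_map phi t (cinv c (c x)) = y by rewrite cmapK.
split; rewrite /f /fields_at /= ?yE.
- exact: gmx_sym.
- exact: gmx_sym.
- by move=> v v0; exact: gmx_pos.
- by move=> v v0; exact: gmx_pos.
- move=> a i j; refine (etrans (fFE a i j) (etrans _ (esym (congr1 -%R (fFE a j i))))).
  by rewrite Omega_anti mxE.
apply/matrixP => a b; rewrite !mxE -sumrN.
have iota X : generator rho X k y *m mu X k (k y) = 0 by exact: mu_iota.
have pol X Y : generator rho X k y *m mu Y k (k y) = - (generator rho Y k y *m mu X k (k y)).
  have := iota (1 *: X + Y); rewrite (generator_linear rho _ _ 1 ak ky) (mu_linear mu 1 X Y ak ky).
  rewrite !scale1r mulmxDr !mulmxDl !iota add0r addr0 => /eqP.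
  by rewrite addr_eq0 => /eqP ->; rewrite opprK.
have := pol (E a) (E b) => /matrixP/(_ 0 0); rewrite !mxE.
rewrite -sumrN => H.
under eq_bigr do rewrite !mxE mulrC.
under [RHS]eq_bigr do rewrite !mxE mulrC.
exact: H.
Qed.

End Point.

Section Related.
Hypotheses (M_oriented : oriented M) (rho_isometric : isometric rho gN)
  (rho_orientation : orientation_preserving rho).
Variables (c c' : chart R 3 M) (t t' : bundle_triv P) (k k' : chart R 3 N).
Variables (d d' : chart R (3 + n) P) (x : M).
Let q := tsec t x.
Let q' := tsec t' x.
Let y := local_map phi t x.
Let y' := local_map phi t' x.
Hypotheses (ac : atlas c) (cx : cdom c x) (tx : tdom t x) (ak : atlas k) (ky : cdom k y).
Hypotheses (ad : atlas d) (dq : cdom d q).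
Hypotheses (ac' : atlas c') (c'x : cdom c' x) (t'x : tdom t' x) (ak' : atlas k')
  (k'y' : cdom k' y').
Hypotheses (ad' : atlas d') (d'q' : cdom d' q').
Let f := fields_at gM mu phi A c t k (c x).
Let f' := fields_at gM mu phi A c' t' k' (c' x).
Let g0 := transition t t' x.
Let a0 := linv g0.
Let K := jacobian_mx (fun xi => c (cinv c' xi)) (c' x).
Let J := jacobian_mx (fun eta => k' (rho a0 (cinv k eta))) (k y).

Let KE v : Dm id c' c x v = v *m K.
Proof. exact: (Dm_jacobian v (mdiffm_id x)). Qed.

Let rhoS : smooth2 rho := @act_smooth _ _ _ _ _ rho.

Let yE' : y' = rho a0 y. Proof. exact: local_map_change. Qed.
Let k'ry : cdom k' (rho a0 y). Proof. by rewrite -yE'. Qed.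

Let JE v : Dm (rho a0) k k' y v = v *m J.
Proof. exact: (Dm_jacobian v (mdiffm2r rhoS _ _)). Qed.

Let qE' : q' = ract q g0. Proof. exact: tsec_change. Qed.
Let d'qg : cdom d' (ract q g0). Proof. by rewrite -qE'. Qed.

Let genB U V : generator rho (U - V) k' y' = generator rho U k' y' - generator rho V k' y'.
Proof.
have h := generator_linear rho V U (-1) ak' k'y'.
by rewrite !scaleN1r in h; rewrite addrC h addrC.
Qed.

Let gen_Ad Z : generator rho (Ad a0 Z) k' y' = generator rho Z k y *m J.
Proof. by rewrite yE' (generator_Ad Z ak ak' ky k'ry) JE. Qed.

(** The inhomogeneous terms cancel: both the differential of the local map and the vector field of
    the gauge potential change by - nu([gauge_derivative]). *)
Lemma covd_change v : covd c' t' k' d' x v = covd c t k d x (v *m K) *m J.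
Proof.
have X1 := Dm_tsec_change tx t'x ac ac' cx c'x ad ad' dq d'q' v.
have X2 := Dm_local_change tx t'x ac ac' cx c'x ak ak' ky k'y' v.
rewrite KE in X1 X2; rewrite JE in X2.
have P1 : potv c' t' d' x v =
    Ad a0 (potv c t d x (v *m K)) - gauge_derivative t t' c' x v.
  refine (etrans (congr1 (fun w => w *m A d' (d' q')) X1)
    (etrans (mulmxDl _ _ _) (congr2 +%R _ (cform_fund A _ ad' d'q')))).
  exact: (etrans (congr1 (fun z => _ *m A d' (d' z)) qE') (cform_Dm A _ ad ad' dq d'qg)).
rewrite /covd P1 genB gen_Ad mulmxBl; refine (etrans (congr1 (fun w => w - _) X2) _).
move: (generator rho (gauge_derivative t t' c' x v) k' y') => Z.
by move: (_ *m J) (_ *m J) => Z1 Z2; rewrite opprB addrA subrK.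
Qed.

Let Ds v := Dm (tsec t) c d x v.
Let Ds' v := Dm (tsec t') c' d' x v.

(** The vertical summands from [Dm_tsec_change] drop out by horizontality; equivariance under g0
    gives the rest. *)
Lemma Omega_change v w : Omega A d' q' (Ds' v) (Ds' w) =
  Ad a0 (Omega A d q (Ds (v *m K)) (Ds (w *m K))).
Proof.
have X1 u := Dm_tsec_change tx t'x ac ac' cx c'x ad ad' dq d'q' u.
have X u : Ds' u = Dm ((@ract _ _ _ _ _ P) ^~ g0) d d' q (Ds (u *m K))
   + fund d' q' (- gauge_derivative t t' c' x u).
  by rewrite /Ds -KE; exact: X1.
refine (etrans (congr2 (Omega A d' q') (X v) (X w)) _).
refine (etrans (Omega_horizontal A _ _ _ _ ad' d'q') _).
refine (etrans _ (Omega_equivariant A _ _ ad ad' dq d'qg)).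
exact: (congr1 (fun z => Omega A d' z _ _) qE').
Qed.

Let L : 'M[R]_n := \matrix_(i, j) Ad a0 (E i) 0 j.

Let AdL Z : Ad a0 Z = Z *m L.
Proof. exact: (@linear_mxE _ _ _ (Ad a0) Z (fun k0 u w => Ad_linear a0 k0 u w)). Qed.

Let ts_mdiffm : mdiffm (tsec t) x.
Proof. exact: smooth_on_mdiffm (tdom_open t) (tsec_smooth t) tx. Qed.

Let Ds_lin a u w : Ds (a *: u + w) = a *: Ds u + Ds w.
Proof. exact: Dm_linear. Qed.

Lemma Omega_sum v w : Omega A d q (Ds v) (Ds w) =
  \sum_i \sum_j (v 0 i * w 0 j) *: Omega A d q (Ds (E i)) (Ds (E j)).
Proof.
pose T v w := Omega A d q (Ds v) (Ds w).
have Tl w' a u u' : T (a *: u + u') w' = a *: T u w' + T u' w'.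
  refine (etrans (congr1 (fun z => Omega A d q z _) (Ds_lin a u u')) _).
  exact: Omega_linearl.
have Tr w' a u u' : T w' (a *: u + u') = a *: T w' u + T w' u'.
  refine (etrans (congr1 (fun z => Omega A d q _ z) (Ds_lin a u u')) _).
  exact: Omega_linearr.
refine (etrans (linear_sum_delta (f := T ^~ w) v (Tl w)) _).
apply: eq_bigr => i _; rewrite (linear_sum_delta (f := T (E i)) w (Tr (E i))).
by rewrite scaler_sumr; apply: eq_bigr => j _; rewrite scalerA.
Qed.

(** K is the jacobian of the change from c' to c, J that of the action of g0^-1 from k to k', and L
    the matrix of Ad (g0^-1). The two orientation hypotheses give the signs of det K and det J. *)
Lemma fields_related : related K J L f f'.
Proof.
have af := fields_admissible ac cx tx ak ky ad dq.
split.
- exact: M_oriented.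
- exact: rho_orientation.
- apply: mx_bilin_eq => v w.
  have -> : fg f' = gmx gM c' (c' x) by [].
  rewrite (gmx_compat gM v w ac' ac c'x cx) -![X in X *m _ *m _]/(Dm id c' c x _).
  rewrite -/(Dm id c' c x v) -/(Dm id c' c x w) !KE trmx_mul !mulmxA.
  by [].
- apply: mx_bilin_eq => v w.
  have -> : fh f = gmx gN k (k y) by rewrite /f /fields_at /= cmapK.
  have -> : fh f' = gmx gN k' (k' y') by rewrite /f' /fields_at /= cmapK.
  have := rho_isometric v w ak ak' ky k'ry => /= <-.
  rewrite -/(Dm (rho a0) k k' y v) -/(Dm (rho a0) k k' y w) !JE trmx_mul !mulmxA -yE'.
  by [].
- apply/matrixP => r i.
  have -> : Umx f' r i = covd c' t' k' d' x (E i) 0 r.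
    by rewrite mxE; exact: fdphiE.
  rewrite covd_change (covd_mx ac cx tx ak ky ad dq) -/f.
  have -> : (J^T *m Umx f *m K^T) r i = (K *m (Umx f)^T *m J) i r.
    by rewrite -[in LHS](trmxK (_ *m K^T)) mxE !trmx_mul !trmxK mulmxA.
  by rewrite -!mulmxA -rowE mxE.
- move=> a i j.
  rewrite (fFE k' ac' c'x t'x ad' d'q') Omega_change AdL mxE.
  apply: eq_bigr => b _; rewrite mulrC; congr (_ * _).
  rewrite Omega_sum summxE; apply: eq_bigr => i' _.
  rewrite summxE; apply: eq_bigr => j' _.
  rewrite (fFE k ac cx tx ad dq) -!rowE !mxE.
  by [].
- apply/matrixP => b r; rewrite !mxE.
  have yE0 : local_map phi t' (cinv c' (c' x)) = y' by rewrite cmapK.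
  have := congr1 (fun w : 'rV_3 => w 0 r) (gen_Ad (E b)).
  rewrite (linear_sum_delta (f := fun X => generator rho X k' y') _
    (fun c0 u w => generator_linear rho u w c0 ak' k'y')) summxE mxE.
  move=> H; refine (etrans _ (etrans H _)).
    by apply: eq_bigr => a _; rewrite !mxE /= yE0.
  by apply: eq_bigr => s _; rewrite !mxE /= cmapK.
- apply/matrixP => b r.
  have yE0 : local_map phi t' (cinv c' (c' x)) = y' by rewrite cmapK.
  have ms s : mu (Ad a0 (E b)) k' (k' y') s 0 = \sum_a L b a * mu (E a) k' (k' y') s 0.
    have lin c0 (u w : 'rV_n) : (mu (c0 *: u + w) k' (k' y'))^T =
        c0 *: (mu u k' (k' y'))^T + (mu w k' (k' y'))^T.
      by rewrite (mu_linear mu c0 u w ak' k'y') linearP.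
    have := congr1 (fun w : 'rV_3 => w 0 s)
      (linear_sum_delta (f := fun X => (mu X k' (k' y'))^T) (Ad a0 (E b)) lin).
    rewrite mxE summxE => ->; apply: eq_bigr => a _.
    by rewrite 2!mxE [L b a]mxE.
  have := congr1 (fun w : 'M[R]_(1, 1) => w 0 0)
    (@mu_equivariant _ _ _ _ _ _ mu a0 (E b) y k k' (E r) ak ak' ky k'ry).
  rewrite -/(Dm (rho a0) k k' y (E r)) JE -yE' -!rowE mxE [RHS]mxE => H.
  rewrite [RHS]mxE /= cmapK//; refine (etrans _ H).
  rewrite mxE; apply: eq_bigr => s _; rewrite ms [LHS]mulrC; congr (_ * _).
    by rewrite mxE [RHS]mxE.
  rewrite mxE; apply: eq_bigr => a _; congr (_ * _).
  by rewrite mxE /= yE0.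
Qed.

End Related.

End FieldsAt.

(** * Continuity of the integrands *)

Section Continuity.
Variables (R : realType) (T : topologicalType) (x : T).
Implicit Types (f g : T -> R).

Definition cts f := {for x, continuous f}.

Lemma cts_cst (a : R) : cts (fun=> a).
Proof. exact: cvg_cst. Qed.

Lemma cts_add f g : cts f -> cts g -> cts (fun y => f y + g y).
Proof. exact: cvgD. Qed.

Lemma cts_opp f : cts f -> cts (fun y => - f y).
Proof. exact: cvgN. Qed.

Lemma cts_mul f g : cts f -> cts g -> cts (fun y => f y * g y).
Proof. exact: cvgM. Qed.

Lemma cts_sum n (f : 'I_n -> T -> R) : (forall i, cts (f i)) -> cts (fun y => \sum_i f i y).
Proof.
elim: n f => [|n IHn] f cf.
  rewrite (_ : (fun y => _) = fun=> 0); first exact: cts_cst.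
  by apply/funext => y; rewrite big_ord0.
rewrite (_ : (fun y => _) = fun y => f ord0 y + \sum_i f (lift ord0 i) y).
  by apply: cts_add => //; exact: IHn.
by apply/funext => y; rewrite big_ord_recl.
Qed.

Lemma cts_inv f : f x != 0 -> cts f -> cts (fun y => (f y)^-1).
Proof. exact: cvgV. Qed.

Lemma cts_sqrt f : cts f -> cts (fun y => Num.sqrt (f y)).
Proof. by move=> cf; apply: (continuous_comp cf); exact: sqrt_continuous. Qed.

Lemma near_eq_cts f g : (\forall y \near x, f y = g y) -> cts f -> cts g.
Proof.
move=> fg; rewrite /cts /prop_for /continuous_at (nbhs_singleton fg) => cf.
by apply: cvg_trans cf; exact: near_eq_cvg.
Qed.

End Continuity.

Ltac cts_step := lazymatch goal with
  | |- cts ?x (fun _ => ?c) => exact: cts_cst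
  | |- cts ?x (fun y => @?a y + @?b y) => apply: (@cts_add _ _ x a b)
  | |- cts ?x (fun y => @?a y * @?b y) => apply: (@cts_mul _ _ x a b)
  | |- cts ?x (fun y => - @?a y) => apply: (@cts_opp _ _ x a)
  | |- cts ?x (fun y => Num.sqrt (@?a y)) => apply: (@cts_sqrt _ _ x a)
  | |- cts ?x (fun y => bigop _ _ _) => apply: cts_sum => ?
  | |- _ => match goal with H : _ |- _ => simple apply H end
  end.
Ltac cts := repeat cts_step.

Section ContinuousFields.
Variables (R : realType) (n : nat) (T : topologicalType) (x : T).
Variable F : T -> local_fields R n.
Local Notation cts f := (@cts R T x f).

Record cts_fields : Prop := CtsFields {
  cts_fg : forall i j, cts (fun y => fg (F y) i j);
  cts_fh : forall i j, cts (fun y => fh (F y) i j);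
  cts_fdphi : forall i j, cts (fun y => fdphi (F y) i j);
  cts_fF : forall a i j, cts (fun y => fF (F y) a i j);
  cts_fnu : forall a i, cts (fun y => fnu (F y) a i);
  cts_fmu : forall a i, cts (fun y => fmu (F y) a i) }.

Lemma cts_det (g : T -> 'M[R]_3) : (forall i j, cts (fun y => g y i j)) ->
  cts (fun y => \det (g y)).
Proof.
move=> cg; rewrite (_ : (fun y => _) = (fun y =>
  g y i0 i0 * (g y i1 i1 * g y i2 i2 - g y i1 i2 * g y i2 i1)
  - g y i0 i1 * (g y i1 i0 * g y i2 i2 - g y i1 i2 * g y i2 i0)
  + g y i0 i2 * (g y i1 i0 * g y i2 i1 - g y i1 i1 * g y i2 i0))).
  by cts.
by apply/funext => y; rewrite det3.
Qed.

(** Cramer's formula. It describes [invmx] only where the determinant is non-zero, hence on a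
    neighbourhood of x. *)
Lemma cts_invmx (g : T -> 'M[R]_3) : (forall i j, cts (fun y => g y i j)) ->
  \det (g x) != 0 -> forall i j, cts (fun y => invmx (g y) i j).
Proof.
move=> cg gx i j; have cd := cts_det cg.
have h : \forall y \near x, (\det (g y))^-1 * cof3 (g y) j i = invmx (g y) i j.
  have : \forall y \near x, \det (g y) != 0.
    exact: cvgr_neq0 cd gx.
  apply: filterS => y dy.
  by rewrite cof3_unit ?unitmxE ?unitfE// mxE mulrA mulVf// mul1r mxE.
apply: near_eq_cts h _; apply: cts_mul; first exact: cts_inv.
rewrite (_ : (fun y => _) = fun y =>
  g y (succ3 j) (succ3 i) * g y (succ3 (succ3 j)) (succ3 (succ3 i))
   - g y (succ3 j) (succ3 (succ3 i)) * g y (succ3 (succ3 j)) (succ3 i)).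
  by cts.
by apply/funext => y; rewrite mxE.
Qed.

Hypothesis cF : cts_fields.
Hypotheses (gx : \det (fg (F x)) != 0) (hx : \det (fh (F x)) != 0).

Let cg := cts_fg cF.
Let ch := cts_fh cF.
Let cp := cts_fdphi cF.
Let cFF := cts_fF cF.
Let cnu := cts_fnu cF.
Let cmu := cts_fmu cF.
Let cgi := cts_invmx cg gx.
Let chi := cts_invmx ch hx.
Let cgd := cts_det cg.
Let chd := cts_det ch.

Let cts_vol (g : T -> 'M[R]_3) i j k : (forall i j, cts (fun y => g y i j)) ->
  cts (fun y => volume (g y) i j k).
Proof.
move=> cgg; rewrite /volume; have cd := cts_det cgg.
by cts.
Qed.

Let cts_star1 (a : T -> tens1 R) i j : (forall k, cts (fun y => a y k)) ->
  cts (fun y => star1 (fg (F y)) (a y) i j).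
Proof.
move=> ca; rewrite /star1; have cv i' j' k' : cts (fun y => volume (fg (F y)) i' j' k') by exact: cts_vol.
cts.
Qed.

Let cts_star2 (a : T -> tens2 R) k : (forall i j, cts (fun y => a y i j)) ->
  cts (fun y => star2 (fg (F y)) (a y) k).
Proof.
move=> ca; rewrite /star2; have cv i' j' k' : cts (fun y => volume (fg (F y)) i' j' k') by exact: cts_vol.
cts.
Qed.

Let cts_pair1 (s t : T -> 'I_3 -> tens1 R) i j k :
  (forall l i, cts (fun y => s y l i)) -> (forall l i, cts (fun y => t y l i)) ->
  cts (fun y => pair1 (fg (F y)) (fh (F y)) (s y) (t y) i j k).
Proof.
move=> cs ct; rewrite /pair1 /wedge12.
have c1 l i' j' : cts (fun y => star1 (fg (F y)) (t y l) i' j') by exact: cts_star1.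
cts.
Qed.

Let cts_pair2 (s t : T -> 'I_3 -> tens2 R) i j k :
  (forall l i j, cts (fun y => s y l i j)) -> (forall l i j, cts (fun y => t y l i j)) ->
  cts (fun y => pair2 (fg (F y)) (fh (F y)) (s y) (t y) i j k).
Proof.
move=> cs ct; rewrite /pair2 /wedge21.
have c1 l i' : cts (fun y => star2 (fg (F y)) (t y l) i') by exact: cts_star2.
cts.
Qed.

Let cts_S l i j : cts (fun y => pb_Sigma (F y) l i j).
Proof.
rewrite /pb_Sigma /Sigma /wedge11.
have cv i' j' k' : cts (fun y => volume (fh (F y)) i' j' k') by exact: cts_vol.
cts.
Qed.

Let cts_N l i j : cts (fun y => pb_nu (F y) l i j).
Proof. by rewrite /pb_nu; cts. Qed.

Let cts_M l i j : cts (fun y => pb_mu_sharp (F y) l i j).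
Proof. by rewrite /pb_mu_sharp; cts. Qed.

Lemma cts_energy a1 a2 a3 a4 a5 a6 i j k :
  cts (fun y => energy_integrand a1 a2 a3 a4 a5 a6 (F y) i j k).
Proof.
rewrite /energy_integrand.
apply: cts_add; [apply: cts_add; [apply: cts_add; [apply: cts_add|]|]|].
- by apply: cts_mul; [exact: cts_cst|exact: cts_pair1].
- by apply: cts_mul; [exact: cts_cst|exact: cts_pair2].
- by apply: cts_mul; [exact: cts_cst|exact: cts_pair2].
- by apply: cts_mul; [exact: cts_cst|exact: cts_pair2].
- by apply: cts_pair2 => // l i' j'; cts.
Qed.

Lemma cts_degree i j k : cts (fun y => degree_integrand (F y) i j k).
Proof.
rewrite /degree_integrand /pb_volume /pb_mu /wedge21 /wedge11.
have cv i' j' k' : cts (fun y => volume (fh (F y)) i' j' k') by exact: cts_vol.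
cts.
Qed.

End ContinuousFields.

Lemma cts_coord (R : realType) (T : topologicalType) (x : T) m n (F : T -> 'M[R]_(m, n)) i j :
  {for x, continuous F} -> cts x (fun y => F y i j).
Proof.
move=> cF; apply: (continuous_comp (g := fun A : 'M[R]_(m, n) => A i j) cF).
exact: coord_continuous.
Qed.

Section FieldsContinuity.
Variables (R : realType) (n : nat).
Variables (M N : manifold R 3) (gM : metric M) (gN : metric N).
Variables (G : lieGroup R n) (rho : gaction G N).
Variables (mu : moment_map rho gN) (P : principal_bundle G M).
Variables (phi : assoc_section P rho) (A : connection P).
Local Opaque derive.
Local Notation E i := (delta_mx 0 i).
Variables (c : chart R 3 M) (t : bundle_triv P) (k : chart R 3 N).
Variable x : M.
Hypotheses (ac : atlas c) (cx : cdom c x) (tx : tdom t x) (ak : atlas k)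
  (kx : cdom k (local_map phi t x)).
Local Notation cts f := (@cts R _ (c x) f).
Local Notation l := (lchart G).
Local Notation e := (lone G).

Let lm xi := local_map phi t (cinv c xi).
Let eta xi := k (lm xi).
Let W := c @` (tdom t `&` cdom c `&` local_map phi t @^-1` cdom k).

Let W_open : open W.
Proof. exact: smooth_dom_open (tdom_open t) (local_map_smooth phi t). Qed.

Let Wx : W (c x). Proof. by exists x. Qed.

Let eta_smooth : Cinf W eta.
Proof. by have [_] := local_map_smooth phi t; apply. Qed.

Let eta_cont : {for c x, continuous eta}.
Proof. exact: Cinf_cont eta_smooth Wx. Qed.

Let eta_x : eta (c x) = k (local_map phi t x).
Proof. by rewrite /eta /lm cmapK. Qed.

Let eta_comp m p (f : 'rV[R]_3 -> 'M[R]_(m, p)) i j : Cinf (k @` cdom k) f ->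
  cts (fun xi => f (eta xi) i j).
Proof.
move=> fs; apply: cts_coord; apply: (continuous_comp eta_cont).
by apply: Cinf_cont fs _; rewrite eta_x; exists (local_map phi t x).
Qed.

Let near_W : \forall xi \near c x, W xi.
Proof. by apply: open_nbhs_nbhs; split. Qed.

Let la : atlas l := @lchart_atlas _ _ G.
Let le : cdom l e := @lchart_one _ _ G.

(** In coordinates nu(X) is minus a partial derivative, at the identity, of the smooth local
    expression of the action, evaluated along the local map. *)
Lemma cts_generator X r : cts (fun xi => generator rho X k (lm xi) 0 r).
Proof.
have rhoS := @act_smooth _ _ _ _ _ rho.
pose Psi (z : 'rV[R]_n * 'rV[R]_3) := k (rho (cinv l z.1) (cinv k z.2)).
have PsiS : Cinf (rep_dom rho l k k) Psi by have [_] := rhoS; apply.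
have h : \forall xi \near c x, - 'D_(X, 0) Psi (l e, eta xi) 0 r = generator rho X k (lm xi) 0 r.
  apply: filterS near_W => _ [z [[tz cz] kz] <-].
  have lmz : lm (c z) = local_map phi t z by rewrite /lm cmapK.
  rewrite lmz (generatorE rho X ak kz) [RHS]mxE /eta lmz derive_pairl.
  by rewrite /Psi /= /Dm cmapK.
apply: near_eq_cts h _; apply: cts_opp; apply: cts_coord.
apply: (continuous_comp (f := fun xi => (l e, eta xi)) (g := fun z => 'D_(X, 0) Psi z)).
  exact: (pair_cont (f := fun=> l e) (@cst_continuous _ _ _ (c x)) eta_cont).
apply: Cinf_cont (Cinf_D (X, 0) PsiS) _.
by exists e, (local_map phi t x); rewrite act1 eta_x.
Qed.

Let sg xi := tsec t (cinv c xi).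

Section ChartOfP.
Variable d : chart R (3 + n) P.
Hypotheses (ad : atlas d) (dx : cdom d (tsec t x)).

Let U := pot_dom t c d.
Let Ux : U (c x). Proof. exact: pot_dom_in. Qed.
Let sgS : Cinf U (fun xi => d (sg xi)). Proof. exact: sg_smooth. Qed.

Let near_U : \forall xi \near c x, U xi.
Proof. by apply: open_nbhs_nbhs; split => //; exact: pot_dom_open. Qed.

Let Dsg v j : cts (fun xi => 'D_v (fun z => d (sg z)) xi 0 j).
Proof. by apply: cts_coord; exact: Cinf_cont (Cinf_D v sgS) Ux. Qed.

Let dsg_x : (d @` cdom d) (d (sg (c x))).
Proof. by exists (tsec t x) => //; rewrite /sg cmapK. Qed.

Let form_comp p (f : 'rV[R]_(3 + n) -> 'M[R]_(3 + n, p)) i j : Cinf (d @` cdom d) f ->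
  cts (fun xi => f (d (sg xi)) i j).
Proof.
move=> fs; apply: cts_coord.
apply: (continuous_comp (Cinf_cont sgS Ux)).
exact: Cinf_cont fs dsg_x.
Qed.

Let cts_mulmx m p q (f : 'rV[R]_3 -> 'M[R]_(m, p)) (g : 'rV[R]_3 -> 'M[R]_(p, q)) i j :
  (forall i j, cts (fun xi => f xi i j)) -> (forall i j, cts (fun xi => g xi i j)) ->
  cts (fun xi => (f xi *m g xi) i j).
Proof.
move=> cf cg; rewrite (_ : (fun xi => _) = fun xi => \sum_s f xi i s * g xi s j).
  by cts.
by apply/funext => xi; rewrite mxE.
Qed.

Let cts_pot v a : cts (fun xi => pot A sg d v xi 0 a).
Proof.
apply: cts_mulmx => i j; last exact: form_comp (omx_smooth A ad).
by rewrite [i]ord1; exact: Dsg.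
Qed.

Lemma cts_local_potential i a : cts (fun xi => local_potential A t c i xi 0 a).
Proof.
have cp : cts (fun xi => pot A sg d (E i) xi 0 a) by exact: cts_pot.
refine (near_eq_cts _ cp).
apply: filterS near_U => xi /pot_domP[? ? ?].
by rewrite (local_potentialE A ac (d := d)).
Qed.

(** Expansion in structure constants, which makes the bracket of continuous functions visibly
    continuous. *)
Let bracket_sum X Y : bracket G X Y =
  \sum_i \sum_j (X 0 i * Y 0 j) *: bracket G (E i) (E j).
Proof.
have Bl w a u u' := bracket_linearl A (tsec t x) a u u' w.
have Br w a u u' := bracket_linearr A (tsec t x) a u u' w.
refine (etrans (linear_sum_delta (f := (bracket G) ^~ Y) X (Bl Y)) _).
apply: eq_bigr => i _; rewrite (linear_sum_delta (f := bracket G (E i)) Y (Br (E i))).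
by rewrite scaler_sumr; apply: eq_bigr => j _; rewrite scalerA.
Qed.

Let dform_sum q u v a : cdom d q -> dform (A d) (d q) u v 0 a =
  \sum_s v 0 s * (\sum_r u 0 r * 'D_(E r) (A d) (d q) s a)
  - \sum_s u 0 s * (\sum_r v 0 r * 'D_(E r) (A d) (d q) s a).
Proof.
move=> dq; have dA := cform_diff A ad dq.
have D w s : 'D_w (A d) (d q) s a = \sum_r w 0 r * 'D_(E r) (A d) (d q) s a.
  rewrite (deriveE _ dA) {1}(row_sum_delta w) linear_sum summxE.
  by apply: eq_bigr => r _; rewrite (deriveE _ dA) linearZ mxE.
rewrite /dform !mxE; congr (_ - _); apply: eq_bigr => s _; by rewrite D.
Qed.

(** [Omega] in a fixed chart of P expresses the curvature through first derivatives of the section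
    and of A, with no derivative of the potential left. *)
Lemma cts_local_curvature i j a : cts (fun xi => local_curvature A t c i j xi 0 a).
Proof.
pose u i' xi := 'D_(E i') (fun z => d (sg z)) xi.
pose T xi := (\sum_s u j xi 0 s * (\sum_r u i xi 0 r * 'D_(E r) (A d) (d (sg xi)) s a)
  - \sum_s u i xi 0 s * (\sum_r u j xi 0 r * 'D_(E r) (A d) (d (sg xi)) s a))
  + \sum_p \sum_q (pot A sg d (E i) xi 0 p * pot A sg d (E j) xi 0 q) * bracket G (E p) (E q) 0 a.
have h : \forall xi \near c x, T xi = local_curvature A t c i j xi 0 a.
  apply: filterS near_U => xi Uxi; have [? ? dq] := pot_domP Uxi.
  rewrite (local_curvatureE A ac i j ad Uxi) /Omega mxE.
  rewrite (dform_sum _ _ _ dq); congr (_ + _).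
  rewrite bracket_sum summxE; apply: eq_bigr => p _; rewrite summxE.
  by apply: eq_bigr => q _; symmetry; exact: mxE.
apply: near_eq_cts h _.
have cu i' s : cts (fun xi => u i' xi 0 s) by exact: Dsg.
have cA r s b : cts (fun xi => 'D_(E r) (A d) (d (sg xi)) s b).
  exact: form_comp (Cinf_D _ (omx_smooth A ad)).
by rewrite /T; cts; exact: cts_pot.
Qed.

End ChartOfP.

Lemma fields_cts : cts_fields (c x) (fields_at gM mu phi A c t k).
Proof.
have [d [ad dx]] := atlas_cover (tsec t x).
have cgen a r : cts (fun xi => generator rho (E a) k (lm xi) 0 r) by exact: cts_generator.
split=> /=.
- move=> i j; apply: cts_coord; apply: Cinf_cont (gmx_smooth gM ac) _.
  by exists x.
- by move=> i j; apply: eta_comp; exact: gmx_smooth.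
- move=> r i; apply: cts_add.
    by apply: cts_coord; exact: Cinf_cont (Cinf_D _ eta_smooth) Wx.
  apply: cts_opp; apply: cts_sum => a; apply: cts_mul => //.
  exact: cts_local_potential ad dx _ _.
- by move=> a i j; exact: cts_local_curvature ad dx _ _ _.
- by move=> a r.
- by move=> a r; apply: eta_comp; exact: omx_smooth.
Qed.

End FieldsContinuity.

(** * Integration *)

Section Integration.
Variable R : realType.
Local Notation R3 := (R * R * R)%type.
(* The measurable structure carried by lebesgue3, which differs by its display
   from the one inferred on R3. *)
Local Notation mR3 := (measurableTypeR R * measurableTypeR R * measurableTypeR R)%type.
Local Notation meas3 U := (@measurable _ mR3 U).
Local Notation leb3 := (@lebesgue3 R).
Implicit Types (z : R3) (D K U : set R3) (f : R3 -> R).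

Lemma ball3E z (r : R) : ball z r = (ball z.1.1 r `*` ball z.1.2 r) `*` ball z.2 r.
Proof. by []. Qed.

Lemma measurable_ball3 z (r : R) : meas3 (ball z r).
Proof.
rewrite ball3E; apply: measurableX; last exact: measurable_ball.
by apply: measurableX; exact: measurable_ball.
Qed.

Lemma lebesgue3_ball z (r : R) : 0 <= r -> leb3 (ball z r) = ((r *+ 2) ^+ 3)%:E.
Proof.
move=> r0; rewrite ball3E /lebesgue3 product_measure1E; last 2 first.
- by apply: measurableX; exact: measurable_ball.
- exact: measurable_ball.
have mb (x : R) : measurable (ball x r : set R) by exact: measurable_ball.
have h := product_measure1E (@lebesgue_measure R) (@lebesgue_measure R) (mb z.1.1) (mb z.1.2).
have lb x := lebesgue_measure_ball x r0.
refine (etrans (congr2 mule (etrans h (congr2 mule (lb _) (lb _))) (lb _)) _).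
by rewrite -!EFinM exprSr expr2.
Qed.

(** The sigma-algebra is the product one, generated by boxes. Balls of the maximum norm are boxes,
    and those with rational centre and radius 1 / (n + 1) that lie in U form a countable cover. *)
Lemma open_measurable3 U : open U -> meas3 U.
Proof.
move=> oU.
pose T : countType := (rat * rat * rat * nat)%type.
pose c (q : T) : R3 := (ratr q.1.1.1, ratr q.1.1.2, ratr q.1.2).
pose b (q : T) : set R3 := ball (c q) q.2.+1%:R^-1.
pose B (o : option T) : set R3 := if o is Some q then
  if `[< b q `<=` U >] then b q else set0 else set0.
pose F n : set R3 := B (unpickle n).
have -> : U = \bigcup_n F n.
  apply/seteqP; split=> [z Uz|z [n _]]; last first.
    rewrite /F; case: (unpickle n) => [q|//] /=.
    by case: asboolP => // bU /bU.
  have [e /= e0 eU] : exists2 e : R, 0 < e & ball z e `<=` U.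
    by apply/nbhs_ballP; exact: open_nbhs_nbhs.
  (* With a radius below e / 2, a small ball that contains z lies in the ball of radius e about
     z. *)
  have e2 : 0 < e / 2 by rewrite divr_gt0.
  have [n _ /(_ n (leqnn n)) /= nE] := near_infty_natSinv_lt (PosNum e2).
  set s : R := n.+1%:R^-1 in nE.
  have s0 : 0 < s by rewrite invr_gt0.
  have approx (a : R) : exists q : rat, `|ratr q - a| < s.
    have /rat_in_itvoo[q] : a - s < a + s by rewrite ltrBlDr -addrA ltrDl addr_gt0.
    by rewrite in_itv /= => qa; exists q; rewrite ltr_distl.
  have [q1 h1] := approx z.1.1; have [q2 h2] := approx z.1.2.
  have [q3 h3] := approx z.2.
  pose q : T := (q1, q2, q3, n).
  have cz : ball (c q) s z by rewrite ball3E; split=> /=; [split|]; rewrite -ball_normE.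
  have FB : F (pickle q) = B (Some q) by rewrite /F; congr B; exact: pickleK.
  exists (pickle q); first exact: I.
  rewrite FB /B ifT; first exact: cz.
  apply/asboolP => y /= yb; apply: eU.
  apply: (@le_ball _ _ _ (s + s)); first by rewrite [leRHS](splitr e) lerD// ltW.
  exact: ball_triangle (ball_sym cz) yb.
apply: bigcupT_measurable => n; rewrite /F /B; case: (unpickle n) => [q|//].
by case: asboolP => [_|//]; exact: measurable_ball3.
Qed.

Lemma continuous_measurable3 D f : open D -> (forall z, D z -> {for z, continuous f}) ->
  @measurable_fun _ _ mR3 R D f.
Proof.
move=> oD fc mD; apply: (measurability _ (RGenOpens.measurableE R)) => //.
move=> _ [_ [a [b ->] <-]]; apply: open_measurable3.
rewrite openE => z [Dz fz].
have h1 : \forall y \near z, D y by exact: open_nbhs_nbhs.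
have oab : open [set` `]a, b[] by exact: interval_open.
have h2 := near_open (fc z Dz) oab fz.
exact: filterS2 h1 h2.
Qed.

(** D may have infinite measure and f no limit at its boundary. But f is bounded, being continuous
    on the compact K and zero on the rest of D, and it lives on the part of D inside a ball
    containing K, which has finite measure. *)
Lemma continuous_compact_support_integrable D K f : open D -> compact K -> K `<=` D ->
  (forall z, D z -> {for z, continuous f}) -> (forall z, D z -> ~ K z -> f z = 0) ->
  leb3.-integrable D (EFin \o f).
Proof.
move=> oD cK KD fc f0.
have mD := open_measurable3 oD.
have mf := continuous_measurable3 oD fc.
have [r r0 Kr] : exists2 r : R, 0 < r & K `<=` ball 0 r.
  have [M [_ /(_ (`|M| + 1))]] := compact_bounded cK.
  rewrite (le_lt_trans (ler_norm M)) ?ltrDl// => /(_ isT) h.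
  exists (`|M| + 2); first by rewrite ltr_wpDl.
  move=> z /h /= zM; rewrite -ball_normE /= sub0r normrN.
  by rewrite (le_lt_trans zM)// ltrD2l ltr1n.
have [C Cf] : exists C : R, forall z, D z -> `|f z| <= C.
  have cfK : compact (f @` K).
    apply: continuous_compact cK; apply: continuous_in_subspaceT => z.
    by rewrite inE => /KD; exact: fc.
  have [M [_ /(_ (`|M| + 1))]] := compact_bounded cfK.
  rewrite (le_lt_trans (ler_norm M)) ?ltrDl// => /(_ isT) h.
  exists (`|M| + 1) => z Dz; have [Kz|nKz] := pselect (K z); first by apply: h; exists z.
  by rewrite f0// normr0 addr_ge0.
pose B := D `&` ball 0 r.
have mB : meas3 B by apply: measurableI => //; exact: measurable_ball3.
have fB : leb3.-integrable B (EFin \o f).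
  apply: measurable_bounded_integrable => //.
  - apply: (@le_lt_trans _ _ (leb3 (ball 0 r))).
      apply: le_measure; rewrite ?inE//; [exact: measurable_ball3|exact: subIsetr].
    by rewrite lebesgue3_ball ?ltW// ltry.
  - apply: measurable_funS mf => //; exact: subIsetl.
  - exists C; split; first exact: num_real.
    by move=> x Cx z [Dz _]; rewrite /= (le_trans (Cf z Dz))// ltW.
refine ((integrable_mkcond (mu := leb3) (EFin \o f) mD).2 _).
have := (integrable_mkcond (mu := leb3) (EFin \o f) mB).1 fB.
suff -> : (EFin \o f) \_ B = (EFin \o f) \_ D by [].
apply/funext => z; rewrite /patch.
have [Dz|nDz] := pselect (D z); last by rewrite !memNset// => -[].
rewrite (mem_set Dz); have [bz|nbz] := pselect (ball 0 r z).
  by rewrite mem_set.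
by rewrite memNset => [|[]//]; rewrite /= f0// => /Kr.
Qed.

(** On a ball inside D continuity gives f >= f z0 / 2; the rest of D contributes a non-negative
    amount. *)
Lemma Rintegral_gt0 D f z0 : open D -> leb3.-integrable D (EFin \o f) ->
  (forall z, D z -> 0 <= f z) -> D z0 -> {for z0, continuous f} -> 0 < f z0 ->
  0 < Rintegral leb3 D f.
Proof.
move=> oD fi f0 Dz fc fz.
have mD := open_measurable3 oD.
have [r r0 rD] : exists2 r : R, 0 < r & forall z, ball z0 r z -> D z /\ f z0 / 2 <= f z.
  have h1 : \forall y \near z0, D y by exact: open_nbhs_nbhs.
  have h2 : \forall y \near z0, f z0 / 2 < f y.
    by apply: cvgr_gt fc _ _; rewrite ltr_pdivrMr// ltr_pMr// ltr1n.
  have : \forall y \near z0, D y /\ f z0 / 2 <= f y.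
    by apply: filterS2 h1 h2 => y Dy /ltW.
  by move=> /nbhs_ballP[r r0 h]; exists r.
set B := ball z0 r in rD.
have mB : meas3 B by exact: measurable_ball3.
have BD : B `<=` D by move=> z /rD[].
have -> : D = B `|` (D `\` B) by rewrite setDUK.
rewrite Rintegral_setU//; last 3 first.
- exact: measurableD.
- by rewrite setDUK.
- by rewrite disj_set2E setDIK.
apply: ltr_pwDl; last by apply: Rintegral_ge0 => z [Dz' _]; exact: f0.
have fB : leb3.-integrable B (EFin \o f) by exact: integrableS fi.
apply: (@lt_le_trans _ _ (Rintegral leb3 B (cst (f z0 / 2)))).
  have -> : Rintegral leb3 B (cst (f z0 / 2)) = f z0 / 2 * (r *+ 2) ^+ 3.
    refine (etrans (Rintegral_cst leb3 mB _) _).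
    exact: (congr1 (fun x => _ * fine x) (lebesgue3_ball z0 (ltW r0))).
  by rewrite mulr_gt0 ?divr_gt0// exprn_gt0// mulr2n addr_gt0.
apply: le_Rintegral => //; last by move=> z /rD[].
apply: measurable_bounded_integrable => //.
- by apply: (@le_lt_trans _ _ ((r *+ 2) ^+ 3)%:E); [rewrite -(lebesgue3_ball z0 (ltW r0))|exact: ltry].
- exists (f z0); split; first exact: num_real.
  move=> a fa z _ /=.
  have c0 : 0 <= f z0 / 2 by rewrite divr_ge0// ltW.
  have c1 : f z0 / 2 <= f z0 by rewrite ler_pdivrMr// ler_peMr ?ler1n// ltW.
  by rewrite ger0_norm// (le_trans c1)// ltW.
Qed.

End Integration.

Section FormIntegrals.
Variables (R : realType) (M : manifold R 3) (p : partition_of_unity M).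
Hypothesis M_compact : compact [set: M].
Local Notation R3 := (R * R * R)%type.
Local Notation leb3 := (@lebesgue3 R).
Implicit Types w : threeform M.

Definition cts_form w := forall c x, atlas c -> cdom c x ->
  {for c x, continuous (fun xi => w c xi i0 i1 i2)}.

Definition nonneg_form w := forall c x, atlas c -> cdom c x -> 0 <= w c (c x) i0 i1 i2.

Let unrow3 (v : 'rV[R]_3) : R3 := (v 0 i0, v 0 i1, v 0 i2).

Lemma unrow3K z : unrow3 (row3 z) = z.
Proof. by case: z => [[a b] c]; rewrite /unrow3 !mxE /= !inordK. Qed.

Lemma row3K v : row3 (unrow3 v) = v.
Proof.
by apply/rowP => j; rewrite !mxE; move: j; apply: ord3P; rewrite /= inordK.
Qed.

Lemma row3_cont : continuous (@row3 R).
Proof.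
move=> z; have -> : @row3 R = fun z => z.1.1 *: delta_mx 0 i0 + z.1.2 *: delta_mx 0 i1 + z.2 *: delta_mx 0 i2.
  apply/funext => y; apply/rowP => j; rewrite !mxE; move: j; apply: ord3P;
  by rewrite /= inordK// !inord3 !eqxx /=; ring.
have c11 : {for z, continuous (fun y : R3 => y.1.1)}.
  by apply: continuous_comp; exact: cvg_fst.
have c12 : {for z, continuous (fun y : R3 => y.1.2)}.
  by apply: continuous_comp; [exact: cvg_fst|exact: cvg_snd].
have c2 : {for z, continuous (fun y : R3 => y.2)} by exact: cvg_snd.
by apply: cvgD; [apply: cvgD|]; apply: cvgZr_tmp.
Qed.

Let unrow3_cont : continuous unrow3.
Proof.
move=> v.
have cc i : {for v, continuous (fun u : 'rV[R]_3 => u 0 i)} by exact: coord_continuous.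
exact: (pair_cont (pair_cont (cc i0) (cc i1)) (cc i2)).
Qed.

Let D i := @row3 R @^-1` (pu_chart i @` cdom (pu_chart (p := p) i)).
Let f w i z := pu_fun i (cinv (pu_chart (p := p) i) (row3 z))
                * w (pu_chart (p := p) i) (row3 z) i0 i1 i2.

Let D_open i : open (D i).
Proof. by apply: open_comp; [move=> z _; exact: row3_cont|exact: cimg_open]. Qed.

Let DP i z : D i z -> exists2 x, cdom (pu_chart (p := p) i) x & row3 z = pu_chart i x.
Proof. by move=> [x cx xz]; exists x. Qed.

Let f_cont w i z : cts_form w -> D i z -> {for z, continuous (f w i)}.
Proof.
move=> cw /DP[x cx xz].
have rc := @row3_cont z.
have ic : {for row3 z, continuous (cinv (pu_chart (p := p) i))}.
  by rewrite xz; exact: cinv_cont_at.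
have wc : {for row3 z, continuous (fun xi => w (pu_chart (p := p) i) xi i0 i1 i2)}.
  by rewrite xz; apply: cw => //; exact: pu_atlas.
apply: cvgM; last exact: (continuous_comp rc wc).
have pc : {for row3 z, continuous (fun v => pu_fun i (cinv (pu_chart (p := p) i) v))}.
  exact: (continuous_comp ic (@pu_cont _ _ _ p i _)).
exact: (continuous_comp rc pc).
Qed.

(** The component of w may be unbounded towards the boundary of the image of the chart. The closed
    support of the partition function is compact because M is, and lies in the chart domain, so its
    image is a compact set off which the integrand vanishes. *)
Lemma int_form_integrable w i : cts_form w -> leb3.-integrable (D i) (EFin \o f w i).
Proof.
move=> cw.
pose S := closure [set x : M | pu_fun (p := p) i x != 0].
have cS : compact S.
  by apply: (subclosed_compact _ M_compact) => //; exact: closed_closure.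
have Sd : S `<=` cdom (pu_chart (p := p) i) by exact: pu_supp.
pose K := (fun x => unrow3 (pu_chart (p := p) i x)) @` S.
apply: (@continuous_compact_support_integrable R (D i) K).
- exact: D_open.
- apply: continuous_compact cS; apply: continuous_in_subspaceT => x.
  rewrite inE => /Sd cx.
  by apply: continuous_comp; [exact: cmap_cont|exact: unrow3_cont].
- by move=> _ [x Sx <-]; rewrite /D /= row3K; exists x => //; exact: Sd.
- by move=> z; exact: f_cont.
move=> z /DP[x cx xz] nK; rewrite /f xz cmapK//.
suff -> : pu_fun i x = 0 by rewrite mul0r.
apply/eqP/negPn/negP => nz; apply: nK.
exists x; first exact: subset_closure.
by rewrite -xz unrow3K.
Qed.

Let mD i : @measurable _ (measurableTypeR R * measurableTypeR R * measurableTypeR R)%type (D i).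
Proof. exact: open_measurable3. Qed.

Let int_formE w : int_form p w = \sum_(i < pu_size p) Rintegral leb3 (D i) (f w i).
Proof. by []. Qed.

Lemma int_form_empty w : (M -> False) -> int_form p w = 0.
Proof.
move=> noM; rewrite int_formE big1// => i _.
have -> : D i = set0 by apply/seteqP; split=> // z [x]; case: (noM x).
exact: Rintegral_set0.
Qed.

Lemma int_form_lin w1 w2 (a : R) : cts_form w1 -> cts_form w2 ->
  int_form p (fun c xi i j k => w1 c xi i j k + a * w2 c xi i j k) =
  int_form p w1 + a * int_form p w2.
Proof.
move=> c1 c2; rewrite !int_formE mulr_sumr -big_split; apply: eq_bigr => i _.
have h1 := int_form_integrable i c1; have h2 := int_form_integrable i c2.
have h3 : leb3.-integrable (D i) (EFin \o (fun z => a * f w2 i z)).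
  exact: integrableZl h2.
rewrite /=; refine (etrans _ (etrans (RintegralD (mD i) h1 h3) _)).
  by apply: eq_Rintegral => z _; rewrite /f mulrDr (mulrCA a).
exact: (congr1 (+%R _) (RintegralZl a (mD i) h2)).
Qed.

Let f_ge0 w i z : nonneg_form w -> D i z -> 0 <= f w i z.
Proof.
move=> w0 /DP[x cx xz]; rewrite /f mulr_ge0 ?pu_ge0// xz.
by apply: w0 => //; exact: pu_atlas.
Qed.

Lemma int_form_ge0 w : nonneg_form w -> 0 <= int_form p w.
Proof.
move=> w0; rewrite int_formE; apply: sumr_ge0 => i _.
by apply: Rintegral_ge0 => z; exact: f_ge0.
Qed.

(** Some function of the partition is non-zero at x; in its chart a positive value of w would make
    the integral positive. Only this one chart is obtained, other charts being reached through the
    transformation law. *)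
Lemma int_form_eq0 w : cts_form w -> nonneg_form w -> int_form p w = 0 ->
  forall x, exists2 c, atlas c /\ cdom c x & w c (c x) i0 i1 i2 = 0.
Proof.
move=> cw w0 I0 x.
have [i xi] : exists i, pu_fun (p := p) i x != 0.
  apply/not_existsP => h; have := pu_sum p x.
  rewrite big1; first by move/eqP; rewrite eq_sym oner_eq0.
  by move=> i _; apply/eqP/negPn/negP => nz; exact: (h i).
have cx : cdom (pu_chart (p := p) i) x by apply: pu_supp; exact: subset_closure.
exists (pu_chart i); first by split=> //; exact: pu_atlas.
have Ii : Rintegral leb3 (D i) (f w i) = 0.
  move: I0; rewrite int_formE => /psumr_eq0P; apply => // j _.
  by apply: Rintegral_ge0 => z; exact: f_ge0.
pose z := unrow3 (pu_chart (p := p) i x).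
have rz : row3 z = pu_chart i x by exact: row3K.
have Dz : D i z by exists x.
have fz : ~ 0 < f w i z.
  move=> fz; have := Rintegral_gt0 (@D_open i) (int_form_integrable i cw)
    (fun y => @f_ge0 w i y w0) Dz (f_cont cw Dz) fz.
  by rewrite Ii ltxx.
have f0 : f w i z = 0.
  by apply/eqP; rewrite eq_le (f_ge0 w0 Dz) andbT leNgt; exact/negP.
move/eqP: f0; rewrite /f rz cmapK// mulf_eq0 (negbTE xi) /=.
by move/eqP.
Qed.

End FormIntegrals.

Lemma volume_gt0 (R : realType) (g : 'M[R]_3) : g^T = g -> posdef g ->
  0 < volume g i0 i1 i2.
Proof.
move=> gT gp; rewrite /volume lc_val !eqxx /= mulr1 sqrtr_gt0.
exact: posdef_det.
Qed.

Lemma volume_cts (R : realType) (N : manifold R 3) (gN : metric N) :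
  cts_form (fun k eta => volume (gmx gN k eta)).
Proof.
move=> c x ac cx.
apply: (@cts_mul _ _ (c x) (fun xi => Num.sqrt (\det (gmx gN c xi))) (fun=> _)); last exact: cts_cst.
apply: cts_sqrt; apply: cts_det => i j; apply: cts_coord.
by apply: Cinf_cont (gmx_smooth gN ac) _; exists x.
Qed.

Lemma Vol_ge0 (R : realType) (N : manifold R 3) (gN : metric N) (p : partition_of_unity N) :
  0 <= Vol gN p.
Proof.
apply: int_form_ge0 => c x ac cx; apply/ltW/volume_gt0; first exact: gmx_sym.
by move=> v v0; exact: gmx_pos.
Qed.

(** The point y excludes the empty manifold, whose volume is zero. *)
Lemma Vol_gt0 (R : realType) (N : manifold R 3) (gN : metric N) (p : partition_of_unity N) (y : N) :
  compact [set: N] -> 0 < Vol gN p.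
Proof.
move=> Nc; rewrite lt0r Vol_ge0 andbT; apply/eqP => V0.
have pos c x : atlas c -> cdom c x -> 0 < volume (gmx gN c (c x)) i0 i1 i2.
  move=> ac cx; apply: volume_gt0; first exact: gmx_sym.
  by move=> v v0; exact: gmx_pos.
have nn : nonneg_form (fun k eta => volume (gmx gN k eta)).
  by move=> c x ac cx; exact/ltW/pos.
have [c [ac cx] h] := int_form_eq0 Nc (@volume_cts _ _ gN) nn V0 y.
by have := pos _ _ ac cx; rewrite h ltxx.
Qed.

(** * Continuity of the densities and the energy bound *)

Section Main.
Variables (R : realType) (n : nat).
Variables (M N : manifold R 3) (gM : metric M) (gN : metric N).
Hypotheses (M_compact : compact [set: M]) (M_oriented : oriented M).
Variables (G : lieGroup R n) (rho : gaction G N).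
Hypotheses (rho_isometric : isometric rho gN)
  (rho_orientation : orientation_preserving rho).
Variables (mu : moment_map rho gN) (P : principal_bundle G M).
Variables (phi : assoc_section P rho) (A : connection P).
Local Notation F := (fields_at gM mu phi A).
Local Notation FC := (fields_in_chart gM mu phi A).

Lemma fields_at_related c c' (t t' : bundle_triv P) k k' x :
  atlas c -> cdom c x -> tdom t x -> atlas k -> cdom k (local_map phi t x) ->
  atlas c' -> cdom c' x -> tdom t' x -> atlas k' -> cdom k' (local_map phi t' x) ->
  [/\ admissible (F c t k (c x)), admissible (F c' t' k' (c' x)) &
  exists J B, related (jacobian_mx (fun xi => c (cinv c' xi)) (c' x)) J B
    (F c t k (c x)) (F c' t' k' (c' x))].
Proof.
move=> ac cx tx ak ky ac' c'x t'x ak' k'y'.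
have [d [ad dq]] := atlas_cover (tsec t x).
have [d' [ad' d'q']] := atlas_cover (tsec t' x).
split; first exact: fields_admissible ac cx tx ak ky ad dq.
  exact: fields_admissible ac' c'x t'x ak' k'y' ad' d'q'.
have := fields_related gM mu A M_oriented rho_isometric rho_orientation ac cx tx ak ky ad dq
  ac' c'x t'x ak' k'y' ad' d'q'.
by move=> h; eexists; eexists; exact: h.
Qed.

Lemma jacobian_mx_id (c : chart R 3 M) (x : M) : cdom c x ->
  jacobian_mx (fun xi => c (cinv c xi)) (c x) = 1%:M.
Proof.
move=> cx; apply/matrixP => i j; rewrite mxE -/(Dm id c c x _) Dm_id//.
by rewrite !mxE eqxx /= eq_sym.
Qed.

Lemma triv_atP (x : M) : tdom (triv_at P x) x.
Proof. exact: svalP (cid (ptriv P x)). Qed.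

Lemma chart_atP (B : manifold R 3) (y : B) : atlas (chart_at y) /\ cdom (chart_at y) y.
Proof. exact: svalP (cid (atlas_cover y)). Qed.

Lemma fields_in_chartE (c : chart R 3 M) x : cdom c x ->
  FC c (c x) = F c (triv_at P x) (chart_at (local_map phi (triv_at P x) x)) (c x).
Proof. by move=> cx; rewrite /fields_in_chart cmapK. Qed.

Lemma FC_related (c c' : chart R 3 M) (t' : bundle_triv P) k' x :
  atlas c -> cdom c x ->
  atlas c' -> cdom c' x -> tdom t' x -> atlas k' -> cdom k' (local_map phi t' x) ->
  [/\ admissible (FC c (c x)), admissible (F c' t' k' (c' x)) &
  exists J B, related (jacobian_mx (fun xi => c (cinv c' xi)) (c' x)) J B
    (FC c (c x)) (F c' t' k' (c' x))].
Proof.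
move=> ac cx; rewrite fields_in_chartE//.
by have [ak ky] := chart_atP (local_map phi (triv_at P x) x);
  apply: fields_at_related => //; exact: triv_atP.
Qed.

Lemma FC_admissible c x : atlas c -> cdom c x -> admissible (FC c (c x)).
Proof.
move=> ac cx; have [ak ky] := chart_atP (local_map phi (triv_at P x) x).
by have [] := FC_related ac cx ac cx (triv_atP x) ak ky.
Qed.

(** Near x the trivialisation and the chart of N chosen at x can be used at all points. The chart of
    M stays the same, so the factor det K is 1 and the density is unchanged; with fixed choices its
    continuity is that of the fields. *)
Lemma FC_cts (e : local_fields R n -> tens3 R) :
  (forall K J B f f', admissible f -> admissible f' -> related K J B f f' ->
    e f' i0 i1 i2 = \det K * e f i0 i1 i2) ->
  (forall x (H : 'rV[R]_3 -> local_fields R n), cts_fields x H ->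
    \det (fg (H x)) != 0 -> \det (fh (H x)) != 0 -> cts x (fun y => e (H y) i0 i1 i2)) ->
  cts_form (fun c xi => e (FC c xi)).
Proof.
move=> eR eC c x ac cx.
pose t := triv_at P x; have tx : tdom t x by exact: triv_atP.
pose k := chart_at (local_map phi t x).
have [ak kx] : atlas k /\ cdom k (local_map phi t x) by exact: chart_atP.
have h : \forall xi \near c x, e (F c t k xi) i0 i1 i2 = e (FC c xi) i0 i1 i2.
  have oW := @smooth_dom_open _ _ _ _ _ _ _ c k (tdom_open t) (local_map_smooth phi t).
  have : \forall xi \near c x, (c @` (tdom t `&` cdom c `&` local_map phi t @^-1` cdom k)) xi.
    by apply: open_nbhs_nbhs; split=> //; exists x.
  apply: filterS => _ [z [[tz cz] kz] <-].
  have [af af' [J [B r]]] := FC_related ac cz ac cz tz ak kz.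
  by rewrite (eR _ _ _ _ _ af af' r) jacobian_mx_id// det1 mul1r.
apply: near_eq_cts h _.
have [d [ad dq]] := atlas_cover (tsec t x).
have af := fields_admissible gM mu A ac cx tx ak kx ad dq.
apply: eC; first exact: fields_cts.
  by rewrite gt_eqF// posdef_det ?(adm_gT af)//; exact: (adm_gp af).
by rewrite gt_eqF// posdef_det ?(adm_hT af)//; exact: (adm_hp af).
Qed.

Lemma energy_cts c1 c2 c3 c4 c5 c6 :
  cts_form (fun c xi => energy_integrand c1 c2 c3 c4 c5 c6 (FC c xi)).
Proof.
apply: FC_cts => [K J B f f' af af' r|x H cH gx hx].
  exact: related_energy af af' r _ _ _ _ _ _.
exact: cts_energy.
Qed.

Lemma degree_cts : cts_form (fun c xi => degree_integrand (FC c xi)).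
Proof.
apply: FC_cts => [K J B f f' af af' r|x H cH gx hx].
  exact: related_degree af af' r.
exact: cts_degree.
Qed.

End Main.

Section Bound.
Variables (R : realType) (n : nat).
Variables (M N : manifold R 3) (gM : metric M) (gN : metric N).
Hypotheses (M_compact : compact [set: M]) (M_oriented : oriented M).
Variables (G : lieGroup R n) (rho : gaction G N).
Hypotheses (rho_isometric : isometric rho gN)
  (rho_orientation : orientation_preserving rho).
Variables (mu : moment_map rho gN) (P : principal_bundle G M).
Variables (phi : assoc_section P rho) (A : connection P) (pM : partition_of_unity M).
Variables alpha beta gamma : R.
Local Notation FC := (fields_in_chart gM mu phi A).

Let wE : threeform M := fun c xi => energy_integrand 1 (1 + alpha ^+ 2) (gamma ^+ 2)
  (9 + beta ^+ 2) (2 * alpha * gamma) (2 * (3 + alpha * beta)) (FC c xi).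
Let wD : threeform M := fun c xi => degree_integrand (FC c xi).

Let E := int_form pM wE.
Let I := int_form pM wD.

Let wE_cts : cts_form wE.
Proof. exact: energy_cts. Qed.

Let wD_cts : cts_form wD.
Proof. exact: degree_cts. Qed.

Let adm c x : atlas c -> cdom c x -> admissible (FC c (c x)).
Proof. exact: FC_admissible. Qed.

(** The density |b1|^2 + |b2|^2, written as a difference so that its continuity and its integral
    come from those of the energy and degree densities. *)
Let wB : threeform M := fun c xi i j k => wE c xi i j k + - 6 * wD c xi i j k.

Let wB_E c x : atlas c -> cdom c x -> let f := FC c (c x) in
  wB c (c x) i0 i1 i2 = Q (fg f) (fh f) (hat (bps1 f)) (hat (bps1 f))
  + Q (fg f) (fh f) (hat (bps2 alpha beta gamma f)) (hat (bps2 alpha beta gamma f)).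
Proof.
move=> ac cx f; rewrite /wB /wE /wD (energy_bps _ _ _ (adm ac cx)) -/f; ring.
Qed.

Let wB_ge0 : nonneg_form wB.
Proof.
move=> c x ac cx; rewrite wB_E//; have [gT hT gp hp _ _] := adm ac cx.
by rewrite addr_ge0// Q_ge0.
Qed.

Let wB_int : int_form pM wB = E - 6 * I.
Proof. by rewrite /wB int_form_lin// mulNr. Qed.

Lemma energy_ge_degree : 6 * I <= E.
Proof. by rewrite -subr_ge0 -wB_int; exact: int_form_ge0. Qed.

Lemma energy_ge_opp_degree : - (6 * I) <= E.
Proof.
rewrite -subr_ge0 opprK -(int_form_lin pM M_compact 6 wE_cts wD_cts).
apply: int_form_ge0 => c x ac cx; have af := adm ac cx.
rewrite /wE /wD (energy_anti_bps _ _ _ af) subrK.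
by case: af => gT hT gp hp _ _; rewrite addr_ge0// Q_ge0.
Qed.

Lemma energy_eq_degree : E = 6 * I <->
  vanishes gM mu phi A (@bps1 R n) /\
  vanishes gM mu phi A (@bps2 R n alpha beta gamma).
Proof.
split=> [EI|[b1 b2]].
  have B0 : int_form pM wB = 0 by rewrite wB_int EI subrr.
  have wB_cts : cts_form wB.
    move=> c x ac cx; apply: (@cts_add _ _ (c x) (fun xi => wE c xi i0 i1 i2)
      (fun xi => - 6 * wD c xi i0 i1 i2)); first exact: wE_cts.
    apply: (@cts_mul _ _ (c x) (fun=> - 6)); [exact: cts_cst|exact: wD_cts].
  have van x : exists2 c, atlas c /\ cdom c x &
      hat (bps1 (FC c (c x))) = 0 /\ hat (bps2 alpha beta gamma (FC c (c x))) = 0.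
    have [c [ac cx] w0] := int_form_eq0 M_compact wB_cts wB_ge0 B0 x.
    exists c => //; have [gT hT gp hp _ _] := adm ac cx.
    move: w0; rewrite wB_E// => /eqP; rewrite paddr_eq0 ?Q_ge0// => /andP[q1 q2].
    by split; apply/eqP/negPn/negP => /(Q_gt0 gT hT gp hp);
      rewrite lt0r ?(negbTE q1) ?q1 ?q2.
  (* The homogeneous transformation law of b1 and b2 carries their vanishing from the chart supplied
     by the partition of unity to any chart and trivialisation. *)
  split=> x c' t' k' ac' c'x t'x ak' k'y; have [c [ac cx] [v1 v2]] := van x;
    have [af af' [J [B r]]] := FC_related gM M_oriented rho_isometric rho_orientation mu A
      ac cx ac' c'x t'x ak' k'y.
    apply/hat_eq0; first by move=> l; apply: bps1_anti; exact: adm_F.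
    by rewrite (related_bps1 af af' r) v1 mulmx0 mul0mx scaler0.
  apply/hat_eq0; first by move=> l; apply: bps2_anti; exact: adm_F.
  by rewrite (related_bps2 af af' r) v2 mulmx0 mul0mx scaler0.
apply/eqP; rewrite eq_le energy_ge_degree andbT.
(* The lower bound on E is known, so only E <= 6 I remains. It follows from positivity applied to
   the degree density minus one sixth of the energy density, which vanishes under the BPS
   equations. *)
have := int_form_lin pM M_compact (- 6^-1) wD_cts wE_cts.
set w := (X in int_form _ X) => wI.
suff : 0 <= int_form pM w by rewrite wI -/E -/I; lra.
apply: int_form_ge0 => c x ac cx; have af := adm ac cx.
have [ak ky] := chart_atP (local_map phi (triv_at P x) x).
have h1 : hat (bps1 (FC c (c x))) = 0.
  apply/(hat_eq0 (fun l => bps1_anti l (adm_F af))).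
  by rewrite fields_in_chartE//; apply: b1 => //; exact: triv_atP.
have h2 : hat (bps2 alpha beta gamma (FC c (c x))) = 0.
  apply/(hat_eq0 (fun l => bps2_anti _ _ _ l (adm_F af))).
  by rewrite fields_in_chartE//; apply: b2 => //; exact: triv_atP.
have := wB_E ac cx; rewrite /wB /w /= h1 h2.
by rewrite /Q !mulmx0 !mul0mx mxtrace0 mulr0; lra.
Qed.

End Bound.

Theorem mainTheorem3 (R : realType) (n : nat)
    (M N : manifold R 3) (gM : metric M) (gN : metric N)
    (M_compact : compact [set: M]) (N_compact : compact [set: N])
    (M_oriented : oriented M) (N_oriented : oriented N)
    (G : lieGroup R n) (rho : gaction G N)
    (rho_isometric : isometric rho gN)
    (rho_orientation : orientation_preserving rho)
    (mu : moment_map rho gN)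
    (P : principal_bundle G M)
    (pM : partition_of_unity M) (pN : partition_of_unity N)
    (alpha beta gamma : R)
    (phi : assoc_section P rho) (A : connection P) :
  let c1 := 1 in
  let c2 := 1 + alpha ^+ 2 in
  let c3 := gamma ^+ 2 in
  let c4 := 9 + beta ^+ 2 in
  let c5 := 2 * alpha * gamma in
  let c6 := 2 * (3 + alpha * beta) in
  let E := energy gM mu pM c1 c2 c3 c4 c5 c6 phi A in
  let deg := degree gM mu pM pN phi A in
  6 * Vol gN pN * `|deg| <= E /\
  (0 <= deg ->
    (E = 6 * Vol gN pN * `|deg| <->
     vanishes gM mu phi A (@bps1 R n) /\
     vanishes gM mu phi A (@bps2 R n alpha beta gamma))).
Proof.
move=> c1 c2 c3 c4 c5 c6 E deg.
set V := Vol gN pN in deg *.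
pose I := int_form pM (fun c xi => degree_integrand (fields_in_chart gM mu phi A c xi)).
have degE : deg = V^-1 * I by [].
have h1 : 6 * I <= E.
  exact: (energy_ge_degree gM M_compact M_oriented rho_isometric rho_orientation
    mu phi A pM alpha beta gamma).
have h2 : - (6 * I) <= E.
  exact: (energy_ge_opp_degree gM M_compact M_oriented rho_isometric rho_orientation
    mu phi A pM alpha beta gamma).
have h3 := energy_eq_degree gM M_compact M_oriented rho_isometric rho_orientation mu phi A pM
  alpha beta gamma.
have V0 : 0 <= V by exact: Vol_ge0.
(* For empty N the volume is zero and its inverse is 0 by convention. A section then forces M to be
   empty as well, so that all integrals vanish and the BPS equations hold vacuously. *)
have [[y _]|noN] := pselect (exists y : N, True).
  have Vp : 0 < V by exact: Vol_gt0 y N_compact.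
  have VI : 6 * V * `|deg| = 6 * `|I|.
    by rewrite degE normrM normfV (ger0_norm V0) mulrA mulfK ?gt_eqF.
  rewrite VI; split.
    have [I0|I0] := leP 0 I; first by rewrite ger0_norm.
    by rewrite ltr0_norm// mulrN.
  rewrite degE pmulr_rge0 ?invr_gt0// => I0.
  by rewrite ger0_norm.
have noM (x : M) : False.
  by apply: noN; exists (local_map phi (triv_at P x) x).
have E0 : E = 0 by exact: int_form_empty.
have I0 : I = 0 by exact: int_form_empty.
rewrite degE I0 mulr0 normr0 mulr0 E0; split=> // _; split=> // _.
by split=> x; case: (noM x).
Qed.
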